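(* Let $d\in\mathbb{N}$, $\beta>0$, $a>b\ge 0$, $\alpha\le 0$, $\mu\in\mathbb{R}$ and $\mathrm{bc}\in\{\emptyset,\mathrm{Dir},\mathrm{per}\}$. Then the sequence $(\nu_{N,\mu,\alpha}^{\mathrm{HYL}})_{N\ge1}$ satisfies a large deviation principle on $\ell_1(\mathbb{R})$ with rate $|\Lambda_N|$ and rate function $$I_{\mu,\alpha}^{\mathrm{HYL}}(x)=\beta H^{\mathrm{HYL}}_{\mu+\alpha,l.s.c.}(x)+I(x)-\inf_{y\in\ell_1(\mathbb{R})}\{\beta H^{\mathrm{HYL}}_{\mu+\alpha,l.s.c.}(y)+I(y)\},$$ where, for every $\mu\in\mathbb{R}$, $$H^{\mathrm{HYL}}_{\mu,l.s.c.}(x)=H^{\mathrm{HYL}}_\mu(x)-\frac{(\mu-aD(x))_+^2}{2(a-b)}=-\frac b2\sum_{k=1}^\infty k^2x_k^2+\begin{cases}-\mu D(x)+\frac a2D(x)^2, & D(x)\ge\frac\mu a,\\ -\frac b{a-b}\big(-\mu D(x)+\frac a2D(x)^2\big)-\frac{\mu^2}{2(a-b)}, & D(x)<\frac\mu a.\end{cases}$$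
   Context: $\Lambda_N=[-N,N]^d$, $|\Lambda_N|=(2N)^d$. For $\alpha\le 0$ and $k\in\mathbb{N}$ put $q_k^{(\alpha)}=\frac{e^{\beta\alpha k}}{(4\pi\beta)^{d/2}k^{1+d/2}}$ and $\bar q^{(\alpha)}=\sum_{k\ge1}q_k^{(\alpha)}$. Let $g_t(x,y)=(4\pi t)^{-d/2}e^{-|x-y|^2/(4t)}$; let $g_t^{(\mathrm{per})}(x,y)=\sum_{z\in\mathbb{Z}^d}g_t(x,y+2Nz)$; let $g_t^{(\mathrm{Dir})}(x,y)$ be the transition density of Brownian motion with generator $\Delta$ killed on leaving $\Lambda_N$. For $\mathrm{bc}=\emptyset$ set $q_k^{(\mathrm{bc},\alpha)}=q_k^{(\alpha)}$ for all $k$; for $\mathrm{bc}\in\{\mathrm{per},\mathrm{Dir}\}$ set $q_k^{(\mathrm{bc},\alpha)}=\frac{e^{\beta\alpha k}}{k|\Lambda_N|}\int_{\Lambda_N}g^{(\mathrm{bc})}_{k\beta}(x,x)\,dx$ for $k\le N$ and $0$ for $k>N$. Let $(\mathcal{N}_k)_k$ be independent Poisson random variables with means $|\Lambda_N|q_k^{(\mathrm{bc},\alpha)}$, and let $\nu_{N,\alpha}^{(\mathrm{bc})}$ be the law of $(\mathcal{N}_k/|\Lambda_N|)_{k\in\mathbb{N}}$ on $\ell_1(\mathbb{R}_+)\subset\ell_1(\mathbb{R})$ (norm topology). $I=I_0$: $I(x)=\sum_{k\ge1}x_k(\log\frac{x_k}{q_k^{(0)}}-1)+\bar q^{(0)}$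 for $x\in\ell_1(\mathbb{R}_+)$ and $I(x)=+\infty$ otherwise ($0\log0=0$). For $x\in\ell_1(\mathbb{R}_+)$, $D(x)=\sum_{k\ge1}kx_k\in[0,\infty]$. HYL model: $H^{\mathrm{HYL}}_\mu(x)=-\mu D(x)+\frac a2D(x)^2-\frac b2\sum_{k\ge1}k^2x_k^2$ for $x\in\ell_1(\mathbb{R}_+)$, with $H^{\mathrm{HYL}}_\mu(x)=H^{\mathrm{HYL}}_{\mu,l.s.c.}(x)=+\infty$ when $D(x)=\infty$ (consistent with $H^{\mathrm{HYL}}_\mu(x)=-\mu D(x)+\frac{a-b}2D(x)^2+\frac b2\sum_{j\ne k}jk\,x_jx_k$). Further, $\nu_{N,\mu,\alpha}^{\mathrm{HYL}}(dx)=\frac{\exp(-\beta|\Lambda_N|H^{\mathrm{HYL}}_\mu(x))}{Z_N}\nu_{N,\alpha}^{(\mathrm{bc})}(dx)$ with $Z_N$ the normalising constant. $(t)_+=\max(t,0)$. Off $\ell_1(\mathbb{R}_+)$ the rate function is $+\infty$. *)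

(* Defs.v *)
From HB Require Import structures.
From mathcomp Require Import all_boot all_order all_algebra.
From mathcomp Require Import all_classical all_reals all_analysis.
Import Order.TTheory GRing.Theory Num.Theory.
Import numFieldNormedType.Exports.

Set Implicit Arguments.
Unset Strict Implicit.
Unset Printing Implicit Defensive.

Local Open Scope classical_set_scope.
Local Open Scope ring_scope.

(* Row vectors carry the Borel sigma-algebra of R^n, generated by the
   coordinate maps. *)
Section row_vectors.
Context {R : realType}.

Section sigma_algebra.
Variable n : nat.

Definition rV_coord (i : 'I_n) (x : 'rV[R]_n) : measurableTypeR R := x 0 i.

Let rV_set0 : g_sigma_preimage rV_coord set0.
Proof. exact: sigma_algebra0. Qed.

Let rV_setC A : g_sigma_preimage rV_coord A -> g_sigma_preimage rV_coord (~` A).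
Proof. exact: sigma_algebraC. Qed.

Let rV_bigcup (F : (set 'rV[R]_n)^nat) :
  (forall i, g_sigma_preimage rV_coord (F i)) ->
  g_sigma_preimage rV_coord (\bigcup_i F i).
Proof. exact: sigma_algebra_bigcup. Qed.

HB.instance Definition _ := @isMeasurable.Build default_measure_display
  'rV[R]_n (g_sigma_preimage rV_coord) rV_set0 rV_setC rV_bigcup.

Lemma measurable_rV_coord (i : 'I_n) : measurable_fun setT (rV_coord i).
Proof.
move=> _ Y mY; rewrite setTI; apply: sub_sigma_algebra => /=.
rewrite -bigcup_seq/=; exists i => /=; first by rewrite mem_index_enum.
by exists Y => //; rewrite setTI.
Qed.

Lemma measurable_fun_rVP d (T : measurableType d) (f : T -> 'rV[R]_n) :
  (forall i, measurable_fun setT (rV_coord i \o f)) -> measurable_fun setT f.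
Proof.
move=> mf; have sub : g_sigma_preimage rV_coord `<=`
    [set A | measurable (f @^-1` A)].
  apply: smallest_sub.
    split.
    - by rewrite /= preimage_set0.
    - by move=> A /= mA; rewrite setTD preimage_setC; exact: measurableC.
    - by move=> F mF /=; rewrite preimage_bigcup; exact: bigcupT_measurable.
  move=> A; rewrite -bigcup_seq => -[i _ [B mB <-]] /=.
  by rewrite setTI -comp_preimage -[X in measurable X]setTI; exact: mf.
by move=> _ A mA; rewrite setTI; exact: sub.
Qed.

End sigma_algebra.

Definition consrV n (p : measurableTypeR R * 'rV[R]_n) : 'rV[R]_n.+1 :=
  row_mx (p.1%:M : 'rV[R]_1) p.2.

Definition unconsrV n (v : 'rV[R]_n.+1) : measurableTypeR R * 'rV[R]_n :=
  (v 0 0, rsubmx (v : 'rV[R]_(1 + n))).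

Lemma unconsrVK n : cancel (@unconsrV n) (@consrV n).
Proof.
move=> v; rewrite /consrV /unconsrV/=; rewrite -[RHS](@hsubmxK _ 1 1 n).
congr (@row_mx R 1 1 n _ _); apply/rowP => j; rewrite !ord1 !mxE eqxx mulr1n.
by congr (v _ _); apply/val_inj.
Qed.

Lemma consrVK n : cancel (@consrV n) (@unconsrV n).
Proof.
move=> [x v]; rewrite /consrV /unconsrV/=; congr pair; last first.
  by rewrite row_mxKr.
have -> : (0 : 'I_n.+1) = lshift n (0 : 'I_1) by exact/val_inj.
by rewrite [LHS]row_mxEl mxE eqxx mulr1n.
Qed.

Lemma measurable_consrV n : measurable_fun setT (@consrV n).
Proof.
apply: measurable_fun_rVP => i.
have [j ->|j ->] := @split_ordP 1 n i.
  rewrite (_ : _ \o _ = fst); first exact: measurable_fst.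
  apply/funext => -[x v] /=.
  by rewrite /rV_coord /consrV [LHS]row_mxEl mxE !ord1 eqxx mulr1n.
rewrite (_ : _ \o _ = rV_coord j \o snd).
  by apply: measurableT_comp; [exact: measurable_rV_coord|exact: measurable_snd].
by apply/funext => -[x v] /=; rewrite /rV_coord /consrV [LHS]row_mxEr.
Qed.

Lemma measurable_unconsrV n : measurable_fun setT (@unconsrV n).
Proof.
apply/measurable_fun_pairP; split.
  exact: (measurable_rV_coord 0).
apply: measurable_fun_rVP => i.
rewrite (_ : _ \o _ = rV_coord (rshift 1 i)).
  exact: measurable_rV_coord.
by apply/funext => v; rewrite /rV_coord /= mxE.
Qed.

Section lebesgue_rV_step.
Local Open Scope ereal_scope.
Variables (n : nat) (m : {sigma_finite_measure set 'rV[R]_n -> \bar R}).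

Definition lebesgue_rVS : set 'rV[R]_n.+1 -> \bar R :=
  pushforward (lebesgue_measure \x m) (@consrV n).

Let lebesgue_rVS0 : lebesgue_rVS set0 = 0.
Proof. by rewrite /lebesgue_rVS /pushforward preimage_set0 measure0. Qed.

Let lebesgue_rVS_ge0 A : 0 <= lebesgue_rVS A.
Proof. rewrite /lebesgue_rVS /pushforward; exact: measure_ge0. Qed.

Let lebesgue_rVS_sigma_additive : semi_sigma_additive lebesgue_rVS.
Proof.
have mc A : measurable A -> measurable ((@consrV n) @^-1` A).
  by move=> mA; rewrite -[X in measurable X]setTI; exact: measurable_consrV.
move=> F mF tF mUF; rewrite /lebesgue_rVS /pushforward preimage_bigcup.
apply: measure_semi_sigma_additive.
- by move=> k; exact: mc.
- apply/trivIsetP => /= i j _ _ ij; rewrite -preimage_setI.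
  by move/trivIsetP : tF => /(_ _ _ _ _ ij) ->//; rewrite preimage_set0.
- by rewrite -preimage_bigcup; exact: mc.
Qed.

HB.instance Definition _ := isMeasure.Build _ _ _ lebesgue_rVS
  lebesgue_rVS0 lebesgue_rVS_ge0 lebesgue_rVS_sigma_additive.

Let lebesgue_rVS_sigma_finite : sigma_finite setT lebesgue_rVS.
Proof.
have /sigma_finiteP[F [TF ndF Foo]] := sigma_finiteT (@lebesgue_measure R).
have /sigma_finiteP[G [TG ndG Goo]] := sigma_finiteT m.
have FGT : setT = \bigcup_k (F k `*` G k).
  rewrite -setXTT TF TG predeqE => -[x y]; split.
    move=> [/= [i _ Fix] [j _ Gjy]]; exists (maxn i j) => //; split.
    - by move: x Fix; exact/subsetPset/ndF/leq_maxl.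
    - by move: y Gjy; exact/subsetPset/ndG/leq_maxr.
  by move=> [i _ []/= ? ?]; split; exists i.
exists (fun k => (@unconsrV n) @^-1` (F k `*` G k)).
  by rewrite -preimage_bigcup -FGT preimage_setT.
move=> k; have [mF oF] := Foo k; have [mG oG] := Goo k; split.
  rewrite -[X in measurable X]setTI; apply: measurable_unconsrV => //.
  exact: measurableX.
rewrite /lebesgue_rVS /pushforward -comp_preimage.
rewrite (_ : _ \o _ = id); last by apply/funext => x; exact: consrVK.
rewrite preimage_id product_measure1E// lte_mul_pinfty// ge0_fin_numE//.
Qed.

HB.instance Definition _ := Measure_isSigmaFinite.Build _ _ _ lebesgue_rVS
  lebesgue_rVS_sigma_finite.

End lebesgue_rV_step.

Fixpoint lebesgue_rV (n : nat) : {sigma_finite_measure set 'rV[R]_n -> \bar R} :=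
  match n with
  | 0 => \d_(0 : 'rV[R]_0)
  | n'.+1 => lebesgue_rVS (lebesgue_rV n')
  end.

End row_vectors.

Section ell1.
Context {R : realType}.

Definition l1norm (x : nat -> R) : \bar R := (\sum_(0 <= k <oo) `|x k|%:E)%E.

Definition l1pred : {pred (nat -> R)} := [pred x | (l1norm x < +oo)%E].

Lemma l1norm_ge0 x : (0 <= l1norm x)%E.
Proof. by apply: nneseries_ge0 => k _ _; rewrite lee_fin. Qed.

Lemma l1norm0 : l1norm 0 = 0%E.
Proof. by apply: eseries0 => k _ _; rewrite normr0. Qed.

Lemma l1normZ (a : R) (x : nat -> R) : l1norm (a *: x) = (`|a|%:E * l1norm x)%E.
Proof.
rewrite /l1norm -nneseriesZl; last by move=> k _; rewrite lee_fin.
by apply: eq_eseriesr => k _; rewrite -EFinM -normrM.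
Qed.

Lemma ler_l1normD (x y : nat -> R) : (l1norm (x + y)%R <= l1norm x + l1norm y)%E.
Proof.
rewrite /l1norm -nneseriesD; try by move=> k _ _; rewrite lee_fin.
apply: lee_nneseries => [k _ _|k _]; first by rewrite lee_fin.
by rewrite -EFinD lee_fin ler_normD.
Qed.

Lemma l1_submod_closed : submod_closed l1pred.
Proof.
split; first by rewrite inE /= l1norm0 ltry.
move=> a x y; rewrite !inE /= => lx ly.
apply: le_lt_trans (ler_l1normD _ _) _; rewrite lte_add_pinfty// l1normZ.
by rewrite lte_mul_pinfty.
Qed.

HB.instance Definition _ := GRing.isSubmodClosed.Build R (nat -> R) l1pred
  l1_submod_closed.

End ell1.

Record l1 (R : realType) := L1 {
  l1val :> nat -> R ;
  l1valP : l1val \in l1pred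
}.

Section ell1_normed.
Context {R : realType}.

HB.instance Definition _ := [isSub for @l1val R].
HB.instance Definition _ := [Choice of l1 R by <:].
HB.instance Definition _ := [SubChoice_isSubLmodule of l1 R by <:].

Lemma l1norm_fin_num (x : l1 R) : l1norm x \is a fin_num.
Proof. by rewrite ge0_fin_numE ?l1norm_ge0//; have := l1valP x; rewrite inE. Qed.

Let norm (x : l1 R) : R := fine (l1norm x).

Let ler_normD (x y : l1 R) : norm (x + y) <= norm x + norm y.
Proof.
rewrite -lee_fin EFinD /norm !fineK ?l1norm_fin_num//.
exact: ler_l1normD.
Qed.

Let normrZ (a : R) (x : l1 R) : norm (a *: x) = `|a| * norm x.
Proof. by rewrite /norm l1normZ fineM// l1norm_fin_num. Qed.

Let normr0_eq0 (x : l1 R) : norm x = 0 -> x = 0.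
Proof.
move=> nx0; apply/val_inj/funext => k; apply/eqP; rewrite -normr_le0 -lee_fin.
have -> : 0%:E = l1norm x by rewrite -[RHS]fineK ?l1norm_fin_num//; congr EFin.
apply: le_trans (@nneseries_lim_ge _ _ xpredT 0%N k.+1 _) => //.
by rewrite big_nat_recr//= leeDr// sume_ge0// => i _; rewrite lee_fin.
Qed.

HB.instance Definition _ := Lmodule_isNormed.Build R (l1 R)
  ler_normD normrZ normr0_eq0.

Lemma l1_normE (x : l1 R) : `|x| = fine (l1norm x).
Proof. by []. Qed.

End ell1_normed.

Notation borel_l1 R := (g_sigma_algebraType (@open (l1 R))).

Section large_deviations.
Context {R : realType} {X : topologicalType}.
Local Open Scope ereal_scope.

Definition rate_function (I : X -> \bar R) :=
  (forall x, 0 <= I x) /\ lower_semicontinuous I.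

Definition large_deviation_principle (mu : nat -> set X -> \bar R)
    (speed : nat -> R) (I : X -> \bar R) :=
  [/\ rate_function I,
      forall C, closed C ->
        limn_esup (fun n => ((speed n)^-1)%:E * lne (mu n C))
          <= - ereal_inf (I @` C) &
      forall O, open O ->
        - ereal_inf (I @` O)
          <= limn_einf (fun n => ((speed n)^-1)%:E * lne (mu n O))].

(* The largest lower semicontinuous minorant of f: [nbhs x] is the full (not
   punctured) neighbourhood filter, so the value f x is taken into account. *)
Definition lsc_regularization (f : X -> \bar R) (x : X) : \bar R :=
  limf_einf f (nbhs x).

End large_deviations.

Section probability_notions.
Context {R : realType} {dO : measure_display} {Omega : measurableType dO}.
Context (P : probability Omega R).

Definition mutually_independent {I : choiceType} {dT : measure_display}
    {T : measurableType dT} (X : I -> Omega -> T) :=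
  forall (J : seq I) (A : I -> set T), uniq J -> (forall j, measurable (A j)) ->
    P (\bigcap_(j in [set` J]) (X j @^-1` A j)) =
    (\prod_(j <- J) P (X j @^-1` A j))%E.

End probability_notions.

Section heat_kernels.
Context {R : realType} {d : nat}.

Definition box (N : nat) : set 'rV[R]_d :=
  [set x | forall i, `|x 0 i| <= N%:R].

Definition gauss (t : R) (x y : 'rV[R]_d) : R :=
  (4 * pi * t) `^ (- (d%:R / 2)) *
  expR (- (\sum_(i < d) (x 0 i - y 0 i) ^+ 2) / (4 * t)).

Definition gauss_per (N : nat) (t : R) (x y : 'rV[R]_d) : \bar R :=
  (\esum_(z in [set: 'rV[int]_d])
     (gauss t x (y + (2 * N%:R) *: map_mx intr z)%R)%:E)%E.

(* The generator is the Laplacian (not half of it), so that the increment over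
   a time span t has density [gauss t]. *)
Definition brownian_motion {dO : measure_display} {Omega : measurableType dO}
    (P : probability Omega R) (W : R -> {RV P >-> 'rV[R]_d}) :=
  [/\ forall w, W 0 w = 0,
      forall w, {within `[0, +oo[, continuous (fun t => W t w)},
      forall s t (A : set 'rV[R]_d), 0 <= s -> s < t -> measurable A ->
        P [set w | A (W t w - W s w)] =
        (\int[lebesgue_rV d]_(y in A) (gauss (t - s) 0 y)%:E)%E &
      forall t : nat -> R, 0 <= t 0%N -> {homo t : m n / (m <= n)%N >-> m <= n} ->
        mutually_independent P (fun n w => W (t n.+1) w - W (t n) w)].

(* [p] is the transition density of Brownian motion killed on leaving the box.
   A density is only determined almost everywhere in the second variable;
   continuity on the box pins down the values on the diagonal. *)
Definition killed_transition_density (N : nat)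
    (p : R -> 'rV[R]_d -> 'rV[R]_d -> R) :=
  exists (dO : measure_display) (Omega : measurableType dO)
      (P : probability Omega R) (W : R -> {RV P >-> 'rV[R]_d}),
    brownian_motion W /\
    forall t, 0 < t ->
      [/\ forall x y, box N x -> box N y -> 0 <= p t x y,
          {within box N `*` box N,
            continuous (fun u : 'rV[R]_d * 'rV[R]_d => p t u.1 u.2)} &
          forall x (A : set 'rV[R]_d), box N x -> measurable A -> A `<=` box N ->
            P [set w | A (x + W t w) /\
                       forall s, 0 <= s <= t -> box N (x + W s w)] =
            (\int[lebesgue_rV d]_(y in A) (p t x y)%:E)%E].

End heat_kernels.

Variant boundary_condition := Free | Periodic | Dirichlet.

Section loop_model.
Context {R : realType}.
Context (d : nat) (beta : R).

Definition vol (N : nat) : R := ((2 * N) ^ d)%:R.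

Definition q_free (alpha : R) (k : nat) : R :=
  expR (beta * alpha * k%:R) /
  ((4 * pi * beta) `^ (d%:R / 2) * k%:R `^ (1 + d%:R / 2)).

Definition qbar (alpha : R) : \bar R :=
  (\sum_(1 <= k <oo) (q_free alpha k)%:E)%E.

(* [gDir N] stands for the Dirichlet heat kernel on [box N]. *)
Definition q_bc (gDir : nat -> R -> 'rV[R]_d -> 'rV[R]_d -> R)
    (bc : boundary_condition) (alpha : R) (N k : nat) : R :=
  let q (g : 'rV[R]_d -> \bar R) : R :=
    if (k <= N)%N then
      expR (beta * alpha * k%:R) / (k%:R * vol N) *
      fine (\int[lebesgue_rV d]_(x in box N) g x)%E
    else 0 in
  match bc with
  | Free => q_free alpha k
  | Periodic => q (fun x => gauss_per N (k%:R * beta) x x)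
  | Dirichlet => q (fun x => (gDir N (k%:R * beta) x x)%:E)
  end.

(* Loop lengths k = 1, 2, ... are shifted to the indices 0, 1, ... of
   sequences: [x k] is the density of loops of length [k.+1]. The nat argument
   of [poisson_prob] is a dummy. *)
Definition reference_law (gDir : nat -> R -> 'rV[R]_d -> 'rV[R]_d -> R)
    (bc : boundary_condition) (alpha : R) (N : nat)
    (nu : probability (borel_l1 R) R) :=
  exists (dO : measure_display) (Omega : measurableType dO)
      (P : probability Omega R) (Nk : nat -> {RV P >-> nat})
      (X : {RV P >-> borel_l1 R}),
    [/\ mutually_independent P (fun k => Nk k : Omega -> nat),
        forall k A, distribution P (Nk k) A =
          poisson_prob (vol N * q_bc gDir bc alpha N k.+1) 0 A,
        {ae P, forall w, forall k, (X w : l1 R) k = (Nk k w)%:R / vol N} &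
        forall A, measurable A -> nu A = distribution P X A].

Definition l1_nonneg : set (l1 R) := [set x | forall k, 0 <= x k].

Definition rate0 (x : l1 R) : \bar R :=
  if `[< l1_nonneg x >] then
    (\sum_(0 <= k <oo) (x k * (ln (x k / q_free 0 k.+1) - 1))%:E + qbar 0)%E
  else +oo%E.

Definition density (x : l1 R) : \bar R :=
  (\sum_(0 <= k <oo) (k.+1%:R * x k)%:E)%E.

Definition sq_density (x : l1 R) : \bar R :=
  (\sum_(0 <= k <oo) (k.+1%:R ^+ 2 * x k ^+ 2)%:E)%E.

Definition finite_density : set (l1 R) :=
  [set x | l1_nonneg x /\ (density x < +oo)%E].

Section HYL.
Context (a b : R).

(* On [finite_density] both series are finite, since [sq_density x] is at most
   [density x] squared. *)
Definition H_HYL (mu : R) (x : l1 R) : \bar R :=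
  if `[< finite_density x >] then
    (- mu * fine (density x) + a / 2 * fine (density x) ^+ 2
     - b / 2 * fine (sq_density x))%:E
  else +oo%E.

Definition H_HYL_lsc (mu : R) : l1 R -> \bar R :=
  lsc_regularization (H_HYL mu).

Definition boltzmann (mu : R) (N : nat) (x : l1 R) : \bar R :=
  expeR (- ((beta * vol N)%:E * H_HYL mu x))%E.

Definition HYL_law (mu : R) (N : nat) (nu : probability (borel_l1 R) R)
    (A : set (l1 R)) : \bar R :=
  let Z := (\int[nu]_x boltzmann mu N x)%E in
  ((fine Z)^-1%:E * \int[nu]_(x in A) boltzmann mu N x)%E.

Definition rate_HYL (mu alpha : R) (x : l1 R) : \bar R :=
  let F y := (beta%:E * H_HYL_lsc (mu + alpha) y + rate0 y)%E in
  (F x - ereal_inf (range F))%E.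

End HYL.

End loop_model.

(* Main.v *)
(* The boundary condition enters only through two facts about the intensities:
   [q_k^(bc) <= (1 + o(1)) q_k^(alpha)] uniformly in k, and convergence for
   each fixed k. In the periodic case the diagonal of the kernel is a theta
   series. In the Dirichlet case it lies below the free kernel, and misses it
   by at most the density of coming back after having left the box, which is
   small away from the boundary.

   A factor [exp (beta alpha k)] in the intensity of loops of length k turns
   the weight [exp (- beta |L| H_mu)] of the intensities [q^(alpha)] into the
   weight [exp (- beta |L| H_(mu + alpha))] of the intensities [q^(0)], up to a
   constant that the normalisation cancels.

   Upper bound: near a point x the energy is bounded below by nearly its lower
   semicontinuous regularization, and the exponential Chebyshev inequality with
   finitely supported exponents yields the entropy, by duality. Exponents
   growing like log k give exponential tightness.

   Lower bound: mass put on loops of length K with [K -> oo] disappears in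
   ell_1 but keeps its density, and its entropy cost vanishes; optimising this
   extra density turns H into its regularization. It remains to bound from
   below the probability of one configuration close to such a finitely
   supported approximation of x, by Stirling's inequality. *)

Require Import Defs.
From HB Require Import structures.
From mathcomp Require Import all_boot all_order all_algebra.
From mathcomp Require Import all_classical all_reals all_analysis.
From mathcomp Require Import measurable_realfun ring lra.
Import Order.TTheory GRing.Theory Num.Theory.
Import numFieldNormedType.Exports.

Local Open Scope classical_set_scope.
Local Open Scope ring_scope.

Set Implicit Arguments.
Unset Strict Implicit.
Unset Printing Implicit Defensive.

(** * Heat kernels *)

Section cubes.
Context {R : realType}.

Definition cube n (l u : 'rV[R]_n) : set 'rV[R]_n :=
  [set x | forall i, l 0 i <= x 0 i <= u 0 i].

Lemma measurable_cube n (l u : 'rV[R]_n) : measurable (cube l u).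
Proof.
have -> : cube l u =
    \bigcap_(i in [set: 'I_n]) (@rV_coord R n i @^-1` `[l 0 i, u 0 i]%classic).
  apply/seteqP; split=> x /=.
    by move=> h i _ /=; rewrite in_itv/=; exact: h.
  by move=> h i; have := h i I; rewrite /= in_itv.
apply: fin_bigcap_measurable; first exact: finite_finset.
move=> i _; rewrite -[X in measurable X]setTI; apply: measurable_rV_coord => //.
Qed.

Lemma lebesgue_rV_cube n (l u : 'rV[R]_n) : (forall i, l 0 i <= u 0 i) ->
  lebesgue_rV n (cube l u) = (\prod_i (u 0 i - l 0 i))%:E.
Proof.
elim: n l u => [|n IH] l u lu.
  rewrite big_ord0 /= diracE mem_set// => -[]//.
pose tl (v : 'rV[R]_n.+1) : 'rV[R]_n := \row_i v 0 (lift ord0 i).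
rewrite /= /lebesgue_rVS /pushforward.
have -> : (@consrV R n) @^-1` cube l u = `[l 0 0, u 0 0]%classic `*` cube (tl l) (tl u).
  have h0 (p : measurableTypeR R * 'rV[R]_n) : consrV p 0 0 = p.1.
    by have /(congr1 fst) := consrVK p.
  have hS (p : measurableTypeR R * 'rV[R]_n) i : consrV p 0 (lift ord0 i) = p.2 0 i.
    rewrite /consrV -(@row_mxEr _ 1 1 n p.1%:M p.2 0 i); congr (_ _ _).
    exact/val_inj.
  apply/seteqP; split => -[r v] /=.
    move=> h; split; first by have := h 0; rewrite h0 /= in_itv.
    by move=> i; have := h (lift ord0 i); rewrite hS !mxE.
  rewrite in_itv /= => -[hr hv] i; case: (unliftP ord0 i) => [j ->|->].
    by rewrite hS; have := hv j; rewrite !mxE.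
  by rewrite h0.
rewrite product_measure1E//; last exact: measurable_cube.
have L := @lebesgue_measure_itv R `[l 0 0, u 0 0]; rewrite [X in (X * _)%E](_ : _ = (u 0 0 - l 0 0)%:E); last first.
  by rewrite [LHS]L /= lte_fin; have := lu 0; rewrite le_eqVlt => /predU1P[->|->]; rewrite ?ltxx ?subrr.
rewrite IH; last by move=> i; rewrite !mxE.
rewrite big_ord_recl EFinM; congr (_ * _)%E.
by congr EFin; apply: eq_bigr => i _; rewrite !mxE.
Qed.

Lemma box_cube d N : @box R d N = cube (const_mx (- N%:R)) (const_mx N%:R).
Proof.
apply/seteqP; split=> x /= h i; have := h i; rewrite !mxE ler_norml//.
Qed.

Lemma measurable_box d N : measurable (@box R d N).
Proof. by rewrite box_cube; exact: measurable_cube. Qed.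

Lemma lebesgue_rV_box d N : lebesgue_rV d (@box R d N) = (vol d N)%:E.
Proof.
rewrite box_cube lebesgue_rV_cube; last by move=> i; rewrite !mxE; have := ler0n R N; lra.
congr EFin; rewrite (eq_bigr (fun=> 2 * N%:R)).
  by rewrite prodr_const card_ord /vol natrX natrM.
by move=> i _; rewrite !mxE; ring.
Qed.

End cubes.

Section independence.
Context {R : realType} {dO : measure_display} {Omega : measurableType dO}.
Context (P : probability Omega R).
Local Open Scope ereal_scope.

Definition past {d'} {T : measurableType d'} (X : nat -> Omega -> T) (j : nat) :
    set (set Omega) :=
  [set E | exists2 A : nat -> set T, (forall i, measurable (A i)) &
     E = \bigcap_(i in [set` iota 0 j]) (X i @^-1` A i)].

Lemma past_independent d' (T : measurableType d') (X : nat -> {RV P >-> T}) j E B :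
  mutually_independent P (fun i => X i : Omega -> T) ->
  <<s past (fun i => X i : Omega -> T) j >> E -> measurable B ->
  measurable E /\ P (E `&` X j @^-1` B) = P E * P (X j @^-1` B).
Proof.
move=> iX sE mB.
have mX i A : measurable A -> measurable (X i @^-1` A).
  by move=> mA; rewrite -[X in measurable X]setTI; exact: measurable_funP.
pose H := [set E | measurable E /\ P (E `&` X j @^-1` B) = P E * P (X j @^-1` B)].
apply: (@lambda_system_subset Omega (past (fun i => X i : Omega -> T) j) _ setT H) sE.
- move=> _ _ [A mA ->] [A' mA' ->]; exists (fun i => A i `&` A' i).
    by move=> i; exact: measurableI.
  by apply/seteqP; split => [w [h h'] i ij|w h]; [split; [exact: h|exact: h']|
    split => i ij; case: (h i ij)].
- split => //.
  + by split => //; rewrite setTI probability_setT mul1e.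
  + move=> E1 E2 E21 [mE1 h1] [mE2 h2]; split; first exact: measurableD.
    have mC := mX j _ mB.
    have -> : (E1 `\` E2) `&` X j @^-1` B = (E1 `&` X j @^-1` B) `\` (E2 `&` X j @^-1` B).
      apply/seteqP; split => w.
        by move=> [[? n] ?]; split => // -[].
      by move=> [[? ?] n]; split => //; split => // ?; exact: n.
    have e : (E1 `&` X j @^-1` B) `&` (E2 `&` X j @^-1` B) = E2 `&` X j @^-1` B.
      by apply/seteqP; split => w [? ?] //; split => //; split => //; exact: E21.
    have D A A' : measurable A -> measurable A' -> P (A `\` A') = P A - P (A `&` A').
      by move=> mA mA'; apply: measureD => //; rewrite ltey_eq fin_num_measure.
    rewrite !D//; try exact: measurableI.
    rewrite e h1 h2 (setIidr E21) muleBl ?fin_num_measure//.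
    by rewrite fin_num_adde_defr ?fin_num_measure//.
  + move=> F ndF HF; split.
      by apply: bigcupT_measurable => i; case: (HF i).
    have mC := mX j _ mB.
    have mF i : measurable (F i) by case: (HF i).
    have c1 : P \o F @ \oo --> P (\bigcup_n F n).
      by apply: nondecreasing_cvg_mu => //; exact: bigcupT_measurable.
    have c2 : P \o (fun i => F i `&` X j @^-1` B) @ \oo -->
        P (\bigcup_n F n `&` X j @^-1` B).
      rewrite setI_bigcupl; apply: nondecreasing_cvg_mu => //.
      - by move=> i; exact: measurableI.
      - by apply: bigcupT_measurable => i; exact: measurableI.
      - by move=> n m nm; apply/subsetPset; apply: setSI; apply/subsetPset; exact: ndF.
    have c3 : P \o (fun i => F i `&` X j @^-1` B) @ \oo -->
        P (\bigcup_n F n) * P (X j @^-1` B).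
      rewrite (_ : _ \o _ = fun i => P (F i) * P (X j @^-1` B)).
        by apply: cvgeZr => //; rewrite fin_num_measure.
      by apply/funext => i /=; case: (HF i).
    exact: cvg_unique c2 c3.
- move=> _ [A mA ->]; split.
    by apply: fin_bigcap_measurable => // i _; exact: mX.
  pose A' i := if i == j then B else A i.
  have mA' i : measurable (A' i) by rewrite /A'; case: ifP.
  have e1 : \bigcap_(i in [set` iota 0 j]) X i @^-1` A i =
     \bigcap_(i in [set` iota 0 j]) X i @^-1` A' i.
    apply: eq_bigcapr => i /=; rewrite mem_iota add0n => /andP[_ ij].
    by rewrite /A' ltn_eqF.
  have e2 : \bigcap_(i in [set` iota 0 j]) X i @^-1` A i `&` X j @^-1` B =
     \bigcap_(i in [set` rcons (iota 0 j) j]) X i @^-1` A' i.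
    rewrite e1; apply/seteqP; split => w.
      move=> [h Bw] i /=; rewrite mem_rcons inE => /predU1P[->|ij].
        by rewrite /A' eqxx.
      exact: h.
    move=> h; split.
      by move=> i ij; apply: h; rewrite /= mem_rcons inE; apply/orP; right.
    by have := h j; rewrite /= mem_rcons mem_head /A' eqxx; exact.
  rewrite e2 e1 !iX ?iota_uniq//; last by rewrite rcons_uniq iota_uniq mem_iota/= ltnn.
  by rewrite big_rcons/= {2}/A' eqxx muleC.
- by move=> X'.
Qed.

Lemma independent_pair_le d1 d2 (T1 : measurableType d1) (T2 : measurableType d2)
    (U : {RV P >-> T1}) (V : {RV P >-> T2}) (S : set (T1 * T2)) (D : set T1)
    (c : \bar R) :
  (forall A B, measurable A -> measurable B ->
    P (U @^-1` A `&` V @^-1` B) = P (U @^-1` A) * P (V @^-1` B)) ->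
  measurable S -> measurable D -> 0 <= c ->
  (forall u, D u -> P (V @^-1` xsection S u) <= c) ->
  (forall u, ~ D u -> xsection S u = set0) ->
  P ((fun w => (U w, V w)) @^-1` S) <= c * P (U @^-1` D).
Proof.
move=> ind mS mD c0 hc hD.
have mUV : measurable_fun setT (fun w => (U w, V w)).
  by apply: measurable_fun_pair; exact: measurable_funP.
pose UV : {RV P >-> (T1 * T2)%type} := HB.pack_for {RV P >-> (T1 * T2)%type}
  (fun w => (U w, V w)) (isMeasurableFun.Build _ _ _ _ _ mUV).
have <- : (distribution P U \x distribution P V) S = P ((fun w => (U w, V w)) @^-1` S).
  exact: (@product_measure_unique _ _ _ _ _ (distribution P U) (distribution P V)
    (distribution P UV)).
rewrite -[leRHS]/(c * distribution P U D) -integral_cst// /product_measure1 /=.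
have -> : \int[distribution P U]_x distribution P V (xsection S x) =
    \int[distribution P U]_(x in D) distribution P V (xsection S x).
  rewrite [RHS]integral_mkcond; apply: eq_integral => u _.
  rewrite patchE; case: ifPn => //; rewrite notin_setE => /hD ->.
  by rewrite measure0.
apply: ge0_le_integral => //.
apply: (measurable_funS measurableT) => //.
exact: (@measurable_fun_xsection _ _ _ _ _ (distribution P V)).
Qed.

End independence.

Section integral_bounds.
Context {R : realType} {d : measure_display} {T : measurableType d}.
Context (mu : {measure set T -> \bar R}).
Local Open Scope ereal_scope.

Lemma ge0_le_integral_pointwise (D : set T) (f g : T -> \bar R) :
  (forall x, D x -> 0 <= f x) -> (forall x, D x -> f x <= g x) ->
  \int[mu]_(x in D) f x <= \int[mu]_(x in D) g x.
Proof.
move=> f0 fg; have g0 x : D x -> 0 <= g x by move=> Dx; exact: le_trans (f0 _ Dx) (fg _ Dx).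
rewrite !ge0_integralE//; apply: le_ereal_sup => _ [h hf <-]; exists h => // x.
apply: le_trans (hf x) _; rewrite !patchE; case: ifPn => // /set_mem; exact: fg.
Qed.

Lemma integral_le_cst (D : set T) (f : T -> \bar R) (c : \bar R) : measurable D ->
  (forall x, D x -> 0 <= f x) -> (forall x, D x -> f x <= c) ->
  \int[mu]_(x in D) f x <= c * mu D.
Proof.
by move=> mD f0 fc; rewrite -integral_cst//; exact: ge0_le_integral_pointwise.
Qed.

Lemma integral_ge_cst (D : set T) (f : T -> \bar R) (c : \bar R) : measurable D ->
  0 <= c -> (forall x, D x -> c <= f x) ->
  c * mu D <= \int[mu]_(x in D) f x.
Proof.
by move=> mD c0 fc; rewrite -integral_cst//; exact: ge0_le_integral_pointwise.
Qed.

End integral_bounds.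

Section gaussian.
Context {R : realType} {d : nat}.
Implicit Types (t : R) (x y : 'rV[R]_d).

Definition dist2 x y : R := \sum_(i < d) (x 0 i - y 0 i) ^+ 2.

Lemma dist2_ge0 x y : 0 <= dist2 x y.
Proof. by apply: sumr_ge0 => i _; rewrite sqr_ge0. Qed.

Lemma gauss_ge0 t x y : 0 <= gauss t x y.
Proof. by rewrite mulr_ge0 ?powR_ge0 ?expR_ge0. Qed.

Lemma gauss_le t x y : 0 < t -> gauss t x y <= (4 * pi * t) `^ (- (d%:R / 2)).
Proof.
move=> t0; rewrite /gauss ler_piMr ?powR_ge0// -[leRHS]expR0 ler_expR.
by rewrite mulNr oppr_le0 divr_ge0 ?dist2_ge0// mulr_ge0// ltW.
Qed.

Lemma gauss_diag t x : gauss t x x = (4 * pi * t) `^ (- (d%:R / 2)).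
Proof.
rewrite /gauss big1 ?oppr0 ?mul0r ?expR0 ?mulr1// => i _.
by rewrite subrr expr0n.
Qed.

(* Up to a factor [expR (- d%:R / 2)], the maximum over t of [gauss t] at distance rho. *)
Definition far_bound (rho : R) : R := (d%:R / (2 * pi * rho ^+ 2)) `^ (d%:R / 2).

Lemma gauss_far (rho t : R) x y : (0 < d)%N -> 0 < t -> 0 < rho ->
  rho ^+ 2 <= dist2 x y -> gauss t x y <= far_bound rho.
Proof.
move=> d0 t0 rho0 hr; have pi0 := @pi_gt0 R.
have dR : 0 < d%:R :> R by rewrite ltr0n.
have r20 : 0 < rho ^+ 2 by rewrite exprn_gt0.
have w0 : 0 < 4 * pi * t by rewrite !mulr_gt0.
have -> : gauss t x y = (4 * pi * t) `^ (- (d%:R / 2)) * expR (- (dist2 x y / (4 * t))).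
  by rewrite /gauss mulNr.
apply: (@le_trans _ _ ((4 * pi * t) `^ (- (d%:R / 2)) * expR (- (rho ^+ 2 / (4 * t))))).
  by rewrite ler_wpM2l ?powR_ge0// ler_expR lerN2 ler_pM2r// invr_gt0 mulr_gt0.
rewrite powRN expRN -invfM /far_bound.
have -> : d%:R / (2 * pi * rho ^+ 2) = (2 * pi * rho ^+ 2 / d%:R)^-1 :> R.
  by rewrite invf_div.
have c0 : 0 < 2 * pi * rho ^+ 2 / d%:R by rewrite divr_gt0// !mulr_gt0.
set X := 2 * pi * rho ^+ 2 / d%:R in c0 *.
have -> : X^-1 `^ (d%:R / 2) = (X `^ (d%:R / 2))^-1.
  by rewrite -powR_inv1 ?ltW// -powRrM mulN1r powRN.
rewrite lef_pV2 ?posrE ?mulr_gt0 ?powR_gt0 ?expR_gt0//.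
have -> : expR (rho ^+ 2 / (4 * t)) =
    expR (X / (4 * pi * t)) `^ (d%:R / 2).
  have aux (p r D s : R) : 0 < p -> 0 < D -> 0 < s ->
      r / (4 * s) = 2 * p * r / D / (4 * p * s) * (D / 2).
    move=> p0 D0 s0; field; by rewrite !gt_eqF.
  by rewrite -expRM /X -aux.
rewrite -powRM ?expR_ge0//; last exact: ltW.
apply: ge0_ler_powR; rewrite ?nnegrE; [by []|exact: ltW|by rewrite mulr_ge0 ?expR_ge0 ?ltW|].
rewrite -ler_pdivrMl// mulrC.
by apply: le_trans (expR_ge1Dx _); rewrite lerDr ler01.
Qed.

Lemma far_bound_ge0 rho : 0 <= far_bound rho. Proof. exact: powR_ge0. Qed.

End gaussian.

Section row_vector_measurability.
Context {R : realType} {n : nat}.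

Lemma measurable_rV_add d (T : measurableType d) (f g : T -> 'rV[R]_n) :
  measurable_fun setT f -> measurable_fun setT g ->
  measurable_fun setT (fun w => f w + g w).
Proof.
move=> mf mg; apply: measurable_fun_rVP => i.
have -> : rV_coord i \o (fun w => f w + g w) =
    (fun w => (rV_coord i \o f) w + (rV_coord i \o g) w).
  by apply/funext => w; rewrite /rV_coord /= mxE.
by apply: measurable_funD; apply: measurableT_comp => //; exact: measurable_rV_coord.
Qed.

Lemma measurable_rV_opp d (T : measurableType d) (f : T -> 'rV[R]_n) :
  measurable_fun setT f -> measurable_fun setT (fun w => - f w).
Proof.
move=> mf; apply: measurable_fun_rVP => i.
have -> : rV_coord i \o (fun w => - f w) = (fun w => - (rV_coord i \o f) w).
  by apply/funext => w; rewrite /rV_coord /= mxE.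
by apply: measurableT_comp => //; apply: measurableT_comp => //; exact: measurable_rV_coord.
Qed.

Lemma measurable_rV_sum d (T : measurableType d) (f : nat -> T -> 'rV[R]_n) j :
  (forall i, (i < j)%N -> measurable_fun setT (f i)) ->
  measurable_fun setT (fun w => \sum_(i < j) f i w).
Proof.
elim: j => [|j IH] mf.
  by under eq_fun do rewrite big_ord0; exact: measurable_cst.
under eq_fun do rewrite big_ord_recr /=.
by apply: measurable_rV_add; [apply: IH => i ij; apply: mf; exact: leqW|exact: mf].
Qed.

End row_vector_measurability.

Section killed_motion.
Context {R : realType} {d : nat}.
Context {dO : measure_display} {Omega : measurableType dO} (P : probability Omega R).
Variable W : R -> {RV P >-> 'rV[R]_d}.
Hypothesis bW : brownian_motion W.
Hypothesis d0 : (0 < d)%N.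

Let mW s : measurable_fun setT (W s : Omega -> 'rV[R]_d).
Proof. exact: measurable_funP. Qed.

Lemma increment_far (s t rho : R) (l u z : 'rV[R]_d) :
  0 <= s -> s < t -> 0 < rho -> (forall i, l 0 i <= u 0 i) ->
  (forall y, cube l u y -> rho ^+ 2 <= dist2 z y) ->
  (P [set w | cube l u (z + (W t w - W s w))%R] <=
   (@far_bound R d rho * \prod_i (u 0 i - l 0 i))%:E)%E.
Proof.
move=> s0 st rho0 lu far; case: bW => _ _ law _.
have e : [set w | cube l u (z + (W t w - W s w))] =
    [set w | cube (l - z) (u - z) (W t w - W s w)].
  apply/seteqP; split=> w /= h i; have := h i; rewrite !mxE; lra.
rewrite e law//; last exact: measurable_cube.
have -> : \prod_i (u 0 i - l 0 i) = \prod_i ((u - z) 0 i - (l - z) 0 i).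
  by apply: eq_bigr => i _; rewrite !mxE; ring.
rewrite EFinM -lebesgue_rV_cube; last by move=> i; rewrite !mxE lerB.
apply: integral_le_cst; first exact: measurable_cube.
  by move=> y _; rewrite lee_fin gauss_ge0.
move=> y hy; rewrite lee_fin; apply: gauss_far => //; first by rewrite subr_gt0.
have -> : dist2 0 y = dist2 z (z + y).
  by apply: eq_bigr => i _; rewrite !mxE; ring.
apply: far => i; have := hy i; rewrite !mxE; lra.
Qed.

Section discrete_times.
Variables (s : nat -> R) (t : R) (n : nat) (B : set 'rV[R]_d) (x l u : 'rV[R]_d).
Hypotheses (s0 : s 0%N = 0) (s_homo : {homo s : i j / (i <= j)%N >-> i <= j}).
Hypothesis st : forall j, (j < n)%N -> s j < t.
Hypothesis mB : measurable B.

Let first_exit j := [set w | (forall i, (i < j)%N -> B (x + W (s i) w)) /\ ~ B (x + W (s j) w)].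

(* Stopping the time grid at index j and then jumping to t makes the increment
   over [s j, t] independent of the event [first_exit j]. *)
Let tau j i := if (i <= j)%N then s i else t.

Let tau_homo j : (j < n)%N -> {homo tau j : i k / (i <= k)%N >-> i <= k}.
Proof.
move=> jn i k ik; rewrite /tau; case: ifPn => ij; case: ifPn => kj //.
- exact: s_homo.
- by apply: le_trans (s_homo ij) _; exact/ltW/st.
- by rewrite (leq_trans ik kj) in ij.
Qed.

Let incr j i : Omega -> 'rV[R]_d := fun w => W (tau j i.+1) w - W (tau j i) w.

Let mincr j i : measurable_fun setT (incr j i).
Proof. by apply: measurable_rV_add => //; exact: measurable_rV_opp. Qed.

Let W_sum j i w : (i <= j)%N -> W (s i) w = \sum_(k < i) incr j k w.
Proof.
case: bW => W0 _ _ _; elim: i => [|i IH] ij; first by rewrite big_ord0 s0 W0.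
rewrite big_ord_recr/= -IH; last exact: ltnW.
by rewrite /incr /tau ij (ltnW ij) addrC subrK.
Qed.

Let incrRV j i : {RV P >-> 'rV[R]_d} := HB.pack_for {RV P >-> 'rV[R]_d}
  (incr j i) (isMeasurableFun.Build _ _ _ _ _ (mincr j i)).

Let pastj j := past (fun i => incr j i) j.

Let mW_past j i : (i <= j)%N ->
  measurable_fun setT (W (s i) : g_sigma_algebraType (pastj j) -> 'rV[R]_d).
Proof.
move=> ij; have -> : (W (s i) : Omega -> _) = (fun w => \sum_(k < i) incr j k w).
  by apply/funext => w; exact: W_sum.
apply: measurable_rV_sum => k ki _ A mA; rewrite setTI.
apply: sub_sigma_algebra; exists (fun m => if m == k then A else setT).
  by move=> m; case: ifP.
apply/seteqP; split => w /=.
  by move=> Aw m _; case: eqP => // ->.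
by move=> /(_ k); rewrite eqxx; apply; rewrite /= mem_iota/= add0n (leq_trans ki).
Qed.

Let exit_bound j (c : R) : (j < n)%N -> 0 <= c ->
  (forall z, ~ B z ->
     (P [set w | cube l u (z + (W t w - W (s j) w))%R] <= c%:E)%E) ->
  (P [set w | first_exit j w /\ cube l u (x + W t w)%R] <= c%:E * P (first_exit j))%E.
Proof.
move=> jn c0 hc.
pose U w : bool * 'rV[R]_d := (`[< first_exit j w >], W (s j) w).
have mxB i : (i <= j)%N -> measurable ([set w | B (x + W (s i) w)] :
    set (g_sigma_algebraType (pastj j))).
  move=> ij; rewrite -[X in measurable X]setTI.
  have : measurable_fun setT ((fun w => x + W (s i) w) :
      g_sigma_algebraType (pastj j) -> 'rV[R]_d).
    by apply: measurable_rV_add; [exact: measurable_cst|exact: mW_past].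
  by apply.
have mfe : measurable (first_exit j : set (g_sigma_algebraType (pastj j))).
  have -> : first_exit j = \bigcap_(i in [set` iota 0 j]) [set w | B (x + W (s i) w)] `&`
      ~` [set w | B (x + W (s j) w)].
    apply/seteqP; split => w [h ?]; split => // i; last first.
      by move=> ij; apply: h; rewrite /= mem_iota.
    by rewrite /= mem_iota add0n => /andP[_]; exact: h.
  apply: measurableI; last by apply: measurableC; exact: mxB.
  apply: fin_bigcap_measurable => // i; rewrite /= mem_iota add0n => /andP[_ ij].
  by apply: mxB; exact: ltnW.
have mU : measurable_fun setT (U : g_sigma_algebraType (pastj j) -> _).
  apply: measurable_fun_pair; last exact: mW_past.
  apply: (measurable_fun_bool true); rewrite setTI.
  rewrite (_ : _ @^-1` _ = first_exit j)//.
  by apply/seteqP; split => w /=; [move/asboolP|move=> h; apply/asboolP].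
have iX : mutually_independent P (fun i => incrRV j i : Omega -> 'rV[R]_d).
  case: bW => _ _ _; apply; last exact: tau_homo.
  by rewrite /tau leq0n s0.
have ind A C : measurable A -> measurable C ->
    measurable (U @^-1` A) /\
    P (U @^-1` A `&` incrRV j j @^-1` C) = (P (U @^-1` A) * P (incrRV j j @^-1` C))%E.
  move=> mA mC; apply: past_independent => //.
  by have := mU measurableT _ mA; rewrite setTI.
have mU' : measurable_fun setT U.
  by move=> _ A mA; rewrite setTI; case: (ind A setT mA).
pose URV : {RV P >-> (bool * 'rV[R]_d)%type} :=
  HB.pack_for {RV P >-> (bool * 'rV[R]_d)%type} U (isMeasurableFun.Build _ _ _ _ _ mU').
pose D := [set q : bool * 'rV[R]_d | q.1 /\ ~ B (x + q.2)].
pose S := [set p : (bool * 'rV[R]_d) * 'rV[R]_d |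
  D p.1 /\ cube l u (x + (p.1.2 + p.2))].
have mD : measurable D.
  have -> : D = fst @^-1` [set true] `&` ~` ((fun q => x + q.2) @^-1` B) by [].
  apply: measurableI; last apply: measurableC; rewrite -[X in measurable X]setTI.
    exact: measurable_fst.
  by apply: measurable_rV_add => //; exact: measurable_snd.
have mS : measurable S.
  have -> : S = fst @^-1` D `&` (fun p => x + (p.1.2 + p.2)) @^-1` cube l u by [].
  apply: measurableI; rewrite -[X in measurable X]setTI; first exact: measurable_fst.
  apply: measurable_rV_add => //; last exact: measurable_cube.
  apply: measurable_rV_add; last exact: measurable_snd.
  by apply: measurableT_comp; [exact: measurable_snd|exact: measurable_fst].
have incE w : incr j j w = W t w - W (s j) w.
  by rewrite /incr /tau leqnn ltnn.
have inv w : (URV w).2 + incrRV j j w = W t w.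
  by rewrite /= /incr /tau leqnn ltnn addrC subrK.
have -> : [set w | first_exit j w /\ cube l u (x + W t w)] =
    (fun w => (URV w, incrRV j j w)) @^-1` S.
  apply/seteqP; split => w.
    move=> [h ?]; split; last by rewrite inv.
    by split; [apply/asboolP|case: h].
  by move=> []; rewrite inv => -[/asboolP].
have -> : first_exit j = URV @^-1` D.
  apply/seteqP; split => w; rewrite /D /=.
    by move=> h; split; [apply/asboolP|case: h].
  by move=> [/asboolP].
apply: (@independent_pair_le _ _ _ _ _ _ _ _ URV (incrRV j j)) => //.
- by move=> A C mA mC; case: (ind A C mA mC).
- move=> q Dq; have := hc _ (proj2 Dq); congr (P _ <= _)%E.
  apply/seteqP; split => w; rewrite /xsection /= inE.
    by move=> h; split => //=; rewrite incE addrA.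
  by move=> [_] /=; rewrite incE addrA.
- by move=> q nD; apply/seteqP; split => // v; rewrite /xsection /= inE => -[].
Qed.

Lemma killed_discrete (c : R) : 0 <= c ->
  (forall j z, (j < n)%N -> ~ B z ->
     (P [set w | cube l u (z + (W t w - W (s j) w))%R] <= c%:E)%E) ->
  (P [set w | cube l u (x + W t w)%R] <=
   P [set w | cube l u (x + W t w)%R /\ forall i, (i < n)%N -> B (x + W (s i) w)%R]
   + c%:E)%E.
Proof.
move=> c0 hc.
have mxW r A : measurable A -> measurable [set w | A (x + W r w)].
  move=> mA; rewrite -[X in measurable X]setTI.
  by apply: (measurable_rV_add (measurable_cst x) (mW r)).
have mfe j : measurable (first_exit j).
  have -> : first_exit j = \bigcap_(i in [set` iota 0 j]) [set w | B (x + W (s i) w)] `&`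
      ~` [set w | B (x + W (s j) w)].
    apply/seteqP; split => w [h ?]; split => // i; last first.
      by move=> ij; apply: h; rewrite /= mem_iota.
    by rewrite /= mem_iota add0n => /andP[_]; exact: h.
  by apply: measurableI; [apply: fin_bigcap_measurable => // i _; exact: mxW|
    apply: measurableC; exact: mxW].
have mcube := mxW t _ (measurable_cube l u).
set K := [set w | cube l u (x + W t w) /\ _].
have mK : measurable K.
  have -> : K = [set w | cube l u (x + W t w)] `&`
      \bigcap_(i in [set` iota 0 n]) [set w | B (x + W (s i) w)].
    apply/seteqP; split => w [hc' h]; split => // i.
      by rewrite /= mem_iota add0n => /andP[_]; exact: h.
    by move=> ij; apply: h; rewrite /= mem_iota.
  by apply: measurableI => //; apply: fin_bigcap_measurable => // i _; exact: mxW.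
pose E j := [set w | first_exit j w /\ cube l u (x + W t w)].
have mE j : measurable (E j) by apply: measurableI.
have cov : [set w | cube l u (x + W t w)] `<=` K `|` \big[setU/set0]_(j < n) E j.
  move=> w hw; have [h|/existsNP[i /not_implyP[ij nB]]] :=
    pselect (forall i, (i < n)%N -> B (x + W (s i) w)); first by left.
  right; have ex : exists i, `[< (i < n)%N /\ ~ B (x + W (s i) w) >].
    by exists i; apply/asboolP.
  case: (ex_minnP ex) => m /asboolP[mn nBm] minm.
  rewrite -bigcup_mkord; exists m => //; split => //; split => // k km.
  apply: contrapT => nBk; have /minm : `[< (k < n)%N /\ ~ B (x + W (s k) w) >].
    by apply/asboolP; split => //; exact: ltn_trans mn.
  by rewrite leqNgt km.
have mUE : measurable (\big[setU/set0]_(j < n) E j) by apply: bigsetU_measurable.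
have le1 : (P [set w | cube l u (x + W t w)%R] <= P (K `|` \big[setU/set0]_(j < n) E j))%E.
  by apply: le_measure => //; rewrite inE //; exact: measurableU.
apply: le_trans le1 _; rewrite measureU//; last first.
  apply/seteqP; split => // w []; rewrite -bigcup_mkord => -[_ h] [j /= jn [[_ nB] _]].
  by apply: nB; exact: h.
rewrite leeD2l//.
have trivE : trivIset setT first_exit.
  apply/trivIsetP => i j _ _ ij; apply/seteqP; split => // w [[h nBi] [h' nBj]].
  have [lt|lt|eq] := ltngtP i j; [exact/nBi/h'|exact/nBj/h|].
  by rewrite eq eqxx in ij.
have trivE' : trivIset setT E.
  apply/trivIsetP => i j _ _ ij; apply/seteqP; split => // w [[wi _] [wj _]].
  by have /trivIsetP/(_ i j I I ij) := trivE; rewrite -subset0; apply; split; [exact: wi|].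
rewrite measure_bigsetU//.
apply: (@le_trans _ _ (\sum_(j < n) (c%:E * P (first_exit j)))%E).
  by apply: lee_sum => j _; apply: exit_bound => // z; exact: hc.
rewrite -ge0_sume_distrr// -measure_bigsetU//.
rewrite -[leRHS]mule1; apply: lee_wpmul2l; first by rewrite lee_fin.
by apply: probability_le1; exact: bigsetU_measurable.
Qed.

End discrete_times.

Lemma grid_approx (s t : R) n : (0 < n)%N -> 0 < t -> 0 <= s <= t ->
  exists2 i, (i < n)%N & `|t * i%:R / n%:R - s| <= t / n%:R.
Proof.
move=> n0 t0 /andP[s0 st]; have nR : 0 < n%:R :> R by rewrite ltr0n.
have [eqs|] := eqVneq s t.
  exists n.-1; first by rewrite prednK.
  have -> : t * n.-1%:R / n%:R - s = - (t / n%:R).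
    rewrite eqs -[X in _ - X](mulfK (lt0r_neq0 nR)) -mulrBl.
    have -> : t * n.-1%:R - t * n%:R = - t by rewrite -{2}(prednK n0) -natr1; ring.
    by rewrite mulNr.
  by rewrite normrN ger0_norm// divr_ge0 ?ltW.
move=> nst; have {nst}st : s < t by rewrite lt_neqAle nst.
pose r := s * n%:R / t.
have r0 : 0 <= r by apply: divr_ge0; [exact: mulr_ge0|exact: ltW].
have /andP[h1 h2] : (Num.truncn r)%:R <= r < (Num.truncn r).+1%:R by rewrite truncn_le r0 truncnS_gt.
exists (Num.truncn r).
  rewrite -(ltr_nat R); apply: le_lt_trans h1 _.
  by rewrite ltr_pdivrMr// mulrC ltr_pM2l.
have e : s = t * r / n%:R by rewrite /r; field; rewrite !gt_eqF.
have -> : t * (Num.truncn r)%:R / n%:R - s = t / n%:R * ((Num.truncn r)%:R - r).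
  by rewrite {1}e; ring.
have tn0 : 0 <= t / n%:R by rewrite divr_ge0 ?ltW.
rewrite normrM (ger0_norm tn0) ler_piMr// ler_distlC.
by rewrite -natr1 in h2; lra.
Qed.

Lemma killed_continuous (t c : R) (N : nat) (x l u : 'rV[R]_d) : 0 < t -> 0 <= c ->
  (forall (s : R) z, 0 <= s < t -> ~ box N z ->
     (P [set w | cube l u (z + (W t w - W s w))%R] <= c%:E)%E) ->
  let S := [set w | cube l u (x + W t w)%R /\
                    forall s : R, (0 <= s <= t)%R -> box N (x + W s w)%R] in
  measurable S /\ (P [set w | cube l u (x + W t w)%R] <= P S + c%:E)%E.
Proof.
move=> t0 c0 hc S.
have mxW r A : measurable A -> measurable [set w | A (x + W r w)].
  move=> mA; rewrite -[X in measurable X]setTI.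
  by apply: (measurable_rV_add (measurable_cst x) (mW r)).
have mcube := mxW t _ (measurable_cube l u).
pose s m i := t * i%:R / (2 ^ m)%:R : R.
have p0 m : 0 < (2 ^ m)%:R :> R by rewrite ltr0n expn_gt0.
have s_lt m i : (i < 2 ^ m)%N -> 0 <= s m i < t.
  move=> im; rewrite /s; apply/andP; split.
    by apply: divr_ge0; [apply: mulr_ge0; [exact: ltW|exact: ler0n]|exact: ltW].
  by rewrite ltr_pdivrMr// ltr_pM2l// ltr_nat.
pose K m := [set w | cube l u (x + W t w)%R /\
  forall i, (i < 2 ^ m)%N -> box N (x + W (s m i) w)%R].
have hK k : (P [set w | cube l u (x + W t w)%R] <= P (K k) + c%:E)%E.
  apply: killed_discrete => //.
  - by rewrite /s mulr0 mul0r.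
  - by move=> i j ij; rewrite /s ler_pM2r ?invr_gt0// ler_pM2l// ler_nat.
  - by move=> j /s_lt/andP[].
  - exact: measurable_box.
  - by move=> j z jn nB; apply: hc => //; exact: s_lt.
have mK m : measurable (K m).
  have -> : K m = [set w | cube l u (x + W t w)] `&`
      \bigcap_(i in [set` iota 0 (2 ^ m)]) [set w | box N (x + W (s m i) w)].
    apply/seteqP; split => w [hc' h]; split => // i.
      by rewrite /= mem_iota add0n => /andP[_]; exact: h.
    by move=> ij; apply: h; rewrite /= mem_iota.
  by apply: measurableI => //; apply: fin_bigcap_measurable => // i _;
    apply: mxW; exact: measurable_box.
have KS m : K m.+1 `<=` K m.
  move=> w [hw h]; split => // i im; have -> : s m i = s m.+1 (2 * i)%N.
    by rewrite /s expnS !natrM; field; rewrite gt_eqF.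
  by apply: h; rewrite expnS ltn_pmul2l.
have Kn : {homo K : n m / (n <= m)%N >-> (m <= n)%O}.
  by apply/nonincreasing_seqP => m; apply/subsetPset; exact: KS.
have -> : S = \bigcap_m K m.
  apply/seteqP; split => w.
    move=> [hw h] m _; split => // i /s_lt/andP[s1 s2]; apply: h.
    by rewrite s1 ltW.
  move=> h; split; first by have [] := h 0%N I.
  move=> r rt i; rewrite leNgt; apply/negP => far.
  case: bW => _ cW _ _.
  have /andP[r0 rt'] := rt.
  have Ar : `[0, +oo[%classic r by rewrite /= in_itv/= r0.
  have /subspace_continuousP/(_ r Ar) cWr := cW w.
  have : (fun r' => x 0 i + W r' w 0 i) @ within `[0, +oo[ (nbhs r) --> x 0 i + W r w 0 i.
    apply: cvgD; first exact: cvg_cst.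
    have cc := @coord_continuous R 1 d 0 i (W r w).
    exact: (cvg_comp _ _ cWr cc).
  have e0 : 0 < `|x 0 i + W r w 0 i| - N%:R by move: far; rewrite !mxE subr_gt0.
  move=> /cvgrPdist_lt/(_ _ e0)/nbhs_ballP[del /= del0 hdel].
  pose m := (Num.truncn (t / del)).+1.
  have tm : t / (2 ^ m)%:R < del.
    rewrite ltr_pdivrMr// mulrC -ltr_pdivrMr//.
    by apply: lt_trans (truncnS_gt _) _; rewrite ltr_nat ltn_expl.
  have [|j jm hj] := @grid_approx r t (2 ^ m)%N _ t0 rt; first by rewrite expn_gt0.
  have := hdel (s m j); rewrite /ball /= distrC => /(_ (le_lt_trans hj tm)).
  have /andP[sj0 _] := s_lt m j jm; rewrite in_itv/= sj0 => /(_ isT).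
  have [_ /(_ _ jm i)] := h m I; rewrite !mxE => h1 h2.
  have := ler_distD 0 (x 0 i + W r w 0 i) (x 0 i + W (s m j) w 0 i).
  have := lerB_dist (x 0 i + W r w 0 i) (x 0 i + W (s m j) w 0 i); lra.
have cv : P \o K @ \oo --> P (\bigcap_m K m).
  apply: nonincreasing_cvg_mu => //; first by rewrite ltey_eq fin_num_measure.
  exact: bigcapT_measurable.
split; first exact: bigcapT_measurable.
rewrite -leeBlDr//; apply: cvge_to_ge cv _; apply: nearW => m /=.
by have := hK m; rewrite -leeBlDr.
Qed.

End killed_motion.

Section killed_density.
Context {R : realType} {d : nat}.
Variables (N : nat) (p : R -> 'rV[R]_d -> 'rV[R]_d -> R).
Hypothesis d0 : (0 < d)%N.
Hypothesis N0 : (0 < N)%N.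
Hypothesis pP : killed_transition_density N p.

Local Notation G t := ((4 * pi * t) `^ (- (d%:R / 2)) : R).

Lemma killed_density_near_diag (t : R) x (e : R) : 0 < t -> box N x -> 0 < e ->
  exists2 del, 0 < del & forall y, box N y -> (forall i, `|y 0 i - x 0 i| <= del) ->
    `|p t x y - p t x x| < e.
Proof.
move=> t0 Bx e0; have [dO [ Omega [P [W [_ /(_ t t0) [_ cp _]]]]]] := pP.
have /subspace_continuousP/(_ (x, x)) := cp => /(_ (conj Bx Bx)).
move=> /cvgrPdist_lt/(_ _ e0)/nbhs_ballP[del /= del0 hdel].
exists (del / 2); first by rewrite divr_gt0.
move=> y By hy; rewrite distrC; apply: (hdel (x, y)); last exact: (conj Bx By).
split; first exact: ballxx.
split=> // i j; rewrite ord1 /ball /= distrC.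
by apply: le_lt_trans (hy j) _; rewrite ltr_pdivrMr// ltr_pMr// ltr1n.
Qed.

Lemma killed_density_ge0 (t : R) x y : 0 < t -> box N x -> box N y -> 0 <= p t x y.
Proof.
by move=> t0 Bx By; have [dO [ Omega [P [W [_ /(_ t t0) [h _ _]]]]]] := pP; exact: h.
Qed.

Lemma bm_cube_prob dO (Omega : measurableType dO) (P : probability Omega R)
    (W : R -> {RV P >-> 'rV[R]_d}) t x l u : brownian_motion W -> 0 < t ->
  P [set w | cube l u (x + W t w)] =
  (\int[lebesgue_rV d]_(y in cube (l - x) (u - x)) (gauss t 0 y)%:E)%E.
Proof.
move=> [W0 _ law _] t0.
have := law 0 t _ (lexx 0) t0 (measurable_cube (l - x) (u - x)).
rewrite subr0 => <-; congr (P _).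
apply/seteqP; split=> w /= h i; have := h i; rewrite W0 !mxE subr0; lra.
Qed.

Lemma killed_density_le (t : R) x : 0 < t -> box N x -> p t x x <= G t.
Proof.
move=> t0 Bx; rewrite leNgt; apply/negP => pG.
pose e := (p t x x - G t) / 2.
have e0 : 0 < e by rewrite divr_gt0 // subr_gt0.
have [del del0 hdel] := killed_density_near_diag t0 Bx e0.
have NR : 0 < N%:R :> R by rewrite ltr0n.
pose l := \row_i Num.max (x 0 i - del) (- N%:R) : 'rV[R]_d.
pose u := \row_i Num.min (x 0 i + del) N%:R : 'rV[R]_d.
have xB i : - N%:R <= x 0 i <= N%:R by rewrite -ler_norml.
have lu i : l 0 i < u 0 i.
  by rewrite !mxE gt_max !lt_min; have := xB i; lra.
have lB : cube l u `<=` box N.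
  move=> y hy i; have := hy i; rewrite !mxE ge_max le_min ler_norml; lra.
have hy y : cube l u y -> forall i, `|y 0 i - x 0 i| <= del.
  move=> yl i; have := yl i; rewrite !mxE ge_max le_min ler_norml; lra.
have vol0 : 0 < \prod_i (u 0 i - l 0 i) by apply: prodr_gt0 => i _; rewrite subr_gt0.
have [dO [ Omega [P [W [bW /(_ t t0) [_ _ law]]]]]] := pP.
have law' := law x _ Bx (measurable_cube l u) lB.
have [|s z _ _|mS _] := @killed_continuous R d dO Omega P W bW t 1 N x l u t0.
- by [].
- rewrite probability_le1//.
  have mf : measurable_fun setT (fun w => z + (W t w - W s w)).
    by apply: measurable_rV_add => //; apply: measurable_rV_add => //;
      apply: measurable_rV_opp.
  by rewrite -[X in measurable X]setTI; apply: mf => //; exact: measurable_cube.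
have mxW : measurable [set w | cube l u (x + W t w)].
  rewrite -[X in measurable X]setTI.
  by apply: (measurable_rV_add (measurable_cst x) (measurable_funP (W t))) => //;
    exact: measurable_cube.
have h : (\int[lebesgue_rV d]_(y in cube l u) (p t x y)%:E <=
    \int[lebesgue_rV d]_(y in cube (l - x) (u - x)) (gauss t 0 y)%:E)%E.
  have h1 : (P [set w | cube l u (x + W t w)%R /\
    forall s : R, (0 <= s <= t)%R -> box N (x + W s w)%R] <=
    P [set w | cube l u (x + W t w)%R])%E.
    by apply: le_measure; rewrite ?inE// => w [].
  by rewrite (bm_cube_prob x l u bW t0) in h1; rewrite -law'.
have h1 := integral_le_cst (lebesgue_rV d) (f := fun y => (gauss t 0 y)%:E)
  (c := (G t)%:E) (measurable_cube (l - x) (u - x)).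
have h2 := integral_ge_cst (lebesgue_rV d) (f := fun y => (p t x y)%:E)
  (c := (G t + e)%:E) (measurable_cube l u).
have : ((G t + e)%:E * lebesgue_rV d (cube l u) <=
    (G t)%:E * lebesgue_rV d (cube (l - x) (u - x)))%E.
  apply: (@le_trans _ _ (\int[lebesgue_rV d]_(y in cube l u) (p t x y)%:E)%E).
    apply: h2; first by rewrite lee_fin addr_ge0 ?powR_ge0 ?ltW.
    move=> y yl; rewrite lee_fin.
    have := hdel y (lB _ yl) (hy _ yl); rewrite ltr_norml /e; lra.
  apply: le_trans h _; apply: h1 => y _; rewrite lee_fin ?gauss_ge0//.
  exact: gauss_le.
rewrite !lebesgue_rV_cube => [|i|i]; last first.
- exact: ltW.
- by rewrite !mxE lerD2r; have := lu i; rewrite !mxE => /ltW.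
have -> : \prod_i ((u - x) 0 i - (l - x) 0 i) = \prod_i (u 0 i - l 0 i).
  by apply: eq_bigr => i _; rewrite !mxE; ring.
by rewrite -!EFinM lee_fin ler_pM2r// gerDl leNgt e0.
Qed.

Lemma killed_density_ge (t r : R) (x : 'rV[R]_d) : 0 < t -> 0 < r ->
  (forall i, `|x 0 i| <= N%:R - r) -> G t - @far_bound R d (r / 2) <= p t x x.
Proof.
move=> t0 r0 hx.
have Bx : box N x by move=> i; have := hx i; lra.
apply/ler_addgt0Pr => e2 e20; pose e := e2 / 2.
have e0 : 0 < e by rewrite divr_gt0.
have [del1 del10 hdel] := killed_density_near_diag t0 Bx e0.
have GC0 : 0 <= G t by exact: powR_ge0.
pose M := G t * d%:R / (4 * t) + 1.
have M0 : 0 < M by rewrite ltr_wpDl// divr_ge0 ?mulr_ge0// ltW.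
have [del del0 [dd1 ddr dl1 dM]] : exists2 del, 0 < del &
    [/\ del <= del1, del <= r / 2, del <= 1 & del * M <= e].
  exists (Num.min (Num.min del1 (r / 2)) (Num.min 1 (e / M))).
    by rewrite !lt_min del10 ltr01 !divr_gt0.
  by split; rewrite -?ler_pdivlMr// !ge_min lexx ?orbT.
pose l := x - const_mx del; pose u := x + const_mx del.
have lB : cube l u `<=` box N.
  by move=> y hy i; have := hy i; have := hx i; rewrite !mxE !ler_norml; lra.
have hy y : cube l u y -> forall i, `|y 0 i - x 0 i| <= del1.
  by move=> yl i; have := yl i; rewrite !mxE ler_norml; lra.
have lu i : l 0 i < u 0 i by rewrite !mxE; lra.
have vol0 : 0 < \prod_i (u 0 i - l 0 i) by apply: prodr_gt0 => i _; rewrite subr_gt0.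
have [dO [ Omega [P [W [bW /(_ t t0) [_ _ law]]]]]] := pP.
have := law x _ Bx (measurable_cube l u) lB.
have [||mS] := @killed_continuous R d dO Omega P W bW t
  (@far_bound R d (r / 2) * \prod_i (u 0 i - l 0 i)) N x l u t0.
- by rewrite mulr_ge0 ?far_bound_ge0 ?ltW.
- move=> s z /andP[s0 st] nB; apply: increment_far => //.
  + by rewrite divr_gt0.
  + by move=> i; exact: ltW.
  + move=> y yl; have /existsNP[i /negP] := nB; rewrite -ltNge => zi.
    have hyi : r / 2 <= `|z 0 i - y 0 i|.
      have := hx i; have := yl i; have := lerB_dist (z 0 i) (y 0 i).
      rewrite !mxE !ler_norml => h1 h2 h3.
      have : `|y 0 i| <= N%:R - r / 2 by rewrite ler_norml; lra.
      by lra.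
    rewrite /dist2 (bigD1 i)//= -[leLHS]addr0 lerD//; last first.
      by apply: sumr_ge0 => j _; rewrite sqr_ge0.
    by rewrite -(real_normK (num_real (z 0 i - y 0 i))) lerXn2r// nnegrE divr_ge0 ?ltW.
move=> h law'.
have {}h : (\int[lebesgue_rV d]_(y in cube (l - x) (u - x)) (gauss t 0 y)%:E <=
    \int[lebesgue_rV d]_(y in cube l u) (p t x y)%:E +
    (@far_bound R d (r / 2) * \prod_i (u 0 i - l 0 i))%:E)%E.
  by rewrite (bm_cube_prob x l u bW t0) in h; rewrite -law'.
have h1 := integral_le_cst (lebesgue_rV d) (f := fun y => (p t x y)%:E)
  (c := (p t x x + e)%:E) (measurable_cube l u).
have h2 := integral_ge_cst (lebesgue_rV d) (f := fun y => (gauss t 0 y)%:E)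
  (c := (G t - e)%:E) (measurable_cube (l - x) (u - x)).
have [Ge|Ge] := ltP (G t) e.
  apply: (@le_trans _ _ (0 + e2)); last by rewrite lerD2r killed_density_ge0.
  by have := @far_bound_ge0 R d (r / 2); rewrite /e in Ge; lra.
have : ((G t - e)%:E * lebesgue_rV d (cube (l - x) (u - x)) <=
    (p t x x + e)%:E * lebesgue_rV d (cube l u) +
    (@far_bound R d (r / 2) * \prod_i (u 0 i - l 0 i))%:E)%E.
  apply: le_trans (h2 _ _) _; [by rewrite lee_fin subr_ge0| |].
    move=> y yl; rewrite lee_fin.
    have dist_le : dist2 0 y <= d%:R * del.
      have -> : d%:R * del = \sum_(i < d) del by rewrite sumr_const card_ord mulr_natl.
      apply: ler_sum => i _; have := yl i; rewrite !mxE => yi.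
      have : `|y 0 i| <= del by rewrite ler_norml; lra.
      move=> yd; rewrite sub0r sqrrN -(real_normK (num_real (y 0 i))) expr2.
      apply: (@le_trans _ _ (`|y 0 i| * 1)); last by rewrite mulr1.
      by rewrite ler_wpM2l// (le_trans yd).
    rewrite /gauss -/(dist2 0 y).
    apply: (@le_trans _ _ (G t * (1 + - dist2 0 y / (4 * t)))); last first.
      by rewrite ler_wpM2l// expR_ge1Dx.
    rewrite [leRHS]mulrDr mulr1 lerD2l mulNr mulrN lerN2.
    apply: le_trans dM; apply: (@le_trans _ _ (G t * (d%:R * del / (4 * t)))).
      by rewrite ler_wpM2l// ler_pM2r// invr_gt0 mulr_gt0.
    rewrite /M [leRHS]mulrDr mulr1; set c := G t.
    have -> : c * (d%:R * del / (4 * t)) = del * (c * d%:R / (4 * t)) by ring.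
    by rewrite lerDl ltW.
  apply: le_trans h _; rewrite leeD2r//; apply: h1 => y yl.
    by rewrite lee_fin killed_density_ge0//; exact: lB.
  by rewrite lee_fin; have := hdel y (lB _ yl) (hy _ yl); rewrite ltr_norml; lra.
rewrite !lebesgue_rV_cube => [|i|i]; last first.
- by rewrite !mxE lerD2r; have := lu i; rewrite !mxE => /ltW.
- exact: ltW.
have -> : \prod_i ((u - x) 0 i - (l - x) 0 i) = \prod_i (u 0 i - l 0 i).
  by apply: eq_bigr => i _; rewrite !mxE; ring.
rewrite -!EFinM -EFinD lee_fin -mulrDl ler_pM2r// /e; lra.
Qed.

End killed_density.

Section theta_sum.
Context {R : realType} {d : nat}.

Let code (z : int) : nat := match z with Posz n => n.*2 | Negz n => n.*2.+1 end.
Let decode (m : nat) : int := if odd m then Negz m./2 else Posz m./2.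

Let codeK : cancel code decode.
Proof.
case=> n; rewrite /code /decode.
  by rewrite odd_double doubleK.
by rewrite /= odd_double /= uphalf_double.
Qed.

Let absz_decode m : `|decode m|%N = uphalf m.
Proof. by rewrite /decode uphalf_half; case: ifP => //= _; rewrite add1n. Qed.

Let sum_uphalf (u : R) L : u != 1 ->
  \sum_(m < L.*2) u ^+ uphalf m = (1 + u) * (1 - u ^+ L) / (1 - u).
Proof.
move=> u1; elim: L => [|L IH]; first by rewrite big_ord0 expr0 subrr mulr0 mul0r.
rewrite doubleS !big_ord_recr/= IH uphalf_double /= doubleK exprS.
by field; rewrite subr_eq0 eq_sym.
Qed.

Lemma theta_sum_le (u c : R) (f : 'rV[int]_d -> R) : 0 <= u < 1 -> 0 <= c ->
  (forall z, 0 <= f z <= c * \prod_i u ^+ `|z ord0 i|%N) ->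
  (\esum_(z in [set: 'rV[int]_d]) (f z)%:E <= (c * ((1 + u) / (1 - u)) ^+ d)%:E)%E.
Proof.
move=> /andP[u0 u1] c0 hf; apply: ge_ereal_sup => _ [A [finA _] <-].
rewrite fsbig_finite//= sumEFin lee_fin.
set s := finmap.enum_fset _.
have us : uniq s by exact: finmap.fset_uniq.
pose L := (\max_(z <- s) \max_i code (z ord0 i)).+1.
have codeL z i : z \in s -> (code (z ord0 i) < L.*2)%N.
  move=> zs; apply: (@leq_trans L); last by rewrite -addnn leq_addr.
  rewrite ltnS; apply: (@leq_trans (\max_i code (z ord0 i))).
    exact: (leq_bigmax i).
  exact: (@leq_bigmax_seq _ s xpredT (fun z : 'rV[int]_d => (\max_i code (z ord0 i))%N) z zs).
have L0 : (0 < L.*2)%N by rewrite double_gt0.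
pose enc (z : 'rV[int]_d) : {ffun 'I_d -> 'I_L.*2} :=
  [ffun i => insubd (Ordinal L0) (code (z 0 i))].
pose dec (g : {ffun 'I_d -> 'I_L.*2}) : 'rV[int]_d := \row_i decode (g i).
have encK z : z \in s -> dec (enc z) = z.
  move=> zs; apply/rowP => i; rewrite !mxE ffunE /= val_insubd codeL// codeK//.
rewrite (eq_big_seq (fun z => f (dec (enc z)))); last by move=> z zs; rewrite encK.
rewrite -(big_map enc xpredT (fun g => f (dec g))) big_uniq; last first.
  by rewrite map_inj_in_uniq// => z1 z2 h1 h2 e; rewrite -(encK z1)// e encK.
apply: (@le_trans _ _ (c * \sum_(g : {ffun 'I_d -> 'I_L.*2}) \prod_i u ^+ uphalf (g i))).
  rewrite mulr_sumr big_mkcond/=; apply: ler_sum => g _; case: ifP => _; last first.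
    by rewrite mulr_ge0// prodr_ge0// => i _; exact: exprn_ge0.
  have /andP[_ /le_trans] := hf (dec g); apply.
  by rewrite ler_wpM2l// le_eqVlt; apply/orP; left; apply/eqP; apply: eq_bigr => i _;
    rewrite mxE absz_decode.
rewrite -(bigA_distr_bigA (fun _ (m : 'I_L.*2) => u ^+ uphalf m)) prodr_const card_ord.
have u10 : 0 < 1 - u by rewrite subr_gt0.
apply: ler_wpM2l => //; apply: lerXn2r; rewrite ?nnegrE.
- by apply: sumr_ge0 => i _; exact: exprn_ge0.
- apply: divr_ge0; last exact: ltW.
  exact: addr_ge0.
- rewrite sum_uphalf ?lt_eqF// ler_pM2r ?invr_gt0// ler_piMr ?addr_ge0//.
  by rewrite gerBl exprn_ge0.
Qed.

End theta_sum.

Section heat_kernel_masses.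
Context {R : realType} {d : nat}.
Variables (beta alpha : R).
Hypotheses (d0 : (0 < d)%N) (beta0 : 0 < beta).

Local Notation G t := ((4 * pi * t) `^ (- (d%:R / 2)) : R).
Local Notation q := (q_free d beta alpha).

Lemma q_freeE k : q k.+1 = expR (beta * alpha * k.+1%:R) / k.+1%:R * G (k.+1%:R * beta).
Proof.
have k0 : 0 < k.+1%:R :> R by rewrite ltr0n.
have b0 : 0 <= 4 * pi * beta by rewrite !mulr_ge0 ?pi_ge0// ltW.
rewrite /q_free -[RHS]mulrA; congr (_ * _).
have -> : 4 * pi * (k.+1%:R * beta) = (4 * pi * beta) * k.+1%:R by ring.
rewrite [X in _ = _ * X]powRN (@powRM _ _ _ (d%:R / 2) b0 (ltW k0)) -invfM; congr (_^-1).
by rewrite powRD ?gt_eqF ?implybT// powRr1 ?ltW//; ring.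
Qed.

Lemma gauss_per_bounds (N : nat) (t : R) (x : 'rV[R]_d) : (0 < N)%N -> 0 < t <= N%:R * beta ->
  let u := expR (- (N%:R / beta)) in
  exists2 c : R, gauss_per N t x x = c%:E &
    G t <= c <= G t * ((1 + u) / (1 - u)) ^+ d.
Proof.
move=> N0 /andP[t0 tN] u.
have NR : 0 < N%:R :> R by rewrite ltr0n.
have u01 : 0 <= u < 1 by rewrite expR_ge0 expR_lt1 oppr_lt0 divr_gt0.
have G0 : 0 <= G t by exact: powR_ge0.
have le1 : (gauss_per N t x x <= (G t * ((1 + u) / (1 - u)) ^+ d)%:E)%E.
  apply: theta_sum_le => // z; rewrite gauss_ge0/= /gauss ler_wpM2l//.
  have -> : - (\sum_(i < d) (x 0 i - (x + (2 * N%:R) *: map_mx intr z) 0 i) ^+ 2) / (4 * t) =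
      \sum_(i < d) - (N%:R ^+ 2 * (z 0 i)%:~R ^+ 2 / t).
    rewrite -sumrN mulr_suml; apply: eq_bigr => i _; rewrite !mxE.
    by field; rewrite gt_eqF.
  rewrite expR_sum; apply: ler_prod => i _; rewrite expR_ge0/=.
  rewrite /u -expRM_natl ler_expR mulrN lerN2.
  rewrite -(real_normK (num_real (z 0 i)%:~R)) -intr_norm -abszE.
  set m := `|z ord0 i|%N.
  rewrite -[m%:Z%:~R]/(m%:R : R).
  apply: (@le_trans _ _ (m%:R ^+ 2 * (N%:R / beta))).
    have Nb0 : 0 <= N%:R / beta by apply/ltW; exact: divr_gt0.
    rewrite (ler_wpM2r Nb0)// -natrX ler_nat.
    by case: (m) => // m'; rewrite leq_pmulr.
  have -> : N%:R ^+ 2 * m%:R ^+ 2 / t = m%:R ^+ 2 * (N%:R ^+ 2 / t) by ring.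
  apply: ler_wpM2l; first exact: sqr_ge0.
  rewrite ler_pdivrMr// mulrAC ler_pdivlMr// expr2 -mulrA.
  by apply: ler_wpM2l => //; exact: ltW.
have ge1 : ((G t)%:E <= gauss_per N t x x)%E.
  apply: esum_ge; exists [set 0].
    by split => //; exact: finite_set1.
  rewrite fsbig_set1 lee_fin.
  have -> : x + (2 * N%:R) *: map_mx intr 0 = x.
    by apply/rowP => i; rewrite !mxE mulr0 addr0.
  by rewrite gauss_diag.
have fn : gauss_per N t x x \is a fin_num.
  by rewrite fin_numElt (lt_le_trans (ltNyr _) ge1) (le_lt_trans le1) ?ltry.
exists (fine (gauss_per N t x x)); first by rewrite fineK.
by rewrite -!lee_fin fineK// ge1.
Qed.

End heat_kernel_masses.

Section loop_intensities.
Context {R : realType} {d : nat}.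
Variables (beta alpha : R) (gDir : nat -> R -> 'rV[R]_d -> 'rV[R]_d -> R).
Variable bc : boundary_condition.
Hypotheses (d0 : (0 < d)%N) (beta0 : 0 < beta).
Hypothesis gDirP : bc = Dirichlet ->
  forall N, (0 < N)%N -> killed_transition_density N (gDir N).

Local Notation G t := ((4 * pi * t) `^ (- (d%:R / 2)) : R).
Local Notation q := (q_free d beta alpha).
Local Notation qN := (q_bc beta gDir bc alpha).

Lemma vol_gt0 N : (0 < N)%N -> 0 < vol d N :> R.
Proof. by move=> N0; rewrite ltr0n expn_gt0 muln_gt0 N0. Qed.

Let time_gt0 k : 0 < k.+1%:R * beta. Proof. by rewrite mulr_gt0 ?ltr0n. Qed.

Let q_gt0 k : 0 < q k.+1.
Proof.
rewrite q_freeE//; apply: mulr_gt0; last by rewrite powR_gt0// !mulr_gt0// pi_gt0.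
by rewrite divr_gt0 ?expR_gt0 ?ltr0n.
Qed.

Let average_bounds N (f : 'rV[R]_d -> \bar R) k (L U : R) : (0 < N)%N ->
  ((L * vol d N)%:E <= \int[lebesgue_rV d]_(x in box N) f x)%E ->
  (\int[lebesgue_rV d]_(x in box N) f x <= (U * vol d N)%:E)%E ->
  expR (beta * alpha * k.+1%:R) / k.+1%:R * L <=
    expR (beta * alpha * k.+1%:R) / (k.+1%:R * vol d N) *
    fine (\int[lebesgue_rV d]_(x in box N) f x)%E <=
    expR (beta * alpha * k.+1%:R) / k.+1%:R * U.
Proof.
move=> N0 hL hU; set w := expR _; have V0 := vol_gt0 N0.
set I := (\int[_]_(x in _) _)%E in hL hU *.
have Ifin : I \is a fin_num.
  by rewrite fin_numElt (lt_le_trans (ltNyr _) hL) (le_lt_trans hU) ?ltry.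
rewrite -(fineK Ifin) !lee_fin in hL hU.
have wk : 0 < w / k.+1%:R by rewrite divr_gt0 ?expR_gt0 ?ltr0n.
have -> : w / (k.+1%:R * vol d N) * fine I = w / k.+1%:R * ((vol d N)^-1 * fine I).
  by rewrite invfM; ring.
rewrite !ler_pM2l//.
by rewrite ler_pdivlMl// ler_pdivrMl// ![vol d N * _]mulrC hL.
Qed.

Let average_le N (f : 'rV[R]_d -> \bar R) k (U : R) : (0 < N)%N ->
  (forall x, box N x -> (0 <= f x)%E) -> (forall x, box N x -> (f x <= U%:E)%E) ->
  expR (beta * alpha * k.+1%:R) / (k.+1%:R * vol d N) *
    fine (\int[lebesgue_rV d]_(x in box N) f x)%E <=
    expR (beta * alpha * k.+1%:R) / k.+1%:R * U.
Proof.
move=> N0 f0 fU; suff h : (\int[lebesgue_rV d]_(x in box N) f x <= (U * vol d N)%:E)%E.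
  have h0 : ((0 * vol d N)%:E <= \int[lebesgue_rV d]_(x in box N) f x)%E.
    by rewrite mul0r; exact: integral_ge0.
  by have /andP[] := average_bounds k N0 h0 h.
by rewrite EFinM -lebesgue_rV_box; apply: integral_le_cst => //; exact: measurable_box.
Qed.

Let average_ge N (f : 'rV[R]_d -> \bar R) k (L U : R) : (0 < N)%N ->
  (forall x, box N x -> (0 <= f x)%E) -> (forall x, box N x -> (f x <= U%:E)%E) ->
  ((L * vol d N)%:E <= \int[lebesgue_rV d]_(x in box N) f x)%E ->
  expR (beta * alpha * k.+1%:R) / k.+1%:R * L <=
    expR (beta * alpha * k.+1%:R) / (k.+1%:R * vol d N) *
    fine (\int[lebesgue_rV d]_(x in box N) f x)%E.
Proof.
move=> N0 f0 fU hL.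
suff h : (\int[lebesgue_rV d]_(x in box N) f x <= (U * vol d N)%:E)%E.
  by have /andP[] := average_bounds k N0 hL h.
by rewrite EFinM -lebesgue_rV_box; apply: integral_le_cst => //; exact: measurable_box.
Qed.

Lemma q_bc_ge0 N k : (0 < N)%N -> 0 <= qN N k.+1.
Proof.
move=> N0; rewrite /q_bc; case: bc gDirP => hP; first exact/ltW/q_gt0.
- case: ifP => // _; apply: mulr_ge0.
    by rewrite divr_ge0 ?expR_ge0// mulr_ge0// ltW// vol_gt0.
  by apply: fine_ge0; apply: integral_ge0 => x _; apply: esum_ge0 => z _;
    rewrite lee_fin gauss_ge0.
- case: ifP => // _; apply: mulr_ge0.
    by rewrite divr_ge0 ?expR_ge0// mulr_ge0// ltW// vol_gt0.
  apply: fine_ge0; apply: integral_ge0 => x xB; rewrite lee_fin.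
  by apply: (killed_density_ge0 (hP erefl N N0)).
Qed.

Let theta_cvg : ((1 + expR (- (N%:R / beta))) / (1 - expR (- (N%:R / beta)))) ^+ d
  @[N --> \oo] --> (1 : R).
Proof.
have e N : expR (- (N%:R / beta)) = expR (- beta^-1) ^+ N :> R.
  by rewrite -expRM_natl mulrN.
have u0 : (fun N => expR (- (N%:R / beta)) : R) @ \oo --> (0 : R).
  under eq_fun do rewrite e; apply: cvg_expr.
  by rewrite ger0_norm ?expR_ge0// expR_lt1 oppr_lt0 invr_gt0.
have c1 : (fun N => 1 + expR (- (N%:R / beta)) : R) @ \oo --> 1 + (0 : R).
  by apply: cvgD => //; exact: cvg_cst.
have c2 : (fun N => 1 - expR (- (N%:R / beta)) : R) @ \oo --> 1 - (0 : R).
  by apply: cvgB => //; exact: cvg_cst.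
have n0 : 1 - 0 != 0 :> R by rewrite subr0 oner_eq0.
have c3 : (fun N => (1 + expR (- (N%:R / beta))) * (1 - expR (- (N%:R / beta)))^-1 : R)
    @ \oo --> (1 + 0) * (1 - 0 : R)^-1.
  by apply: cvgM => //; exact: (cvgV n0 c2).
have := @continuous_cvg _ _ _ _ _ _ (fun x : R => x ^+ d) _ (@exprn_continuous R d _) c3.
by rewrite /= addr0 subr0 divr1 expr1n; apply.
Qed.

Lemma q_bc_le (e : R) : 0 < e ->
  \forall N \near \oo, forall k, qN N k.+1 <= (1 + e) * q k.+1.
Proof.
move=> e0.
have hth : \forall N \near \oo,
    ((1 + expR (- (N%:R / beta))) / (1 - expR (- (N%:R / beta)))) ^+ d <= 1 + e.
  have /cvgrPdist_le/(_ _ e0) := theta_cvg; apply: filterS => N.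
  by rewrite ler_distlC => /andP[_]; rewrite addrC.
near=> N => k.
have N0 : (0 < N)%N by near: N; exists 1%N.
have qe : q k.+1 <= (1 + e) * q k.+1 by rewrite ler_peMl ?lerDl// ltW.
have q0 := q_gt0 k.
rewrite /q_bc; case: bc gDirP => hP //.
- case: ifP => kN; last by apply: le_trans qe; exact: ltW.
  have tN : 0 < k.+1%:R * beta <= N%:R * beta.
    by rewrite time_gt0/= ler_pM2r// ler_nat.
  pose th := ((1 + expR (- (N%:R / beta))) / (1 - expR (- (N%:R / beta)))) ^+ d : R.
  have th1 : th <= 1 + e.
    by rewrite /th; near: N; exact: hth.
  have hb (x : 'rV[R]_d) := gauss_per_bounds beta0 x N0 tN.
  apply: (le_trans (average_le (U := G (k.+1%:R * beta) * th) k N0 _ _)).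
  + by move=> x _; apply: esum_ge0 => z _; rewrite lee_fin gauss_ge0.
  + by move=> x _; have [c -> /andP[_]] := hb x.
  rewrite q_freeE// mulrA mulrC ler_wpM2r//.
  by apply: mulr_ge0; [rewrite divr_ge0 ?expR_ge0|exact: powR_ge0].
- case: ifP => kN; last by apply: le_trans qe; exact: ltW.
  have pd := hP erefl N N0; have t0 := time_gt0 k.
  apply: (le_trans (average_le (U := G (k.+1%:R * beta)) k N0 _ _)).
  + by move=> x xB; rewrite lee_fin; apply: (killed_density_ge0 pd).
  + by move=> x xB; rewrite lee_fin; apply: (killed_density_le N0 pd).
  by rewrite -q_freeE.
Unshelve. all: by end_near. Qed.

Let far_bound_small (e : R) : 0 < e -> exists n, @far_bound R d (n.+1%:R / 2) <= e.
Proof.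
move=> e0; have dR : 0 < d%:R :> R by rewrite ltr0n.
have pi0 := @pi_gt0 R.
pose c := e `^ (2 / d%:R); have c0 : 0 < c by rewrite powR_gt0.
pose n := Num.truncn (2 * d%:R / (pi * c)); exists n.
have hn : 2 * d%:R / (pi * c) < n.+1%:R := truncnS_gt _.
have n1 : 1 <= n.+1%:R :> R by rewrite ler1n.
have -> : e = c `^ (d%:R / 2).
  rewrite -powRrM (_ : _ * _ = 1); first by rewrite powRr1 ?ltW.
  by field; rewrite gt_eqF.
apply: ge0_ler_powR; rewrite ?nnegrE; [by rewrite divr_ge0| |exact: ltW|].
  by rewrite divr_ge0// !mulr_ge0 ?sqr_ge0// ltW.
have r0 : 0 < 2 * pi * (n.+1%:R / 2) ^+ 2 :> R by rewrite !mulr_gt0// exprn_gt0// divr_gt0.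
rewrite ler_pdivrMr//; rewrite ltr_pdivrMr ?mulr_gt0// in hn.
have : n.+1%:R * (pi * c) <= n.+1%:R ^+ 2 * (pi * c).
  by rewrite ler_pM2r ?mulr_gt0// expr2 ler_peMl.
have -> : c * (2 * pi * (n.+1%:R / 2) ^+ 2) = n.+1%:R ^+ 2 * (pi * c) / 2 by field.
lra.
Qed.

Lemma q_bc_ge (e : R) k : 0 < e ->
  \forall N \near \oo, q k.+1 - e <= qN N k.+1.
Proof.
move=> e0; have q0 := q_gt0 k; have t0 := time_gt0 k.
pose w := expR (beta * alpha * k.+1%:R) / k.+1%:R.
have w0 : 0 < w by rewrite divr_gt0 ?expR_gt0 ?ltr0n.
have := q_bc_ge0 ^~ k; case: bc gDirP => hP qb0.
- by apply: nearW => N; rewrite /q_bc gerBl ltW.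
- near=> N; have N0 : (0 < N)%N by near: N; exists 1%N.
  have kN : (k.+1 <= N)%N by near: N; exists k.+1.
  have tN : 0 < k.+1%:R * beta <= N%:R * beta.
    by rewrite time_gt0/= ler_pM2r// ler_nat.
  have hb (x : 'rV[R]_d) := gauss_per_bounds beta0 x N0 tN.
  rewrite /q_bc kN; apply: (@le_trans _ _ (q k.+1)); first by rewrite gerBl ltW.
  pose th := ((1 + expR (- (N%:R / beta))) / (1 - expR (- (N%:R / beta)))) ^+ d : R.
  rewrite q_freeE//; apply: (average_ge (U := G (k.+1%:R * beta) * th) k N0).
  + by move=> x _; apply: esum_ge0 => z _; rewrite lee_fin gauss_ge0.
  + by move=> x _; have [c -> /andP[_]] := hb x.
  + rewrite EFinM -lebesgue_rV_box; apply: integral_ge_cst; first exact: measurable_box.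
      by rewrite lee_fin powR_ge0.
    by move=> x _; have [c -> /andP[]] := hb x.
- have [n hn] : exists n, @far_bound R d (n.+1%:R / 2) <= e / (2 * w).
    by apply: far_bound_small; rewrite divr_gt0// mulr_gt0.
  set g := G (k.+1%:R * beta).
  have g0 : 0 < g by rewrite powR_gt0// !mulr_gt0// pi_gt0.
  set K := far_bound _ in hn.
  have K0 : 0 <= K by exact: far_bound_ge0.
  have ratio : (fun N => ((N - n.+1)%N%:R / N%:R) ^+ d : R) @ \oo --> (1 : R).
    have h0 : (fun N => N%:R^-1 : R) @ \oo --> (0 : R).
      by rewrite -cvg_shiftS; exact: cvg_harmonic.
    have c1 : (fun N => 1 - n.+1%:R * N%:R^-1 : R) @ \oo --> 1 - n.+1%:R * (0 : R).
      by apply: cvgB; [exact: cvg_cst|apply: cvgM => //; exact: cvg_cst].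
    have := @continuous_cvg _ _ _ _ _ _ (fun x : R => x ^+ d) _ (@exprn_continuous R d _) c1.
    rewrite /= mulr0 subr0 expr1n => c2; apply: cvg_trans (c2 _).
    apply: near_eq_cvg; near=> N => /=; have nN : (n.+1 <= N)%N by near: N; exists n.+1.
    rewrite natrB// mulrBl mulfV//.
    by rewrite pnatr_eq0 -lt0n (leq_trans _ nN).
  have hr : \forall N \near \oo, 1 - e / (2 * w * g) <= ((N - n.+1)%N%:R / N%:R) ^+ d :> R.
    have e1 : 0 < e / (2 * w * g) by apply: divr_gt0 => //; do 2 apply: mulr_gt0 => //.
    have /cvgrPdist_le/(_ _ e1) := ratio; apply: filterS => N.
    by rewrite ler_distlC => /andP[].
  near=> N; have N0 : (0 < N)%N by near: N; exists 1%N.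
  have kN : (k.+1 <= N)%N by near: N; exists k.+1.
  have nN : (n.+1 <= N)%N by near: N; exists n.+1.
  have pd := hP erefl N N0.
  have f0 x : box N x -> (0 <= (gDir N (k.+1%:R * beta) x x)%:E)%E.
    by move=> xB; rewrite lee_fin; apply: (killed_density_ge0 pd).
  have fU x : box N x -> ((gDir N (k.+1%:R * beta) x x)%:E <= g%:E)%E.
    by move=> xB; rewrite lee_fin; apply: (killed_density_le N0 pd).
  have [gK|gK] := ltP g K.
    apply: (@le_trans _ _ 0); last exact: qb0.
    rewrite q_freeE// -/w -/g subr_le0.
    have : w * g <= w * (e / (2 * w)) by rewrite ler_pM2l// (le_trans (ltW gK)).
    have -> : w * (e / (2 * w)) = e / 2 by field; rewrite gt_eqF.
    lra.
  rewrite /q_bc kN.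
  apply: (le_trans _ (average_ge k N0 f0 fU
    (L := (g - K) * ((N - n.+1)%N%:R / N%:R) ^+ d) _)).
  + rewrite q_freeE// -/w -/g.
    set rt := _ ^+ d; have rtlo : 1 - e / (2 * w * g) <= rt by rewrite /rt; near: N; exact: hr.
    have wg : w * g * (e / (2 * w * g)) = e / 2 by field; rewrite !gt_eqF.
    have wK : w * K <= e / 2.
      have -> : e / 2 = w * (e / (2 * w)) by field; rewrite gt_eqF.
      by rewrite ler_pM2l.
    have wr : w * g * (1 - e / (2 * w * g)) <= w * g * rt by rewrite ler_pM2l// mulr_gt0.
    have rt1 : rt <= 1.
      rewrite exprn_ile1// ?divr_ge0// ler_pdivrMr ?ltr0n// mul1r ler_nat.
      exact: leq_subr.
    have wKr : w * K * rt <= w * K by rewrite ler_piMr// mulr_ge0// ltW.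
    rewrite mulrBr wg mulr1 in wr.
    have -> : w * ((g - K) * rt) = w * g * rt - w * K * rt by ring.
    lra.
  + have -> : (g - K) * ((N - n.+1)%N%:R / N%:R) ^+ d * vol d N =
        (g - K) * vol d (N - n.+1)%N.
      have NR : N%:R != 0 :> R by rewrite pnatr_eq0 -lt0n.
      rewrite -mulrA; congr (_ * _); rewrite /vol !natrX !natrM expr_div_n !exprMn.
      by field; rewrite expf_eq0 (negbTE NR) andbF.
    have sub : box (N - n.+1)%N `<=` @box R d N.
      by move=> x hx i; apply: le_trans (hx i) _; rewrite ler_nat leq_subr.
    rewrite EFinM -lebesgue_rV_box -integral_cst; last exact: measurable_box.
    rewrite -{1}(setIidr sub) integral_mkcondr; apply: ge0_le_integral_pointwise.
      by move=> x _; apply: erestrict_ge0 => ? _; rewrite lee_fin subr_ge0.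
    move=> x xB; rewrite patchE; case: ifPn => [/set_mem xB'|_]; last exact: f0.
    rewrite lee_fin; apply: (killed_density_ge d0 pd) => //.
    by move=> i; rewrite -natrB//; exact: xB'.
Unshelve. all: by end_near. Qed.

End loop_intensities.

(** * The lower semicontinuous regularization of the energy *)

Section series.
Context {R : realType}.
Implicit Types u : nat -> R.

Local Notation psum u n := (\sum_(0 <= k < n) u k).
Local Notation tsum u := (\sum_(0 <= k <oo) (u k)%:E)%E.

Lemma psum_le u m n : (forall k, 0 <= u k) -> (m <= n)%N -> psum u m <= psum u n.
Proof.
by move=> u0 mn; rewrite (big_cat_nat _ mn)//= lerDl sumr_ge0.
Qed.

Lemma cvg_tsum u : (forall k, 0 <= u k) -> (fun n => (psum u n)%:E) @ \oo --> tsum u.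
Proof.
move=> u0; under eq_fun do rewrite -sumEFin.
by apply: is_cvg_nneseries => k _ _; rewrite lee_fin.
Qed.

Lemma tsum_ge0 u : (forall k, 0 <= u k) -> (0 <= tsum u)%E.
Proof. by move=> u0; apply: nneseries_ge0 => k _ _; rewrite lee_fin. Qed.

Lemma psum_le_tsum u n : (forall k, 0 <= u k) -> ((psum u n)%:E <= tsum u)%E.
Proof.
move=> u0; apply: cvge_to_ge (cvg_tsum u0) _.
by near=> m; rewrite lee_fin; apply: psum_le => //; near: m; exists n.
Unshelve. all: by end_near. Qed.

Lemma tsum_le u (B : \bar R) : (forall k, 0 <= u k) ->
  (forall n, ((psum u n)%:E <= B)%E) -> (tsum u <= B)%E.
Proof. by move=> u0 uB; apply: cvge_to_le (cvg_tsum u0) _; exact: nearW. Qed.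

Lemma tsum_fin u : (forall k, 0 <= u k) -> (tsum u < +oo)%E -> (fine (tsum u))%:E = tsum u.
Proof. by move=> u0 uoo; rewrite fineK// ge0_fin_numE// tsum_ge0. Qed.

Lemma psum_cvg u : (forall k, 0 <= u k) -> (tsum u < +oo)%E ->
  (fun n => psum u n) @ \oo --> fine (tsum u).
Proof.
move=> u0 uoo; have := cvg_tsum u0; rewrite -(tsum_fin u0 uoo).
by move/fine_cvg.
Qed.

Lemma psum_le_fine u n : (forall k, 0 <= u k) -> (tsum u < +oo)%E ->
  psum u n <= fine (tsum u).
Proof. by move=> u0 uoo; rewrite -lee_fin tsum_fin//; exact: psum_le_tsum. Qed.

Lemma tsum_infty u M : (forall k, 0 <= u k) -> ~ (tsum u < +oo)%E ->
  exists n, M < psum u n.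
Proof.
move=> u0 /negP; rewrite -leNgt leye_eq => /eqP uoo.
have := cvg_tsum u0; rewrite uoo => /cvgeyPgt/(_ M)[n _ /(_ n)].
by rewrite /= lte_fin => /(_ (leqnn _)) h; exists n.
Qed.

Lemma tsum_finsupp u n : (forall k, (n <= k)%N -> u k = 0) -> tsum u = (psum u n)%:E.
Proof.
move=> un; apply: cvg_lim => //; apply: cvg_near_cst; near=> m.
have nm : (n <= m)%N by near: m; exists n.
rewrite sumEFin (big_cat_nat _ nm)//= [X in _ + X]big_nat_cond.
rewrite [X in _ + X]big1 ?addr0//.
by move=> i /andP[/andP[/un]].
Unshelve. all: by end_near. Qed.

End series.

Section l1_basics.
Context {R : realType}.
Implicit Types x y : l1 R.

Lemma l1_psum_le x n : \sum_(0 <= k < n) `|x k| <= `|x|.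
Proof.
apply: (psum_le_fine (u := fun k => `|x k|)) => //.
by have := l1valP x; rewrite inE.
Qed.

Lemma l1_coord_le x k : `|x k| <= `|x|.
Proof.
by apply: le_trans (l1_psum_le x k.+1); rewrite big_nat_recr//= lerDr sumr_ge0.
Qed.

Lemma l1_norm_le x (B : R) : (forall n, \sum_(0 <= k < n) `|x k| <= B) -> `|x| <= B.
Proof.
move=> h; rewrite l1_normE -lee_fin fineK; last exact: l1norm_fin_num.
by apply: (tsum_le (u := fun k => `|x k|)) => // n; rewrite lee_fin.
Qed.

Lemma near_l1_norm x (e : R) : 0 < e -> \forall y \near x, `|x - y| < e.
Proof.
move=> e0; apply/nbhs_ballP; exists e => //= y; by rewrite -ball_normE.
Qed.

Lemma l1_coord_continuous k : continuous (fun x : l1 R => x k).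
Proof.
move=> x; apply/(@cvgrPdist_lt _ _ _ (nbhs x) (nbhs_filter x)) => e e0.
apply: (@filterS _ (nbhs x) (nbhs_filter x)) (near_l1_norm x e0) => y; apply: le_lt_trans.
exact: (l1_coord_le (x - y) k).
Qed.

Lemma finsupp_l1 (f : nat -> R) n : (forall k, (n <= k)%N -> f k = 0) -> f \in l1pred.
Proof.
move=> fn; rewrite inE /l1norm /= (@tsum_finsupp _ (fun k => `|f k|) n) ?ltry//.
by move=> k /fn ->; rewrite normr0.
Qed.

End l1_basics.

Section truncated_energy.
Context {R : realType}.
Variables (a b : R).
Hypotheses (b0 : 0 <= b) (ab : b < a).
Implicit Types (x y : l1 R) (m : R).

Definition dens_trunc K x : R := \sum_(0 <= k < K) k.+1%:R * x k.
Definition sq_trunc K x : R := \sum_(0 <= k < K) k.+1%:R ^+ 2 * x k ^+ 2.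

(* The energy of a configuration of density [D] and square density [S],
   minimised over the mass that may be added at infinity. *)
Definition relaxed m (D S : R) : R :=
  - m * D + a / 2 * D ^+ 2 - b / 2 * S - (Num.max (m - a * D) 0) ^+ 2 / (2 * (a - b)).

Definition trunc_energy m K x : R := relaxed m (dens_trunc K x) (sq_trunc K x).

Let ab0 : 0 < a - b. Proof. by rewrite subr_gt0. Qed.

Lemma relaxed_le m (D S t S' : R) : 0 <= t -> S' <= S + t ^+ 2 ->
  relaxed m D S <= - m * (D + t) + a / 2 * (D + t) ^+ 2 - b / 2 * S'.
Proof.
move=> t0 hS; rewrite /relaxed.
have hb : b / 2 * S' <= b / 2 * (S + t ^+ 2) by rewrite ler_wpM2l// divr_ge0.
suff : (m - a * D) * t <= (a - b) / 2 * t ^+ 2 +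
    Num.max (m - a * D) 0 ^+ 2 / (2 * (a - b)) by lra.
have [c0|c0] := leP (m - a * D) 0.
  rewrite expr0n/= mul0r addr0 (@le_trans _ _ 0)//.
    by rewrite mulr_le0_ge0.
  by rewrite mulr_ge0 ?sqr_ge0// divr_ge0// ltW.
set c := m - a * D; rewrite -subr_ge0.
have -> : (a - b) / 2 * t ^+ 2 + c ^+ 2 / (2 * (a - b)) - c * t =
    ((a - b) * t - c) ^+ 2 / (2 * (a - b)) by field; rewrite gt_eqF.
by rewrite divr_ge0 ?sqr_ge0// mulr_ge0// ltW.
Qed.

Lemma relaxed_attained m (D S : R) : let t := Num.max (m - a * D) 0 / (a - b) in
  relaxed m D S = - m * (D + t) + a / 2 * (D + t) ^+ 2 - b / 2 * (S + t ^+ 2).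
Proof.
rewrite /relaxed; have [c0|c0] := leP (m - a * D) 0.
  by rewrite /= expr0n/= !mul0r; ring.
by rewrite /=; field; rewrite gt_eqF.
Qed.

Section nonnegative.
Variable x : l1 R.
Hypothesis x0 : l1_nonneg x.

Let u0 k : 0 <= k.+1%:R * x k. Proof. by rewrite mulr_ge0. Qed.
Let v0 k : 0 <= k.+1%:R ^+ 2 * x k ^+ 2.
Proof. by rewrite mulr_ge0 ?sqr_ge0. Qed.

Lemma sq_trunc_increment K n : (K <= n)%N ->
  sq_trunc n x <= sq_trunc K x + (dens_trunc n x - dens_trunc K x) ^+ 2.
Proof.
move=> Kn; rewrite /sq_trunc /dens_trunc !(big_cat_nat (leq0n K) Kn)//= [X in X ^+ 2]addrC addKr.
rewrite lerD2l; elim: n Kn => [|n IH]; first by rewrite leqn0 => /eqP ->; rewrite !big_geq// expr0n.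
rewrite leq_eqVlt => /predU1P[->|]; first by rewrite !big_geq// expr0n.
rewrite ltnS => Kn; rewrite !big_nat_recr//=.
set A := \sum_(K <= i < n) _; set B := \sum_(K <= i < n) _.
have A0 : 0 <= B by exact: sumr_ge0.
have := IH Kn; rewrite -/A -/B -exprMn => h.
have : 0 <= B * (n.+1%:R * x n) by rewrite mulr_ge0.
rewrite sqrrD; move: h; rewrite -mulr_natr; lra.
Qed.

Lemma density_trunc_cvg : (density x < +oo)%E ->
  dens_trunc ^~ x @ \oo --> fine (density x).
Proof. by move=> h; exact: psum_cvg. Qed.

Lemma sq_density_fin : (density x < +oo)%E -> (sq_density x < +oo)%E.
Proof.
move=> h; apply: (@le_lt_trans _ _ ((fine (density x)) ^+ 2)%:E); last exact: ltry.
apply: tsum_le => // n; rewrite lee_fin.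
have := @sq_trunc_increment 0 n isT.
rewrite /sq_trunc /dens_trunc !(@big_geq _ _ _ 0 0)// add0r subr0 => /le_trans; apply.
have d0 : 0 <= \sum_(0 <= k < n) k.+1%:R * x k by exact: sumr_ge0.
have := psum_le_fine n u0 h; rewrite -/(density x) => h2.
by rewrite lerXn2r// ?nnegrE// (le_trans d0).
Qed.

Lemma sq_trunc_cvg : (density x < +oo)%E ->
  sq_trunc ^~ x @ \oo --> fine (sq_density x).
Proof. by move=> h; apply: psum_cvg => //; exact: sq_density_fin. Qed.

Lemma trunc_energy_le m K : (density x < +oo)%E ->
  trunc_energy m K x <= - m * fine (density x) + a / 2 * fine (density x) ^+ 2
     - b / 2 * fine (sq_density x).
Proof.
move=> h; rewrite /trunc_energy.
set D := fine (density x); set S := fine (sq_density x).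
have DK : dens_trunc K x <= D by exact: psum_le_fine.
have -> : D = dens_trunc K x + (D - dens_trunc K x) by ring.
apply: relaxed_le; first by rewrite subr_ge0.
have c1 : (fun n => sq_trunc K x + (dens_trunc n x - dens_trunc K x) ^+ 2) @ \oo -->
    sq_trunc K x + (D - dens_trunc K x) ^+ 2.
  apply: cvgD; first exact: cvg_cst.
  have c2 : (fun n => dens_trunc n x - dens_trunc K x) @ \oo --> D - dens_trunc K x.
    by apply: cvgB; [exact: density_trunc_cvg|exact: cvg_cst].
  by under eq_fun do rewrite expr2; rewrite expr2; exact: cvgM.
apply: ler_cvg_to (sq_trunc_cvg h) c1 _.
by near=> n; apply: sq_trunc_increment; near: n; exists K.
Unshelve. all: by end_near. Qed.

End nonnegative.
End truncated_energy.

Section relaxation.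
Context {R : realType}.
Variables (a b : R).
Hypotheses (b0 : 0 <= b) (ab : b < a).
Implicit Types (x y : l1 R) (m : R).

Lemma relaxed_cvg {T : Type} (F : set_system T) {FF : Filter F} (f g : T -> R) m (D S : R) :
  f @ F --> D -> g @ F --> S ->
  (fun t => relaxed a b m (f t) (g t)) @ F --> relaxed a b m D S.
Proof.
move=> fD gS.
have sq (h : T -> R) (l : R) : h @ F --> l -> (fun t => h t ^+ 2) @ F --> l ^+ 2.
  by move=> hl; under eq_fun do rewrite expr2; rewrite expr2; exact: cvgM.
have cM (h : T -> R) (c l : R) : h @ F --> l -> (fun t => c * h t) @ F --> c * l.
  by move=> hl; apply: cvgM => //; exact: cvg_cst.
have maxE (c : R) : Num.max c 0 = (c + `|c|) / 2.
  by case: leP => h; [rewrite ler0_norm//|rewrite gtr0_norm//]; field.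
have posE (c : R) : Num.max c 0 ^+ 2 / (2 * (a - b)) =
    (2 * (a - b))^-1 * (2^-1 * (c + `|c|)) ^+ 2.
  by rewrite maxE mulrC [in RHS](mulrC 2^-1).
rewrite /relaxed posE; under eq_fun do rewrite posE.
have mD : (fun t => m - a * f t) @ F --> m - a * D.
  by apply: cvgB; [exact: cvg_cst|exact: cM].
apply: cvgB; last first.
  by apply/cM/sq/cM; apply: cvgD => //; exact: cvg_norm.
apply: cvgB; last exact: cM.
by apply: cvgD; [exact: cM|apply/cM/sq].
Qed.

Lemma weighted_psum_cvg (c : nat -> R) (n : nat) K x :
  (fun y : l1 R => \sum_(0 <= k < K) c k * (y k) ^+ n) @ nbhs x -->
  \sum_(0 <= k < K) c k * (x k) ^+ n.
Proof.
elim: K => [|K IH].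
  under eq_fun do rewrite big_geq//; rewrite big_geq//; exact: cvg_cst.
under eq_fun do rewrite big_nat_recr//=; rewrite big_nat_recr//=.
apply: cvgD => //; apply: cvgM; first exact: cvg_cst.
have := @l1_coord_continuous R K x => h.
exact: (cvg_comp _ _ h (@exprn_continuous R n (x K))).
Qed.

Lemma trunc_energy_continuous m K x :
  (fun y : l1 R => trunc_energy a b m K y) @ nbhs x --> trunc_energy a b m K x.
Proof.
apply: relaxed_cvg; last exact: weighted_psum_cvg.
by have := @weighted_psum_cvg (fun k => k.+1%:R) 1 K x; under eq_fun do under eq_bigr do rewrite expr1;
  under eq_bigr do rewrite expr1.
Qed.

Lemma trunc_energy_le_H m K x : ((trunc_energy a b m K x)%:E <= H_HYL a b m x)%E.
Proof.
rewrite /H_HYL; case: asboolP => [[x0 xoo]|_]; last exact: leey.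
by rewrite lee_fin; apply: trunc_energy_le.
Qed.

Lemma lsc_regularization_ge (X : topologicalType) (f : X -> \bar R) (x : X) (c : \bar R) :
  (\forall y \near x, (c <= f y)%E) -> (c <= lsc_regularization f x)%E.
Proof.
move=> h; rewrite /lsc_regularization limf_einfE.
apply: le_ereal_sup_tmp; exists (ereal_inf (f @` [set y | (c <= f y)%E])).
  by exists [set y | (c <= f y)%E].
by apply: le_ereal_inf_tmp => _ [y hy <-].
Qed.

Lemma lsc_regularization_le (X : topologicalType) (f : X -> \bar R) (x : X)
    (y : nat -> X) (l : \bar R) :
  y @ \oo --> x -> f \o y @ \oo --> l -> (lsc_regularization f x <= l)%E.
Proof.
move=> yx fl; rewrite /lsc_regularization limf_einfE.
apply: ge_ereal_sup => _ [V /yx Vy <-]; apply: cvge_to_ge fl _.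
apply: (@filterS _ (nbhs \oo) _ (y @^-1` V) _ _ Vy) => n Vn.
by apply: ereal_inf_lbound; exists (y n).
Qed.

Lemma trunc_energy_le_H_lsc m K x :
  ((trunc_energy a b m K x)%:E <= H_HYL_lsc a b m x)%E.
Proof.
apply/lee_subgt0Pr => e e0; apply: lsc_regularization_ge.
have /(@cvgrPdist_lt _ _ _ (nbhs x) (nbhs_filter x))/(_ _ e0) :=
  @trunc_energy_continuous m K x.
apply: (@filterS _ (nbhs x) (nbhs_filter x)) => y.
rewrite ltr_distlC => /andP[h _]; apply: le_trans (trunc_energy_le_H m K y).
by rewrite -EFinB lee_fin ltW.
Qed.

Definition energy_lsc m x : R := relaxed a b m (fine (density x)) (fine (sq_density x)).

Lemma trunc_energy_cvg m x : finite_density x ->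
  (fun K => trunc_energy a b m K x) @ \oo --> energy_lsc m x.
Proof.
by move=> [x0 xoo]; apply: relaxed_cvg; [exact: density_trunc_cvg|exact: sq_trunc_cvg].
Qed.

Lemma energy_lsc_le_H_lsc m x : finite_density x ->
  ((energy_lsc m x)%:E <= H_HYL_lsc a b m x)%E.
Proof.
move=> fx; have c : (fun K => (trunc_energy a b m K x)%:E) @ \oo --> (energy_lsc m x)%:E.
  by apply: cvg_EFin; [exact: nearW|exact: trunc_energy_cvg].
by apply: cvge_to_le c _; apply: nearW => K; exact: trunc_energy_le_H_lsc.
Qed.

Lemma H_lsc_infty m x : ~ finite_density x -> H_HYL_lsc a b m x = +oo%E.
Proof.
move=> nfx.
have [x0|/existsNP[k /negP]] := pselect (l1_nonneg x); last first.
  rewrite -ltNge => xk; apply/eqP; rewrite -leye_eq; apply: lsc_regularization_ge.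
  have xk0 : 0 < - x k by rewrite oppr_gt0.
  have /(@cvgrPdist_lt _ _ _ (nbhs x) (nbhs_filter x))/(_ _ xk0) :=
    @l1_coord_continuous R k x.
  apply: (@filterS _ (nbhs x) (nbhs_filter x)) => y.
  rewrite ltr_distlC /H_HYL => /andP[_ h]; case: asboolP => // -[y0 _].
  by exfalso; have := y0 k; lra.
have D0 : ~ (density x < +oo)%E by move=> h; apply: nfx.
have ab0 : 0 < a - b by rewrite subr_gt0.
have a0 : 0 < a by exact: le_lt_trans ab.
apply: eq_infty => M; have [K hK] := @tsum_infty _ (fun k => k.+1%:R * x k)
  (1 + `|m / a| + 2 * (`|M| + `|m|) / (a - b)) (fun k => mulr_ge0 (ler0n _ _) (x0 k)) D0.
apply: le_trans (trunc_energy_le_H_lsc m K x); rewrite lee_fin /trunc_energy.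
have hS := @sq_trunc_increment R x x0 0 K isT.
have [e1 e2] : dens_trunc 0 x = 0 /\ sq_trunc 0 x = 0 by split; rewrite /dens_trunc /sq_trunc big_geq.
rewrite e1 e2 add0r subr0 in hS; move: hK hS.
rewrite -/(dens_trunc K x); set D := dens_trunc K x; set S := sq_trunc K x => hK hS.
set E := 2 * _ / _ in hK.
have E0 : 0 <= E by apply: divr_ge0; [apply: mulr_ge0 => //; exact: addr_ge0|exact: ltW].
have Dm : m - a * D <= 0.
  rewrite subr_le0 -ler_pdivrMl// mulrC; apply: le_trans (ler_norm _) _.
  by have := normr_ge0 (m / a); lra.
have D1 : 1 <= D by have := normr_ge0 (m / a); lra.
have DE : `|M| + `|m| <= (a - b) / 2 * D.
  have -> : `|M| + `|m| = (a - b) / 2 * E by rewrite /E; field; rewrite gt_eqF.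
  by rewrite ler_pM2l ?divr_gt0//; have := normr_ge0 (m / a); lra.
rewrite /relaxed (max_idPr Dm) expr0n/= mul0r subr0.
have h1 : b / 2 * S <= b / 2 * D ^+ 2 by rewrite ler_wpM2l// divr_ge0.
have h2 : (`|M| + `|m|) * D <= (a - b) / 2 * D * D by rewrite ler_wpM2r//; lra.
have h3 : m * D <= `|m| * D by rewrite ler_wpM2r ?ler_norm//; lra.
have h4 : `|M| <= `|M| * D by rewrite ler_peMr.
have := ler_norm M; lra.
Qed.

(* The maximiser [(m - a D)_+ / (a - b)] of the extra density is carried by the
   single loop length [K.+1]. *)
Definition recovery_seq m x K : nat -> R := fun k =>
  if (k < K)%N then x k
  else if k == K then Num.max (m - a * fine (density x)) 0 / (a - b) / K.+1%:R else 0.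

Lemma recovery_l1 m x K : recovery_seq m x K \in l1pred.
Proof.
apply: (@finsupp_l1 _ _ K.+1) => k Kk.
by rewrite /recovery_seq ltnNge (ltnW Kk) /= gtn_eqF.
Qed.

Definition recovery m x K : l1 R := L1 (recovery_l1 m x K).

Lemma recovery_ge m x K k : (K < k)%N -> recovery m x K k = 0.
Proof. by move=> Kk; rewrite /= /recovery_seq ltnNge (ltnW Kk) /= gtn_eqF. Qed.

Lemma recovery_lt m x K k : (k < K)%N -> recovery m x K k = x k.
Proof. by move=> kK; rewrite /= /recovery_seq kK. Qed.

Lemma recovery_at m x K : recovery m x K K =
  Num.max (m - a * fine (density x)) 0 / (a - b) / K.+1%:R.
Proof. by rewrite /= /recovery_seq ltnn eqxx. Qed.

Lemma recovery_nonneg m x K : l1_nonneg x -> l1_nonneg (recovery m x K).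
Proof.
move=> x0 k; rewrite /= /recovery_seq; case: ifP => // _; case: ifP => // _.
by rewrite divr_ge0// divr_ge0 ?le_max ?lexx ?orbT// ltW// subr_gt0.
Qed.

Lemma recovery_psum m x K (f : nat -> R -> R) : (forall k, f k 0 = 0) ->
  (\sum_(0 <= k <oo) (f k (recovery m x K k))%:E)%E =
  (\sum_(0 <= k < K) f k (x k) + f K (recovery m x K K))%:E.
Proof.
move=> f0; rewrite (@tsum_finsupp _ (fun k => f k (recovery m x K k)) K.+1).
  rewrite big_nat_recr//=; congr (_ + _)%:E; apply: eq_big_nat => k /andP[_ kK].
  by rewrite /recovery_seq kK.
by move=> k Kk; rewrite recovery_ge.
Qed.

Lemma recovery_finite_density m x K : l1_nonneg x -> finite_density (recovery m x K).
Proof.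
move=> x0; split; first exact: recovery_nonneg.
by rewrite /density (@recovery_psum _ _ _ (fun k => *%R k.+1%:R))// ?ltry// => k; rewrite mulr0.
Qed.

Lemma recovery_energy m x : finite_density x ->
  (fun K => H_HYL a b m (recovery m x K)) @ \oo --> (energy_lsc m x)%:E.
Proof.
move=> [x0 xoo]; pose t := Num.max (m - a * fine (density x)) 0 / (a - b).
have e K : H_HYL a b m (recovery m x K) = (- m * (dens_trunc K x + t) +
    a / 2 * (dens_trunc K x + t) ^+ 2 - b / 2 * (sq_trunc K x + t ^+ 2))%:E.
  rewrite /H_HYL asboolT; last exact: recovery_finite_density.
  have K0 : K.+1%:R != 0 :> R by rewrite pnatr_eq0.
  have -> : fine (density (recovery m x K)) = dens_trunc K x + t.
    rewrite /density (@recovery_psum _ _ _ (fun k => *%R k.+1%:R)) => [|k]; last by rewrite mulr0.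
    by rewrite [in LHS]recovery_at; congr (_ + _); rewrite mulrC divfK.
  have -> : fine (sq_density (recovery m x K)) = sq_trunc K x + t ^+ 2.
    rewrite /sq_density (@recovery_psum _ _ _ (fun k z => k.+1%:R ^+ 2 * z ^+ 2)) => [|k].
      by rewrite [in LHS]recovery_at; congr (_ + _); rewrite -exprMn mulrC divfK.
    by rewrite expr0n mulr0.
  by [].
under eq_fun do rewrite e; apply: cvg_EFin; first exact: nearW.
rewrite /energy_lsc relaxed_attained// -/t.
have cM (h : nat -> R) (c l : R) : h @ \oo --> l -> (fun t => c * h t) @ \oo --> c * l.
  by move=> hl; apply: cvgM => //; exact: cvg_cst.
have cD : (fun K => dens_trunc K x + t) @ \oo --> fine (density x) + t.
  by apply: cvgD; [exact: density_trunc_cvg|exact: cvg_cst].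
have cS : (fun K => sq_trunc K x + t ^+ 2) @ \oo --> fine (sq_density x) + t ^+ 2.
  by apply: cvgD; [exact: sq_trunc_cvg|exact: cvg_cst].
apply: cvgB; last exact: cM.
apply: cvgD; apply: cM => //.
by under eq_fun do rewrite expr2; rewrite expr2; exact: cvgM.
Qed.

Lemma recovery_cvg m x : recovery m x @ \oo --> x.
Proof.
apply/cvgrPdist_le => e e0.
set t := Num.max (m - a * fine (density x)) 0 / (a - b).
have t0 : 0 <= t by rewrite divr_ge0 ?le_max ?lexx ?orbT// ltW// subr_gt0.
have xoo : (\sum_(0 <= k <oo) `|x k|%:E < +oo)%E by have := l1valP x; rewrite inE.
have ct := @psum_cvg _ (fun k => `|x k|) (fun=> normr_ge0 _) xoo.
have e2 : 0 < e / 2 by rewrite divr_gt0.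
have ch : (fun K => t / K.+1%:R) @ \oo --> (0 : R).
  rewrite -[X in _ --> X](mulr0 t); apply: cvgM; [exact: cvg_cst|exact: cvg_harmonic].
have sum_delta (c : R) N i : 0 <= c -> \sum_(0 <= k < N) (if k == i then c else 0) <= c.
  move=> c0; suff -> : \sum_(0 <= k < N) (if k == i then c else 0) = if (i < N)%N then c else 0.
    by case: ifP.
  elim: N => [|N IH]; first by rewrite big_geq.
  by rewrite big_nat_recr//= IH ltnS; case: ltngtP => _; rewrite ?addr0 ?add0r.
have sum_cut N K : (K <= N)%N -> \sum_(0 <= k < N) (if (k < K)%N then 0 else `|x k|) =
    \sum_(0 <= k < N) `|x k| - \sum_(0 <= k < K) `|x k|.
  move=> KN; rewrite !(big_cat_nat (leq0n K) KN)/= [RHS]addrC addKr.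
  rewrite [X in X + _]big1_seq ?add0r; last by move=> k /=; rewrite mem_index_iota => /andP[_ ->].
  by apply: eq_big_nat => k /andP[Kk _]; rewrite ltnNge Kk.
near=> K; apply: l1_norm_le => n'.
have nn := leq_addl K n'; set n := (K + n')%N in nn.
apply: le_trans (psum_le (u := fun k => `|(x - recovery m x K) k|) (fun=> normr_ge0 _) nn) _.
have h1 : t / K.+1%:R <= e / 2.
  near: K; move/cvgrPdist_le : ch => /(_ _ e2); apply: filterS => K.
  by rewrite sub0r normrN; apply: le_trans; exact: ler_norm.
have h2 : \sum_(0 <= k < n) `|x k| - \sum_(0 <= k < K) `|x k| <= e / 2.
  apply: (@le_trans _ _ (fine (\sum_(0 <= k <oo) `|x k|%:E)%E - \sum_(0 <= k < K) `|x k|)).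
    by rewrite lerD2r; apply: (@psum_le_fine _ (fun k => `|x k|)).
  apply: le_trans (ler_norm _) _.
  by near: K; move/cvgrPdist_le : ct => /(_ _ e2); apply: filterS.
have split_le k : `|(x - recovery m x K) k| <=
    (if (k < K)%N then 0 else `|x k|) + (if k == K then t / K.+1%:R else 0).
  rewrite [X in `|X|](_ : _ = x k - recovery m x K k)//.
  have [kK|kK|->] := ltngtP k K.
  - by rewrite recovery_lt// subrr normr0 addr0.
  - by rewrite recovery_ge// subr0 addr0.
  - rewrite recovery_at -/t; apply: le_trans (ler_normB _ _) _.
    by rewrite lerD2l ger0_norm// divr_ge0.
apply: (@le_trans _ _ (\sum_(0 <= k < n) ((if (k < K)%N then 0 else `|x k|) +
    (if k == K then t / K.+1%:R else 0)))).
  by apply: ler_sum_nat => k _; exact: split_le.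
rewrite big_split/= sum_cut ?leq_addr//.
have h3 := sum_delta (t / K.+1%:R) n K (divr_ge0 t0 (ler0n _ _)).
by apply: le_trans (lerD h2 (le_trans h3 h1)) _; rewrite -splitr.
Unshelve. all: by end_near. Qed.

Lemma H_lscE m x : finite_density x -> H_HYL_lsc a b m x = (energy_lsc m x)%:E.
Proof.
move=> fx; apply/eqP; rewrite eq_le energy_lsc_le_H_lsc// andbT.
exact: (lsc_regularization_le (@recovery_cvg m x) (@recovery_energy m x fx)).
Qed.

Lemma H_lsc_formulas m x : finite_density x ->
  let D := fine (density x) in
  H_HYL_lsc a b m x =
    (H_HYL a b m x - ((Num.max (m - a * D) 0) ^+ 2 / (2 * (a - b)))%:E)%E
  /\
  H_HYL_lsc a b m x =
    (- (b / 2) * fine (sq_density x) +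
     if m / a <= D then - m * D + a / 2 * D ^+ 2
     else - (b / (a - b)) * (- m * D + a / 2 * D ^+ 2)
          - m ^+ 2 / (2 * (a - b)))%:E.
Proof.
move=> fx D; have ab0 : 0 < a - b by rewrite subr_gt0.
have a0 : 0 < a by exact: le_lt_trans ab.
rewrite H_lscE// /H_HYL asboolT// -EFinB; split; first by [].
congr EFin; rewrite /energy_lsc /relaxed -/D ler_pdivrMr//.
have [h|h] := leP m (D * a).
  have -> : Num.max (m - a * D) 0 = 0 by apply/max_idPr; rewrite subr_le0 mulrC.
  by rewrite expr0n/= mul0r subr0; ring.
have -> : Num.max (m - a * D) 0 = m - a * D by apply/max_idPl; rewrite subr_ge0 mulrC ltW.
by field; rewrite gt_eqF.
Qed.

End relaxation.

(** * The entropy *)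

Section relative_entropy.
Context {R : realType}.
Implicit Types (q t l e : R).

Definition entropy q t : R := t * (ln (t / q) - 1) + q.

Lemma entropy_ge_affine q t l : 0 < q -> 0 <= t ->
  l * t - q * (expR l - 1) <= entropy q t.
Proof.
move=> q0; rewrite /entropy le_eqVlt => /predU1P[<-|t0].
  by rewrite mulr0 mul0r add0r add0r; have := mulr_ge0 (ltW q0) (expR_ge0 l); lra.
have tq : 0 < t / q by rewrite divr_gt0.
have -> : q * (expR l - 1) = t * expR (l - ln (t / q)) - q.
  by rewrite expRB lnK ?posrE//; field; rewrite !gt_eqF.
have := expR_ge1Dx (l - ln (t / q)).
rewrite -(ler_pM2l t0); lra.
Qed.

Lemma entropy_ge0 q t : 0 < q -> 0 <= t -> 0 <= entropy q t.
Proof.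
by move=> q0 t0; have := @entropy_ge_affine q t 0 q0 t0; rewrite expR0 subrr mulr0 mul0r subr0.
Qed.

(* The maximiser of [entropy_ge_affine]; at [t = 0] the supremum is not attained. *)
Definition dual_point e q t : R := if 0 < t then ln (t / q) else ln (e / q).

Lemma entropy_dual e q t : 0 < q -> 0 < e -> 0 <= t ->
  entropy q t - e <= dual_point e q t * t - q * (expR (dual_point e q t) - 1).
Proof.
move=> q0 e0 t0; rewrite /entropy /dual_point; case: ifPn => [tp|].
  by rewrite lnK ?posrE ?divr_gt0// [X in _ <= X](_ : _ = t * (ln (t / q) - 1) + q);
    [lra|field; rewrite gt_eqF].
rewrite -leNgt => tn; have -> : t = 0 by apply/eqP; rewrite eq_le tn.
rewrite lnK ?posrE ?divr_gt0// mulr0 mul0r !add0r.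
have -> : - (q * (e / q - 1)) = q - e by field; rewrite gt_eqF.
by [].
Qed.

End relative_entropy.

Section free_intensities.
Context {R : realType} {d : nat} {beta : R}.
Hypotheses (d0 : (0 < d)%N) (beta0 : 0 < beta).
Implicit Types x : l1 R.

Local Notation q k := (q_free d beta 0 k.+1).

Let C : R := (4 * pi * beta) `^ (d%:R / 2).
Let C0 : 0 < C. Proof. by rewrite powR_gt0// !mulr_gt0// pi_gt0. Qed.

Lemma q_free0E k : q k = (C * k.+1%:R `^ (1 + d%:R / 2))^-1.
Proof. by rewrite /q_free mulr0 mul0r expR0 div1r. Qed.

Lemma q_free0_gt0 k : 0 < q k.
Proof. by rewrite q_free0E invr_gt0 mulr_gt0// powR_gt0// ltr0n. Qed.

Let root4 k : R := k.+1%:R `^ (1 / 4).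
Let root4_gt0 k : 0 < root4 k. Proof. by rewrite powR_gt0// ltr0n. Qed.
Let root4X k n : root4 k ^+ n = k.+1%:R `^ (n%:R / 4).
Proof. by rewrite -powR_mulrn ?powR_ge0// -powRrM; congr (_ `^ _); ring. Qed.
Let root4_4 k : root4 k ^+ 4 = k.+1%:R.
Proof. by rewrite root4X divff// powRr1. Qed.

Let root4_sum n : \sum_(0 <= k < n.+1) (root4 k ^+ 5)^-1 <= 5 - 4 / root4 n.
Proof.
elim: n => [|n IH].
  by rewrite big_nat1 /root4 powR1 expr1n invr1; lra.
rewrite big_nat_recr//=; apply: le_trans (lerD IH (lexx _)) _.
suff : (root4 n.+1 ^+ 5)^-1 <= 4 / root4 n - 4 / root4 n.+1 by lra.
have h4 : root4 n.+1 ^+ 4 = root4 n ^+ 4 + 1 by rewrite !root4_4 natr1.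
move: (root4_gt0 n) (root4_gt0 n.+1) h4; set s := root4 n; set r := root4 n.+1 => s0 r0 h4.
have sr : s <= r.
  by rewrite -(@ler_pXn2r _ 4)// ?nnegrE ?(ltW s0) ?(ltW r0)// h4 lerDl.
have -> : 4 / s - 4 / r = 4 * (r - s) / (s * r) by field; rewrite !gt_eqF.
rewrite -[X in X <= _]mul1r ler_pdivrMr ?exprn_gt0// mulrAC ler_pdivlMr ?mulr_gt0// mul1r.
have h1 : (r - s) * (4 * r ^+ 3) >= 1.
  have e0 : (r - s) * (r ^+ 3 + r ^+ 2 * s + r * s ^+ 2 + s ^+ 3) = 1.
    by transitivity (r ^+ 4 - s ^+ 4); [ring|rewrite h4; ring].
  rewrite -[X in X <= _]e0.
  apply: ler_wpM2l; first by rewrite subr_ge0.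
  have e1 : r ^+ 2 * s <= r ^+ 3 by rewrite [leRHS]exprSr ler_wpM2l// exprn_ge0// ltW.
  have e2 : r * s ^+ 2 <= r * r ^+ 2.
    by rewrite ler_wpM2l ?(ltW r0)// lerXn2r// nnegrE ltW.
  have e3 : s ^+ 3 <= r ^+ 3 by rewrite lerXn2r// nnegrE ltW.
  by rewrite -exprS in e2; lra.
apply: (@le_trans _ _ (r * r)).
  by rewrite ler_pM2r.
have -> : 4 * (r - s) * r ^+ 5 = (r * r) * ((r - s) * (4 * r ^+ 3)) by ring.
by rewrite ler_peMr// mulr_ge0// ltW.
Qed.

(* [expR (tight_weight k)] is of order [k ^ (1 / 4)], which the intensities
   [q_k <= C k ^ (- 3 / 2)] can absorb, while the weights still tend to infinity. *)
Definition tight_weight k : R := 1 + ln k.+1%:R / 4.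

Lemma tight_weight_ge1 k : 1 <= tight_weight k.
Proof. by rewrite lerDl divr_ge0// ln_ge0// ler1n. Qed.

Lemma tight_weight_homo m n : (m <= n)%N -> tight_weight m <= tight_weight n.
Proof.
by move=> mn; rewrite lerD2l ler_pM2r ?invr_gt0// ler_ln ?posrE ?ltr0n// ler_nat.
Qed.

Lemma tight_weight_unbounded (M : R) : exists k, M <= tight_weight k.
Proof.
exists (Num.truncn (expR (4 * M))); rewrite /tight_weight.
have h := truncnS_gt (expR (4 * M)).
have : ln (expR (4 * M)) <= ln (Num.truncn (expR (4 * M))).+1%:R.
  by rewrite ler_ln ?posrE ?expR_gt0 ?ltr0n// ltW.
rewrite expRK; lra.
Qed.

Lemma q_free0_weighted_sum : exists B : R, forall n,
  \sum_(0 <= k < n) q k * expR (tight_weight k) <= B.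
Proof.
exists (expR 1 / C * 5) => n.
apply: (@le_trans _ _ (expR 1 / C * \sum_(0 <= k < n.+1) (root4 k ^+ 5)^-1)); last first.
  apply: ler_wpM2l; first by rewrite divr_ge0 ?expR_ge0// ltW.
  apply: le_trans (root4_sum n) _; rewrite gerBl divr_ge0// ltW//.
rewrite mulr_sumr big_nat_recr//= -[leLHS]addr0 lerD//; last first.
  by rewrite mulr_ge0 ?divr_ge0 ?expR_ge0 ?invr_ge0 ?exprn_ge0// ltW.
apply: ler_sum_nat => k _; rewrite q_free0E /tight_weight expRD.
have k0 : 0 < k.+1%:R :> R by rewrite ltr0n.
have -> : expR (ln k.+1%:R / 4) = root4 k.
  by rewrite expRM lnK ?posrE// /root4 div1r.
rewrite invfM.
have -> : C^-1 * (k.+1%:R `^ (1 + d%:R / 2))^-1 * (expR 1 * root4 k) =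
    expR 1 / C * ((k.+1%:R `^ (1 + d%:R / 2))^-1 * root4 k) by ring.
apply: ler_wpM2l; first by rewrite divr_ge0 ?expR_ge0// ltW.
rewrite mulrC ler_pdivrMr ?powR_gt0// mulrC ler_pdivlMr ?exprn_gt0//.
rewrite -exprS root4X ler_powR ?ler1n//.
have : 1 <= d%:R :> R by rewrite ler1n.
lra.
Qed.

End free_intensities.

Section free_rate_function.
Context {R : realType} {d : nat} {beta : R}.
Hypotheses (d0 : (0 < d)%N) (beta0 : 0 < beta).
Implicit Types x : l1 R.

Local Notation q k := (q_free d beta 0 k.+1).
Local Notation I := (rate0 d beta).

Let q0 k : 0 < q k. Proof. exact: q_free0_gt0. Qed.
Let ql0 k : 0 <= q k. Proof. exact/ltW. Qed.

Lemma q_free0_summable : (\sum_(0 <= k <oo) (q k)%:E < +oo)%E.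
Proof.
have [B hB] := @q_free0_weighted_sum R d beta d0 beta0.
apply: (@le_lt_trans _ _ B%:E); last exact: ltry.
apply: tsum_le => // n; rewrite lee_fin; apply: le_trans (hB n).
apply: ler_sum_nat => k _; rewrite ler_peMr// -expR0 ler_expR.
by apply: le_trans (tight_weight_ge1 k).
Qed.

Definition qtot : R := fine (\sum_(0 <= k <oo) (q k)%:E)%E.

Lemma qbar0E : qbar d beta 0 = qtot%:E.
Proof.
rewrite /qtot tsum_fin//; last exact: q_free0_summable.
rewrite /qbar -(@nneseries_addn _ (fun k => (q_free d beta 0 k)%:E) 1).
  by apply: eq_eseriesr => k _; rewrite addn1.
move=> [|k]; rewrite lee_fin// /q_free.
by rewrite divr_ge0 ?expR_ge0// mulr_ge0 ?powR_ge0.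
Qed.

Lemma rate0_nonneg x : l1_nonneg x ->
  I x = (\sum_(0 <= k <oo) (entropy (q k) (x k))%:E)%E.
Proof.
move=> x0; rewrite /rate0 asboolT// qbar0E.
have e0 k : 0 <= entropy (q k) (x k) by exact: entropy_ge0.
have c1 := cvg_tsum e0.
have c2 : (fun n => (\sum_(0 <= k < n) q k)%:E) @ \oo --> qtot%:E.
  by apply: cvg_EFin; [exact: nearW|apply: psum_cvg => //; exact: q_free0_summable].
have c3 : (fun n => \sum_(0 <= k < n) (x k * (ln (x k / q k) - 1))%:E)%E @ \oo -->
    (\sum_(0 <= k <oo) (entropy (q k) (x k))%:E - qtot%:E)%E.
  under eq_fun => n.
    rewrite (_ : (\sum_(0 <= k < n) _)%E =
      ((\sum_(0 <= k < n) entropy (q k) (x k))%:E - (\sum_(0 <= k < n) q k)%:E)%E).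
      over.
    rewrite sumEFin -EFinB -sumrB; congr EFin; apply: eq_bigr => k _.
    by rewrite /entropy addrK.
  by apply: cvgeB => //; rewrite fin_num_adde_defl.
by rewrite (cvg_lim _ c3)// subeK.
Qed.

Lemma rate0_ge0 x : (0 <= I x)%E.
Proof.
have [x0|nx0] := pselect (l1_nonneg x); last by rewrite /rate0 asboolF// leey.
by rewrite rate0_nonneg//; apply: tsum_ge0 => k; exact: entropy_ge0.
Qed.

Definition dual_pairing (l : nat -> R) K x : R :=
  \sum_(0 <= k < K) (l k * x k - q k * (expR (l k) - 1)).

Lemma dual_pairing_le_rate0 l K x : ((dual_pairing l K x)%:E <= I x)%E.
Proof.
have [x0|nx0] := pselect (l1_nonneg x); last by rewrite /rate0 asboolF// leey.
have e0 k : 0 <= entropy (q k) (x k) by exact: entropy_ge0.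
rewrite rate0_nonneg//; apply: le_trans (psum_le_tsum K e0).
by rewrite lee_fin; apply: ler_sum_nat => k _; exact: entropy_ge_affine.
Qed.

Lemma rate0_dual (c : R) x : (c%:E < I x)%E -> exists l K, c < dual_pairing l K x.
Proof.
move=> cI; have [x0|/existsNP[k0 /negP]] := pselect (l1_nonneg x); last first.
  rewrite -ltNge => xk0; pose L := (`|c| + 1) / - x k0.
  have L0 : 0 < L by rewrite divr_gt0 ?oppr_gt0// ltr_wpDl.
  exists (fun k => if k == k0 then - L else 0), k0.+1.
  rewrite /dual_pairing big_nat_recr//= eqxx big_nat_cond big1 ?add0r.
    have -> : - L * x k0 = `|c| + 1 by rewrite /L; field; rewrite lt_eqF.
    have : expR (- L) <= 1 by rewrite expR_le1 oppr_le0 ltW.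
    move=> hL; have := mulr_ge0 (ql0 k0) (_ : 0 <= 1 - expR (- L)).
    rewrite subr_ge0 => /(_ hL); have := ler_norm c; lra.
  move=> k /andP[/andP[_ kk0] _]; rewrite ltn_eqF//.
  by rewrite mul0r expR0 subrr mulr0 subr0.
have e0 k : 0 <= entropy (q k) (x k) by exact: entropy_ge0.
rewrite rate0_nonneg// in cI.
have [K hK] : exists K, c < \sum_(0 <= k < K) entropy (q k) (x k).
  have [Ioo|Ioo] := pselect (\sum_(0 <= k <oo) (entropy (q k) (x k))%:E < +oo)%E; last first.
    exact: tsum_infty.
  apply/not_existsP => h; move: cI; apply/negP; rewrite -leNgt.
  by apply: tsum_le => // n; rewrite lee_fin leNgt; apply/negP; exact: h.
pose e := (\sum_(0 <= k < K) entropy (q k) (x k) - c) / (2 * K.+1%:R).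
have e1 : 0 < e by rewrite divr_gt0 ?subr_gt0// mulr_gt0// ltr0n.
exists (fun k => dual_point e (q k) (x k)), K.
apply: (@lt_le_trans _ _ (\sum_(0 <= k < K) (entropy (q k) (x k) - e))); last first.
  by apply: ler_sum_nat => k _; exact: entropy_dual.
rewrite sumrB sumr_const_nat subn0 -mulr_natr.
set S := \sum_(0 <= k < K) _ in e e1 hK *.
have : e * K%:R < e * K.+1%:R by rewrite ltr_pM2l// ltr_nat.
have -> : e * K.+1%:R = (S - c) / 2 by rewrite /e; field; rewrite ?natr1 ?(addrC 1) ?natr1 pnatr_eq0.
lra.
Qed.

Lemma dual_pairing_continuous l K x :
  (fun y : l1 R => dual_pairing l K y) @ nbhs x --> dual_pairing l K x.
Proof.
rewrite /dual_pairing; elim: K => [|K IH].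
  under eq_fun do rewrite big_geq//; rewrite big_geq//; exact: cvg_cst.
under eq_fun do rewrite big_nat_recr//=; rewrite big_nat_recr//=.
apply: cvgD => //; apply: cvgB; last exact: cvg_cst.
apply: cvgM; [exact: cvg_cst|exact: l1_coord_continuous].
Qed.

Lemma rate0_lsc : lower_semicontinuous I.
Proof.
move=> x c /rate0_dual[l [K h]]; exists [set y | c < dual_pairing l K y]; last first.
  move=> y hy; apply: lt_le_trans (dual_pairing_le_rate0 l K y).
  by rewrite lte_fin.
have e0 : 0 < dual_pairing l K x - c by rewrite subr_gt0.
have /(@cvgrPdist_lt _ _ _ (nbhs x) (nbhs_filter x))/(_ _ e0) :=
  @dual_pairing_continuous l K x.
apply: (@filterS _ (nbhs x) (nbhs_filter x)) => y /=.
by rewrite ltr_distlC => /andP[]; lra.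
Qed.

End free_rate_function.

Section entropy_of_recovery.
Context {R : realType} {d : nat} {beta : R}.
Hypotheses (d0 : (0 < d)%N) (beta0 : 0 < beta).
Implicit Types x : l1 R.

Local Notation q k := (q_free d beta 0 k.+1).
Local Notation I := (rate0 d beta).
Local Notation qt := (@qtot R d beta).

Let q0 k : 0 < q k. Proof. exact: q_free0_gt0. Qed.
Let ql0 k : 0 <= q k. Proof. exact/ltW. Qed.

Lemma ln_le_sqrt n : ln n.+1%:R <= 2 * Num.sqrt n.+1%:R :> R.
Proof.
have s0 : 0 < Num.sqrt n.+1%:R :> R by rewrite sqrtr_gt0 ltr0n.
rewrite -[X in ln X]sqr_sqrtr ?ler0n// lnXn// -[leLHS]mulr_natl ler_wpM2l//.
have := @le_ln1Dx R (Num.sqrt n.+1%:R - 1).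
rewrite addrCA subrr addr0 => h; apply: le_trans (h _) _; last by lra.
by rewrite ltrBrDr addrC subrr.
Qed.

Lemma entropy_spread_cvg0 (t e : R) : 0 <= t -> 0 < e ->
  \forall K \near \oo, entropy (q K) (t / K.+1%:R) <= q K + e.
Proof.
rewrite le_eqVlt => /predU1P[<- e0|t0 e0].
  by apply: nearW => K; rewrite /entropy !mul0r add0r lerDl ltW.
pose C : R := (4 * pi * beta) `^ (d%:R / 2).
have C0 : 0 < C by rewrite powR_gt0// !mulr_gt0// pi_gt0.
pose A : R := `|ln t + ln C - 1| + d%:R.
have A0 : 0 < A by rewrite ltr_wpDl// ltr0n.
near=> K; rewrite /entropy addrC lerD2l.
have k0 : 0 < K.+1%:R :> R by rewrite ltr0n.
set s : R := Num.sqrt K.+1%:R.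
have s0 : 0 < s by rewrite sqrtr_gt0.
have ss : K.+1%:R = s ^+ 2 by rewrite sqr_sqrtr// ltW.
have s1 : 1 <= s by rewrite -sqrtr1 ler_sqrt// ler1n.
have sbig : t * A / e <= s.
  rewrite -[leLHS]ger0_norm; last by rewrite divr_ge0 ?mulr_ge0// ltW.
  rewrite -sqrtr_sqr ler_wsqrtr//.
  near: K; exists (Num.truncn ((t * A / e) ^+ 2)) => // K /= hK.
  by apply: (le_trans (ltW (truncnS_gt _))); rewrite ler_nat ltnS.
have -> : ln (t / K.+1%:R / q K) = ln t + ln C + d%:R / 2 * ln K.+1%:R.
  have lnMM (u v : R) : 0 < u -> 0 < v -> ln (u * v) = ln u + ln v.
    by move=> u0 v0; rewrite lnM.
  have p0 : 0 < K.+1%:R `^ (1 + d%:R / 2) :> R by rewrite powR_gt0.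
  rewrite q_free0E -/C invrK (lnMM (t / K.+1%:R)) ?divr_gt0 ?mulr_gt0//.
  by rewrite (lnMM C)// ln_div ?posrE// ln_powR; ring.
have h : ln t + ln C + d%:R / 2 * ln K.+1%:R - 1 <= A * s.
  have := ln_le_sqrt K; rewrite -/s => h1.
  have h2 : d%:R / 2 * ln K.+1%:R <= d%:R / 2 * (2 * s) by rewrite ler_wpM2l// divr_ge0.
  have h3 := ler_norm (ln t + ln C - 1).
  have h4 : `|ln t + ln C - 1| <= `|ln t + ln C - 1| * s by rewrite ler_peMr.
  rewrite /A mulrDl; lra.
apply: (@le_trans _ _ (t / K.+1%:R * (A * s))).
  by rewrite ler_wpM2l// divr_ge0// ltW.
have -> : t / K.+1%:R * (A * s) = t * A / s by rewrite ss; field; rewrite gt_eqF.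
by rewrite ler_pdivrMr// [leRHS]mulrC -ler_pdivrMr.
Unshelve. all: by end_near. Qed.

Lemma rate0_recovery_le a b (m e : R) x : b < a -> l1_nonneg x -> 0 < e ->
  \forall K \near \oo, (I (recovery a b m x K) <= I x + e%:E)%E.
Proof.
move=> ab x0 e0; set t := Num.max (m - a * fine (density x)) 0 / (a - b).
have t0 : 0 <= t by rewrite divr_ge0 ?le_max ?lexx ?orbT// ltW// subr_gt0.
have e2 : 0 < e / 2 by rewrite divr_gt0.
have [q1 ql1] := (q_free0_summable d0 beta0, ql0).
have ct := @psum_cvg _ (fun k => q k) ql1 q1.
near=> K.
have hK : entropy (q K) (t / K.+1%:R) <= q K + e / 2.
  by near: K; exact: entropy_spread_cvg0.
have tl : qt - \sum_(0 <= k < K) q k <= e / 2.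
  apply: le_trans (ler_norm _) _.
  by near: K; move/cvgrPdist_le : ct => /(_ _ e2); apply: filterS.
have y0 := @recovery_nonneg R a b ab m x K x0.
have ey k : 0 <= entropy (q k) (recovery a b m x K k) by exact: entropy_ge0.
have ex k : 0 <= entropy (q k) (x k) by exact: entropy_ge0.
rewrite rate0_nonneg//; apply: tsum_le => // n'.
have nn := leq_addl K.+1 n'; set n := (K.+1 + n')%N in nn.
apply: le_trans (_ : (\sum_(0 <= k < n) entropy (q k) (recovery a b m x K k))%:E <= _)%E.
  by rewrite lee_fin; exact: psum_le.
have Kn : (K.+1 <= n)%N by exact: leq_addr.
rewrite (big_cat_nat (leq0n K.+1) Kn)//= big_nat_recr//=.
have -> : \sum_(0 <= k < K) entropy (q k) (recovery_seq a b m x K k) =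
    \sum_(0 <= k < K) entropy (q k) (x k).
  by apply: eq_big_nat => k /andP[_ kK]; rewrite /recovery_seq kK.
have -> : \sum_(K.+1 <= k < n) entropy (q k) (recovery_seq a b m x K k) =
    \sum_(K.+1 <= k < n) q k.
  apply: eq_big_nat => k /andP[kK _]; rewrite /recovery_seq ltnNge (ltnW kK)/= gtn_eqF//.
  by rewrite /entropy !mul0r add0r.
have -> : recovery_seq a b m x K K = t / K.+1%:R by rewrite /recovery_seq ltnn eqxx.
have hn : \sum_(0 <= k < n) q k <= qt by exact: psum_le_fine.
rewrite (big_cat_nat (leq0n K.+1) Kn)//= big_nat_recr//= in hn.
apply: (@le_trans _ _ ((\sum_(0 <= k < K) entropy (q k) (x k))%:E + e%:E)%E).
  rewrite -EFinD lee_fin; lra.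
by rewrite leeD2r//; rewrite (rate0_nonneg d0 beta0 x0); exact: psum_le_tsum.
Unshelve. all: by end_near. Qed.

End entropy_of_recovery.

(** * Independent Poisson counts *)

Section poisson_weights.
Context {R : realType}.
Implicit Types r c : R.

Definition poisson_weight r (n : nat) : R := r ^+ n / n`!%:R * expR (- r).

Lemma poisson_weight_ge0 r n : 0 <= r -> 0 <= poisson_weight r n.
Proof. by move=> r0; rewrite mulr_ge0 ?expR_ge0// divr_ge0// exprn_ge0. Qed.

Lemma poisson_prob_set1 r n : 0 <= r -> poisson_prob r 0 [set n] = (poisson_weight r n)%:E.
Proof.
rewrite le_eqVlt => /predU1P[<-|r0]; rewrite /poisson_prob /poisson_weight.
  rewrite ltxx oppr0 expR0 mulr1 diracE.
  case: n => [|n]; first by rewrite mem_set//= expr0 fact0 divr1.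
  by rewrite memNset ?expr0n ?mul0r.
rewrite r0 esum_set1/= /poisson_pmf ?r0// lee_fin.
by rewrite mulr_ge0 ?expR_ge0// divr_ge0// exprn_ge0// ltW.
Qed.

Lemma expR_tsum (u : R) : 0 <= u -> (\sum_(0 <= n <oo) (u ^+ n / n`!%:R)%:E)%E = (expR u)%:E.
Proof.
move=> u0; have v0 n : 0 <= u ^+ n / n`!%:R by rewrite divr_ge0// exprn_ge0.
have h : series (exp_coeff u) @ \oo --> expR u by exact: is_cvg_series_exp_coeff.
have h2 : (fun n => (\sum_(0 <= k < n) u ^+ k / k`!%:R)%:E) @ \oo --> (expR u)%:E.
  by apply: cvg_EFin; [exact: nearW|exact: h].
exact: (cvg_unique _ (cvg_tsum v0) h2).
Qed.

Lemma poisson_mgf r c : 0 <= r ->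
  (\sum_(0 <= n <oo) (expR (c * n%:R) * poisson_weight r n)%:E)%E =
  (expR (r * (expR c - 1)))%:E.
Proof.
move=> r0; have u0 : 0 <= expR c * r by rewrite mulr_ge0 ?expR_ge0.
rewrite (eq_eseriesr (g := fun n => ((expR (- r))%:E * ((expR c * r) ^+ n / n`!%:R)%:E)%E)).
  rewrite nneseriesZl => [|n _]; last by rewrite lee_fin divr_ge0// exprn_ge0.
  by rewrite expR_tsum// -EFinM -expRD; congr (expR _)%:E; ring.
move=> n _; rewrite -EFinM; congr EFin.
rewrite /poisson_weight exprMn mulrC -expRM_natr; ring.
Qed.

End poisson_weights.

Section independent_poisson.
Context {R : realType} {dO : measure_display} {Omega : measurableType dO}.
Context (P : probability Omega R) (Nk : nat -> {RV P >-> nat}) (r : nat -> R).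
Hypothesis ind : mutually_independent P (fun k => Nk k : Omega -> nat).
Hypothesis law : forall k A, distribution P (Nk k) A = poisson_prob (r k) 0 A.
Hypothesis r0 : forall k, 0 <= r k.
Local Open Scope ereal_scope.

Lemma poisson_event k n : P (Nk k @^-1` [set n]) = (poisson_weight (r k) n)%:E.
Proof. by rewrite -[LHS]/(distribution P (Nk k) [set n]) law poisson_prob_set1. Qed.

Let mN k A : measurable (Nk k @^-1` A).
Proof. by rewrite -[X in measurable X]setTI; exact: measurable_funP. Qed.

Let mfN (f : nat -> R) k : measurable_fun setT (fun w => f (Nk k w)).
Proof. by move=> _ A mA; rewrite setTI; exact: (mN k (f @^-1` A)). Qed.

Lemma integral_prod_independent (f : nat -> nat -> R) (e : nat -> R) n (J : seq nat) (A : nat -> set nat) :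
  (forall k m, 0 <= f k m)%R ->
  (forall k, \sum_(0 <= m <oo) (f k m * poisson_weight (r k) m)%:E = (e k)%:E) ->
  uniq J -> (forall j, j \in J -> (n <= j)%N) ->
  \int[P]_(w in \bigcap_(j in [set` J]) (Nk j @^-1` A j)) (\prod_(k < n) f k (Nk k w))%:E =
  P (\bigcap_(j in [set` J]) (Nk j @^-1` A j)) *
  (\prod_(k < n) e k)%:E.
Proof.
move=> f0 fe; elim: n J A => [|n IH] J A uJ nJ.
  under eq_integral do rewrite big_ord0.
  rewrite big_ord0 mule1 integral_cst ?mul1e//.
  by apply: fin_bigcap_measurable => //; exact: finite_set_seq.
set B := \bigcap_(j in _) _.
have mB : measurable B by apply: fin_bigcap_measurable => //; exact: finite_set_seq.
have nnJ : n \notin J by apply/negP => /nJ; rewrite ltnn.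
pose A' m j := if j == n then [set m] else A j.
have BE m : B `&` Nk n @^-1` [set m] = \bigcap_(j in [set` n :: J]) (Nk j @^-1` A' m j).
  apply/seteqP; split => w.
    move=> [Bw nw] j /=; rewrite inE /A' => /predU1P[->|jJ]; first by rewrite eqxx.
    by case: eqP => [jn|_]; [rewrite -jn jJ in nnJ|exact: Bw].
  move=> h; split; last by have := h n; rewrite /= mem_head /A' eqxx; exact.
  move=> j jJ; have := h j; rewrite /= inE jJ orbT => /(_ isT).
  by rewrite /A'; case: eqP => // jn; rewrite -jn jJ in nnJ.
have -> : B = \bigcup_m (B `&` Nk n @^-1` [set m]).
  by apply/seteqP; split => [w Bw|w [m _ []]//]; exists (Nk n w).
have BU : B = \bigcup_m (B `&` Nk n @^-1` [set m]).
  by apply/seteqP; split => [w Bw|w [m _ []]//]; exists (Nk n w).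
have prod0 w i : (0 <= \prod_(k < i) f k (Nk k w))%R by apply: prodr_ge0.
have mprod i : measurable_fun setT (fun w => (\prod_(k < i) f k (Nk k w))%:E).
  apply/measurable_EFinP; elim: i => [|i IHi].
    by under eq_fun do rewrite big_ord0; exact: measurable_cst.
  by under eq_fun do rewrite big_ord_recr/=; apply: measurable_funM.
rewrite ge0_integral_bigcup//=; last 4 first.
- by move=> m; exact: measurableI.
- exact: measurable_funTS (mprod _).
- by move=> w _; rewrite lee_fin prod0.
- apply/trivIsetP => i j _ _ ij; apply/seteqP; split => // w [[_ wi] [_ wj]].
  by move: ij; rewrite -wi -wj eqxx.
rewrite -BU big_ord_recr/= EFinM -fe.
have PBfin : P B \is a fin_num by exact: fin_num_measure.
rewrite muleA -(fineK PBfin) -EFinM -nneseriesZl => [|m _]; last first.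
  by rewrite lee_fin mulr_ge0// poisson_weight_ge0.
rewrite EFinM fineK//.
apply: eq_eseriesr => m _.
transitivity (\int[P]_(w in B `&` Nk n @^-1` [set m]) ((f n m)%:E * (\prod_(k < n) f k (Nk k w))%:E)).
  apply: eq_integral => w; rewrite inE => -[_ <-].
  by rewrite big_ord_recr/= mulrC EFinM.
rewrite ge0_integralZl ?lee_fin//; last 3 first.
- exact: measurableI.
- exact: measurable_funTS (mprod _).
- by move=> w _; rewrite lee_fin prod0.
rewrite BE IH; last 2 first.
- by rewrite /= nnJ.
- by move=> j; rewrite inE => /predU1P[->//|/nJ /ltnW].
have mA' j : measurable (A' m j) by [].
have en : P (Nk n @^-1` A' m n) = (poisson_weight (r n) m)%:E.
  by rewrite /A' eqxx poisson_event.
rewrite ind//=; last by rewrite nnJ.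
rewrite big_cons en.
have -> : \prod_(j <- J) P (Nk j @^-1` A' m j) = P B.
  rewrite /B ind//; apply: eq_big_seq => j jJ; rewrite /A'.
  by case: eqP => // jn; rewrite -jn jJ in nnJ.
rewrite -(fineK PBfin) -!EFinM; congr EFin; ring.
Qed.

Lemma poisson_joint_mgf (c : nat -> R) n :
  \int[P]_w (expR (\sum_(0 <= k < n) c k * (Nk k w)%:R))%:E =
  (expR (\sum_(0 <= k < n) r k * (expR (c k) - 1)))%:E.
Proof.
have := @integral_prod_independent (fun k m => expR (c k * m%:R))
  (fun k => expR (r k * (expR (c k) - 1))) n [::] (fun=> setT).
rewrite (_ : \bigcap_(j in [set` [::]]) _ = setT); last by apply/seteqP; split.
rewrite probability_setT mul1e => h.
rewrite [in RHS]big_mkord [in RHS]expR_sum -h//.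
- by apply: eq_integral => w _; rewrite big_mkord expR_sum.
- by move=> k; exact: poisson_mgf.
Qed.

Lemma poisson_config_ge (m : nat -> nat) K (T : R) :
  (forall k, (K <= k)%N -> m k = 0%N) -> (forall n, \sum_(K <= k < n) r k <= T)%R ->
  measurable [set w | forall k, Nk k w = m k] /\
  (\prod_(0 <= k < K) poisson_weight (r k) (m k) * expR (- T))%:E <=
    P [set w | forall k, Nk k w = m k].
Proof.
move=> mK rT; pose E n := \bigcap_(j in [set` iota 0 n]) (Nk j @^-1` [set m j]).
have mE n : measurable (E n) by apply: fin_bigcap_measurable => //; exact: finite_set_seq.
have -> : [set w | forall k, Nk k w = m k] = \bigcap_n E n.
  apply/seteqP; split => w h; first by move=> n _ j _; exact: h.
  by move=> k; apply: (h k.+1 I k); have : k \in iota 0 k.+1 by rewrite mem_iota add0n ltnSn.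
split; first exact: bigcapT_measurable.
have PE n : P (E n) = (\prod_(0 <= k < n) poisson_weight (r k) (m k))%:E.
  rewrite /E ind ?iota_uniq// -prodEFin /index_iota subn0.
  by apply: eq_bigr => k _; exact: poisson_event.
have ndE : {homo E : i j / (i <= j)%N >-> (j <= i)%O}.
  move=> i j ij; apply/subsetPset => w h k /=; rewrite mem_iota add0n => /andP[_ ki].
  by apply: h; rewrite /= mem_iota add0n (leq_trans ki).
have cv : P \o E @ \oo --> P (\bigcap_n E n).
  apply: nonincreasing_cvg_mu => //; first by rewrite ltey_eq fin_num_measure.
  exact: bigcapT_measurable.
apply: cvge_to_ge cv _; near=> n; have Kn : (K <= n)%N by near: n; exists K.
rewrite /= PE lee_fin (big_cat_nat (leq0n K) Kn)/= ler_wpM2l//.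
  by apply: prodr_ge0 => k _; exact: poisson_weight_ge0.
rewrite (eq_big_nat _ _ (F2 := fun k => expR (- r k))); last first.
  by move=> k /andP[Kk _]; rewrite mK// /poisson_weight expr0 fact0 divr1 mul1r.
by rewrite -expR_sum ler_expR sumrN lerN2.
Unshelve. all: by end_near. Qed.

Lemma integral_le_eventually (f : Omega -> \bar R) (G : nat -> Omega -> R) (B : R) :
  measurable_fun setT f -> (forall w, 0 <= f w) ->
  (forall n, measurable_fun setT (G n)) -> (forall n w, (0 <= G n w)%R) ->
  (forall n, \int[P]_w (G n w)%:E <= B%:E) ->
  {ae P, forall w, exists M, forall n, (M <= n)%N -> f w <= (G n w)%:E} ->
  \int[P]_w f w <= B%:E.
Proof.
move=> mf f0 mG G0 GB fG.
have mG' n : measurable_fun setT (fun w => (G n w)%:E) by apply/measurable_EFinP.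
have fat := @fatou _ _ _ P setT measurableT (fun n w => (G n w)%:E) mG' _.
apply: (@le_trans _ _ (\int[P]_w limn_einf (fun n => (G n w)%:E))).
  apply: ae_ge0_le_integral => //.
  - move=> w _; rewrite limn_einf_lim; apply: lime_ge; first exact: is_cvg_einfs.
    apply: nearW => n; apply: le_ereal_inf_tmp => _ [k _ <-].
    by rewrite lee_fin.
  - rewrite /limn_einf; apply: measurableT_comp; first exact: oppe_measurable.
    apply: measurable_fun_limn_esup => n.
    by apply: measurableT_comp => //; exact: oppe_measurable.
  - apply: filterS fG => w [M hM] _; rewrite limn_einf_lim.
    apply: lime_ge; first exact: is_cvg_einfs.
    near=> n; apply: le_ereal_inf_tmp => _ [k /= nk <-]; apply: hM.
    by apply: leq_trans nk; near: n; exists M.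
apply: le_trans (fat _) _ => [n w _|]; first by rewrite lee_fin.
rewrite limn_einf_lim; apply: lime_le; first exact: is_cvg_einfs.
apply: nearW => n; apply: le_trans (GB n); apply: ereal_inf_lbound.
by exists n => //=.
Unshelve. all: by end_near. Qed.

End independent_poisson.

Section poisson_asymptotics.
Context {R : realType}.

Lemma ln_fact_le n : n`!%:R <= expR (n.+1%:R * ln n.+1%:R - n%:R) :> R.
Proof.
elim: n => [|n IH]; first by rewrite fact0 mul1r ln1 subrr expR0.
rewrite factS natrM; apply: le_trans (ler_wpM2l (ler0n _ _) IH) _.
have n10 : 0 < n.+1%:R :> R by rewrite ltr0n.
rewrite -[X in X * _](@lnK R) ?posrE// -expRD ler_expR.
have n20 : 0 < n.+2%:R :> R by rewrite ltr0n.
have h : ln (n.+1%:R / n.+2%:R) <= - (n.+2%:R)^-1 :> R.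
  have := @le_ln1Dx R (- (n.+2%:R)^-1).
  have -> : 1 + - n.+2%:R^-1 = n.+1%:R / n.+2%:R :> R.
    have -> : n.+1%:R = n.+2%:R - 1 :> R by rewrite -[in RHS]natr1 addrK.
    by rewrite mulrBl mulfV ?gt_eqF// mul1r.
  apply; rewrite ltrN2 invf_lt1// ltr1n//.
have {}h : n.+2%:R * (ln n.+1%:R - ln n.+2%:R) <= -1 :> R.
  rewrite -ln_div ?posrE//; apply: le_trans (ler_wpM2l (ltW n20) h) _.
  by rewrite mulrN mulfV ?gt_eqF.
have e2 : n.+2%:R = n.+1%:R + 1 :> R by rewrite natr1.
have e1 : n.+1%:R = n%:R + 1 :> R by rewrite natr1.
move: h; rewrite mulrBr [X in X * ln n.+1%:R - _]e2; move: (ln _) (n.+2%:R * _) => x z; lra.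
Qed.

Lemma poisson_weight_lower_ln (V r : R) n : 0 < V -> 0 < r ->
  expR (V * (n%:R / V * ln r + n%:R / V - r - n%:R / V * ln (n.+1%:R / V)
    - 2 * Num.sqrt (n.+1%:R / V) * Num.sqrt V^-1)) <= poisson_weight (V * r) n.
Proof.
move=> V0 r0; have Vr0 : 0 < V * r by exact: mulr_gt0.
have n10 : 0 < n.+1%:R :> R by rewrite ltr0n.
apply: (@le_trans _ _ (expR (n%:R * ln (V * r) - (n.+1%:R * ln n.+1%:R - n%:R) - V * r))).
  rewrite ler_expR lnM ?posrE// ln_div ?posrE//.
  have -> : V * (n%:R / V * ln r + n%:R / V - r - n%:R / V * (ln n.+1%:R - ln V)
      - 2 * Num.sqrt (n.+1%:R / V) * Num.sqrt V^-1) =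
      n%:R * ln r + n%:R - V * r - n%:R * (ln n.+1%:R - ln V)
      - V * (2 * Num.sqrt (n.+1%:R / V) * Num.sqrt V^-1) by field; rewrite gt_eqF.
  have -> : V * (2 * Num.sqrt (n.+1%:R / V) * Num.sqrt V^-1) = 2 * Num.sqrt n.+1%:R.
    rewrite sqrtrM ?ler0n//.
    have : Num.sqrt V^-1 * Num.sqrt V^-1 = V^-1 by rewrite -expr2 sqr_sqrtr// invr_ge0 ltW.
    move=> h; transitivity (2 * Num.sqrt n.+1%:R * (V * (Num.sqrt V^-1 * Num.sqrt V^-1))); first ring.
    by rewrite h mulfV ?gt_eqF// mulr1.
  have := @ln_le_sqrt R n; move: (ln _) (Num.sqrt _) (ln V) (ln r) => L s lV lr h.
  rewrite -natr1 mulrDl mul1r; lra.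
rewrite /poisson_weight expRD ler_wpM2r ?expR_ge0// expRD expRM_natl lnK ?posrE//.
rewrite ler_wpM2l ?exprn_ge0 ?(ltW Vr0)// expRN lef_pV2 ?posrE ?expR_gt0//.
  exact: ln_fact_le.
Qed.

Lemma poisson_weight_lower (V r : nat -> R) (p y e : R) :
  V @ \oo --> +oo -> r @ \oo --> p -> 0 < p -> 0 <= y -> 0 < e ->
  \forall N \near \oo, expR (- V N * (entropy p y + e)) <=
    poisson_weight (V N * r N) (Num.truncn (V N * y)).
Proof.
move=> Voo rp p0 y0 e0.
have V0 : \forall N \near \oo, 0 < V N by move/cvgryPgt : Voo; exact.
have r0 : \forall N \near \oo, 0 < r N by exact: (cvgr_gt _ rp).
have Vi : (fun N => (V N)^-1) @ \oo --> (0 : R).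
  by apply/gtr0_cvgV0.
move: y0; rewrite le_eqVlt => /predU1P[<-|y0].
  have : \forall N \near \oo, r N <= p + e by apply: (cvgr_le _ rp); rewrite ltrDl.
  apply: filterS2 V0 => N VN rN.
  rewrite mulr0 truncn0 /poisson_weight expr0 fact0 divr1 mul1r ler_expR mulNr lerN2.
  by rewrite ler_pM2l// /entropy mul0r add0r.
pose n N := Num.truncn (V N * y).
have sV : (fun N => (n N).+1%:R / V N) @ \oo --> y.
  apply: (@squeeze_cvgr _ _ _ _ (fun=> y) (fun N => y + (V N)^-1)).
  - apply: filterS V0 => N VN; apply/andP; split.
      by rewrite ler_pdivlMr// mulrC ltW// truncnS_gt.
    rewrite ler_pdivrMr// mulrDl mulVf ?gt_eqF// -natr1 lerD2r mulrC.
    by rewrite truncn_le// mulr_ge0// ltW.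
  - exact: cvg_cst.
  - by rewrite -[X in _ --> X]addr0; apply: cvgD => //; exact: cvg_cst.
have tV : (fun N => (n N)%:R / V N) @ \oo --> y.
  have -> : (fun N => (n N)%:R / V N) = (fun N => (n N).+1%:R / V N - (V N)^-1).
    by apply/funext => N; rewrite -natr1 mulrDl mul1r addrK.
  by rewrite -[X in _ --> X]subr0; exact: cvgB.
have sq (u : nat -> R) (l : R) : u @ \oo --> l -> (fun N => Num.sqrt (u N)) @ \oo --> Num.sqrt l.
  by move=> ul; apply: (continuous_cvg _ _ ul); exact: sqrt_continuous.
have ln_ (u : nat -> R) (l : R) : 0 < l -> u @ \oo --> l -> (fun N => ln (u N)) @ \oo --> ln l.
  by move=> l0 ul; apply: (continuous_cvg _ _ ul); exact: continuous_ln.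
have : (fun N => (n N)%:R / V N * ln (r N) + (n N)%:R / V N - r N
    - (n N)%:R / V N * ln ((n N).+1%:R / V N)
    - 2 * Num.sqrt ((n N).+1%:R / V N) * Num.sqrt (V N)^-1) @ \oo -->
    y * ln p + y - p - y * ln y - 2 * Num.sqrt y * Num.sqrt 0.
  apply: cvgB; last by apply: cvgM; [apply: cvgM; [exact: cvg_cst|exact: sq]|exact: sq].
  apply: cvgB; last by apply: cvgM => //; exact: ln_.
  by apply: cvgB => //; apply: cvgD => //; apply: cvgM => //; exact: ln_.
have -> : y * ln p + y - p - y * ln y - 2 * Num.sqrt y * Num.sqrt 0 = - entropy p y.
  by rewrite sqrtr0 /entropy ln_div ?posrE//; ring.
move=> /cvgr_ge/(_ (- (entropy p y + e))); rewrite opprD gtrDl oppr_lt0 => /(_ e0).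
apply: filterS3 V0 r0 => N VN rN h; apply: le_trans (poisson_weight_lower_ln _ VN rN).
by rewrite ler_expR mulNr -mulrN ler_pM2l// opprD.
Qed.

End poisson_asymptotics.

Section borel_l1_measurability.
Context {R : realType}.
Local Notation X := (borel_l1 R).

Lemma open_borel_l1 (A : set (l1 R)) : open A -> measurable (A : set X).
Proof. by move=> oA; exact: sub_sigma_algebra. Qed.

Lemma closed_borel_l1 (A : set (l1 R)) : closed A -> measurable (A : set X).
Proof.
by move=> cA; rewrite -(setCK A); apply: measurableC; apply: open_borel_l1; exact: closed_openC.
Qed.

Lemma measurable_l1_coord k : measurable_fun setT ((fun x => (x : l1 R) k) : X -> R).
Proof.
apply: (measurability _ (RGenOInfty.measurableE R)) => //.
move=> /= _ [_ [a ->] <-]; rewrite setTI; apply: open_borel_l1.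
have /continuousP := @l1_coord_continuous R k; apply.
exact: interval_open.
Qed.

Lemma measurable_trunc_sum (c : nat -> R) n K : measurable_fun setT
  ((fun x => \sum_(0 <= k < K) c k * ((x : l1 R) k) ^+ n) : X -> R).
Proof.
elim: K => [|K IH]; first by under eq_fun do rewrite big_geq//; exact: measurable_cst.
under eq_fun do rewrite big_nat_recr//=.
apply: measurable_funD => //; apply: measurable_funM; first exact: measurable_cst.
by apply: measurable_funX; exact: measurable_l1_coord.
Qed.

Lemma measurable_dens_trunc K : measurable_fun setT ((fun x => dens_trunc K (x : l1 R)) : X -> R).
Proof.
have := measurable_trunc_sum (fun k => k.+1%:R) 1 K; congr (measurable_fun _ _).
Qed.

Lemma measurable_l1_nonneg : measurable ([set x | l1_nonneg x] : set X).
Proof.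
have -> : [set x : X | l1_nonneg x] = \bigcap_k ((fun x : X => (x : l1 R) k) @^-1` `[0, +oo[%classic).
  apply/seteqP; split => x h k; first by move=> _ /=; rewrite in_itv/= andbT.
  by have := h k I; rewrite /= in_itv/= andbT.
apply: bigcapT_measurable => k; rewrite -[Y in measurable Y]setTI.
exact: measurable_l1_coord.
Qed.

Lemma measurable_finite_density : measurable (@finite_density R : set X).
Proof.
have -> : @finite_density R = [set x : X | l1_nonneg x] `&`
    \bigcup_M \bigcap_K ((fun x : X => dens_trunc K x) @^-1` `]-oo, M%:R]%classic).
  apply/seteqP; split => x [x0 h]; split => //.
    exists (Num.truncn (fine (density x))).+1 => // K _; rewrite /= in_itv/=.
    apply: (@le_trans _ _ (fine (density x))); last exact/ltW/truncnS_gt.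
    by apply: psum_le_fine => // k; rewrite mulr_ge0.
  case: h => M _ h; apply: (@le_lt_trans _ _ (M%:R)%:E); last exact: ltry.
  apply: tsum_le => [k|n]; first by rewrite mulr_ge0.
  by have := h n I; rewrite /= in_itv/= lee_fin.
apply: measurableI; first exact: measurable_l1_nonneg.
apply: bigcup_measurable => M _; apply: bigcapT_measurable => K.
rewrite -[Y in measurable Y]setTI; exact: measurable_dens_trunc.
Qed.

Definition energy (a b m D S : R) : R := - m * D + a / 2 * D ^+ 2 - b / 2 * S.

Lemma energy_cvg {T : Type} (F : set_system T) {FF : Filter F} (a b m : R) (f g : T -> R) (D S : R) :
  f @ F --> D -> g @ F --> S ->
  (fun t => energy a b m (f t) (g t)) @ F --> energy a b m D S.
Proof.
move=> fD gS; have cM (h : T -> R) (c l : R) : h @ F --> l -> (fun t => c * h t) @ F --> c * l.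
  by move=> hl; apply: cvgM => //; exact: cvg_cst.
apply: cvgB; last exact: cM.
apply: cvgD; first exact: cM.
by apply: cM; under eq_fun do rewrite expr2; rewrite expr2; exact: cvgM.
Qed.

Variables (d : nat) (beta a b mu : R) (N : nat).

Lemma boltzmannE (x : l1 R) : boltzmann d beta a b mu N x =
  if `[< finite_density x >] then
    (expR (- (beta * vol d N * energy a b mu (fine (density x)) (fine (sq_density x)))))%:E
  else expeR (- ((beta * vol d N)%:E * +oo)).
Proof. by rewrite /boltzmann /H_HYL; case: asboolP. Qed.

Lemma boltzmann_ge0 x : (0 <= boltzmann d beta a b mu N x)%E.
Proof. exact: expeR_ge0. Qed.

Lemma measurable_boltzmann :
  measurable_fun setT (boltzmann d beta a b mu N : X -> \bar R).
Proof.
have -> : boltzmann d beta a b mu N = (fun x => if `[< finite_density x >] then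
    (expR (- (beta * vol d N * energy a b mu (fine (density x)) (fine (sq_density x)))))%:E
  else expeR (- ((beta * vol d N)%:E * +oo))).
  by apply/funext => x; exact: boltzmannE.
have mF := measurable_finite_density.
have preF : (fun x : X => `[< @finite_density R x >]) @^-1` [set true] = @finite_density R.
  by apply/seteqP; split => x /= /asboolP.
apply: measurable_fun_if => //.
- by apply: (measurable_fun_bool true); rewrite setTI preF.
- rewrite setTI preF; apply/measurable_EFinP; apply: measurableT_comp => //.
  apply: measurable_funN; apply: measurable_funM; first exact: measurable_cst.
  apply: (@measurable_fun_cvg _ _ _ _
    (fun K (x : X) => energy a b mu (dens_trunc K x) (sq_trunc K x))).
    move=> K; apply: (measurable_funS measurableT) => //.
    apply: measurable_funB; last first.
      apply: measurable_funM; first exact: measurable_cst.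
      exact: (@measurable_trunc_sum (fun k => k.+1%:R ^+ 2) 2 K).
    apply: measurable_funD; apply: measurable_funM; try exact: measurable_cst.
      exact: measurable_dens_trunc.
    by apply: measurable_funX; exact: measurable_dens_trunc.
  move=> x [x0 xoo]; apply: energy_cvg; [exact: density_trunc_cvg|exact: sq_trunc_cvg].
Qed.

End borel_l1_measurability.

Section gibbs_weights.
Context {R : realType}.
Variables (d : nat) (beta a b alpha mu : R).
Variables (gDir : nat -> R -> 'rV[R]_d -> 'rV[R]_d -> R) (bc : boundary_condition).
Variables (N : nat) (nu : probability (borel_l1 R) R).
Hypotheses (N0 : (0 < N)%N) (beta0 : 0 < beta).
Hypothesis nuP : reference_law beta gDir bc alpha N nu.
Local Notation V := (vol d N).
Local Notation qN k := (q_bc beta gDir bc alpha N k.+1).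
Hypothesis qN0 : forall k, 0 <= qN k.
Hypothesis V0 : 0 < V :> R.
Local Notation boltz := (boltzmann d beta a b mu N).

Definition gibbs (A : set (l1 R)) : \bar R := (\int[nu]_(x in A) boltz x)%E.

Let integral_transfer dO (Omega : measurableType dO) (P : probability Omega R)
    (X : {RV P >-> borel_l1 R}) (A : set (borel_l1 R)) (f : borel_l1 R -> \bar R) :
  (forall A, measurable A -> nu A = distribution P X A) ->
  measurable A -> measurable_fun setT f -> (forall x, (0 <= f x)%E) ->
  (\int[nu]_(x in A) f x = \int[P]_w ((f \_ A) (X w)))%E.
Proof.
move=> nuX mA mf f0.
have -> : (\int[nu]_(x in A) f x = \int[distribution P X]_(x in A) f x)%E.
  by apply: eq_measure_integral => B mB _; exact: nuX.
rewrite integral_mkcond.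
have mfA : measurable_fun setT (f \_ A).
  by apply/(measurable_restrict _ _ _) => //; apply: (measurable_funS measurableT).
rewrite ge0_integral_pushforward// => x _; exact: erestrict_ge0.
Qed.

Lemma gibbs_ge0 A : (0 <= gibbs A)%E.
Proof. by apply: integral_ge0 => x _; exact: boltzmann_ge0. Qed.

Lemma gibbs_upper (A : set (l1 R)) (c S T : R) (l : nat -> R) (K : nat) :
  measurable (A : set (borel_l1 R)) ->
  (forall x, A x -> (c%:E <= H_HYL a b (mu + alpha) x)%E) ->
  (forall x, A x -> l1_nonneg x -> exists M, forall n, (M <= n)%N ->
     S <= \sum_(0 <= k < n) l k * x k) ->
  (forall n, (K <= n)%N ->
     \sum_(0 <= k < n) qN k * (expR (l k - beta * alpha * k.+1%:R) - 1) <= T) ->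
  (gibbs A <= (expR (V * (T - beta * c - S)))%:E)%E.
Proof.
move=> mA hc hS hT; case: nuP => dO [ Omega [P [Nk [X [ind law XN nuX]]]]].
rewrite /gibbs (integral_transfer nuX mA (measurable_boltzmann _ _ _ _ _ _))//; last first.
  exact: boltzmann_ge0.
pose cc k := l k - beta * alpha * k.+1%:R.
pose r k := V * qN k.
have r0 k : 0 <= r k by rewrite mulr_ge0// ltW.
pose G n w := expR (- V * (beta * c + S)) *
  expR (\sum_(0 <= k < n + K) cc k * (Nk k w)%:R).
have mG0 n : measurable_fun setT (fun w => expR (\sum_(0 <= k < n) cc k * (Nk k w)%:R) : R).
  apply: measurableT_comp => //; elim: n => [|n IH].
    by under eq_fun do rewrite big_geq//; exact: measurable_cst.
  under eq_fun do rewrite big_nat_recr//=; apply: measurable_funD => //.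
  apply: measurable_funM; first exact: measurable_cst.
  apply: (@measurableT_comp _ _ _ _ _ _ (fun m : nat => m%:R : R)) => //.
apply: (@integral_le_eventually _ _ _ _ _ G).
- apply: measurableT_comp; last exact: measurable_funP.
  apply/(measurable_restrict _ _ _) => //; apply: (measurable_funS measurableT) => //.
  exact: measurable_boltzmann.
- by move=> w; apply: erestrict_ge0 => x _; exact: boltzmann_ge0.
- by move=> n; apply: measurable_funM; [exact: measurable_cst|exact: mG0].
- by move=> n w; rewrite mulr_ge0 ?expR_ge0.
- move=> n; rewrite /G; under eq_integral do rewrite EFinM.
  rewrite ge0_integralZl//=; last by apply/measurable_EFinP; exact: mG0.
  rewrite (poisson_joint_mgf ind law r0) -EFinM lee_fin -expRD ler_expR.
  have -> : \sum_(0 <= k < n + K) r k * (expR (cc k) - 1) =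
      V * \sum_(0 <= k < n + K) qN k * (expR (cc k) - 1).
    by rewrite mulr_sumr; apply: eq_bigr => k _; rewrite mulrA.
  have := hT (n + K)%N (leq_addl _ _); rewrite -(ler_pM2l V0) /cc; lra.
- apply: filterS XN => w Xw.
  have [M hM] : exists M, forall k, (M <= k)%N -> Nk k w = 0%N.
    have /psum_cvg h := fun k => normr_ge0 ((X w : l1 R) k).
    have {}h := h (ltac:(by have := l1valP (X w : l1 R); rewrite inE)).
    have /cvg_series_cvg_0 : cvgn (series (fun k => `|(X w : l1 R) k|)).
      by apply/cvg_ex; eexists; exact: h.
    have iV : 0 < V^-1 :> R by rewrite invr_gt0.
    move=> /cvgrPdist_lt/(_ _ iV)[M _ hM]; exists M => k Mk.
    have := hM k Mk; rewrite /= sub0r normrN normr_id Xw ger0_norm ?divr_ge0 ?(ltW V0)//.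
    by rewrite -[X in _ < X]mul1r ltr_pM2r// ltrn1 ltnS leqn0 => /eqP.
  rewrite patchE; case: ifPn => [/set_mem AX|_]; last first.
    by exists 0%N => n _; rewrite lee_fin /G mulr_ge0 ?expR_ge0.
  rewrite boltzmannE; case: asboolP => [[x0 xoo]|_]; last first.
    exists 0%N => n _; rewrite gt0_muley ?lte_fin ?mulr_gt0//= lee_fin.
    by rewrite /G mulr_ge0 ?expR_ge0.
  have [M2 hM2] := hS _ AX x0.
  exists (maxn M M2) => n; rewrite geq_max => /andP[Mn M2n].
  have Xn : forall k, (n <= k)%N -> (X w : l1 R) k = 0.
    by move=> k nk; rewrite Xw hM ?mul0r// (leq_trans Mn).
  have hD : fine (density (X w)) = \sum_(0 <= k < n + K) k.+1%:R * (X w : l1 R) k.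
    rewrite /density (@tsum_finsupp _ _ (n + K)%N)// => k nk.
    by rewrite Xn ?mulr0// (leq_trans _ nk)// leq_addr.
  have := hc _ AX; rewrite /H_HYL asboolT// lee_fin -/(energy a b (mu + alpha) _ _) => hE.
  have eE : energy a b (mu + alpha) (fine (density (X w))) (fine (sq_density (X w))) =
      energy a b mu (fine (density (X w))) (fine (sq_density (X w))) -
      alpha * fine (density (X w)) by rewrite /energy; ring.
  have {}hM2 := hM2 (n + K)%N (leq_trans M2n (leq_addr _ _)).
  rewrite lee_fin /G -expRD ler_expR.
  have -> : \sum_(0 <= k < n + K) cc k * (Nk k w)%:R =
      V * (\sum_(0 <= k < n + K) l k * (X w : l1 R) k - beta * alpha * fine (density (X w))).
    rewrite hD mulr_sumr -sumrB mulr_sumr; apply: eq_bigr => k _.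
    by rewrite /cc Xw; field; rewrite gt_eqF.
  rewrite eE in hE; move: hE hM2.
  set E := energy _ _ _ _ _; set D := fine _; set L := \sum_(_ <= _ < _) _ => hE hM2.
  have h1 : V * beta * c <= V * beta * (E - alpha * D) by rewrite ler_pM2l// mulr_gt0.
  have h2 : V * S <= V * L by rewrite ler_pM2l.
  have -> : - (beta * V * E) = - (V * beta * (E - alpha * D)) - V * beta * alpha * D by ring.
  lra.
Qed.

Lemma gibbs_lower (A : set (l1 R)) (y : l1 R) (m : nat -> nat) (K : nat) (T : R) :
  measurable (A : set (borel_l1 R)) -> A y -> (forall k, y k = (m k)%:R / V) ->
  (forall k, (K <= k)%N -> m k = 0%N) ->
  (forall n, \sum_(K <= k < n) V * qN k <= T) ->
  ((\prod_(0 <= k < K) poisson_weight (V * qN k) (m k) * expR (- T) *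
    expR (- (beta * V * energy a b mu (dens_trunc K y) (sq_trunc K y))))%:E <= gibbs A)%E.
Proof.
move=> mA Ay ym mK hT; case: nuP => dO [ Omega [P [Nk [X [ind law XN nuX]]]]].
rewrite /gibbs (integral_transfer nuX mA (measurable_boltzmann _ _ _ _ _ _))//; last first.
  exact: boltzmann_ge0.
have r0 k : 0 <= V * qN k by rewrite mulr_ge0// ltW.
have [mE PE] := poisson_config_ge ind law r0 mK hT.
set E := [set w | _] in mE PE.
set g := expR (- (beta * V * _)).
have by_ : boltz y = g%:E.
  have y0 : l1_nonneg y by move=> k; rewrite ym divr_ge0// ltW.
  have yK k : (K <= k)%N -> y k = 0 by move=> Kk; rewrite ym mK// mul0r.
  have dE : density y = (dens_trunc K y)%:E.
    by apply: tsum_finsupp => k /yK ->; rewrite mulr0.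
  have sE : sq_density y = (sq_trunc K y)%:E.
    by apply: tsum_finsupp => k /yK ->; rewrite expr0n mulr0.
  by rewrite boltzmannE asboolT ?dE ?sE//; split => //; rewrite dE ltry.
rewrite EFinM muleC; apply: (@le_trans _ _ (g%:E * P E)%E).
  by apply: lee_wpmul2l => //; rewrite lee_fin expR_ge0.
rewrite -integral_cst// integral_mkcond; apply: ae_ge0_le_integral => //.
- by move=> w _; apply: erestrict_ge0 => ? _; rewrite lee_fin expR_ge0.
- by apply/(measurable_restrict _ _ _) => //; exact: measurable_cst.
- by move=> w _; apply: erestrict_ge0 => x _; exact: boltzmann_ge0.
- apply: measurableT_comp; last exact: measurable_funP.
  apply/(measurable_restrict _ _ _) => //; apply: (measurable_funS measurableT) => //.
  exact: measurable_boltzmann.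
- apply: filterS XN => w Xw _; rewrite [X in (X <= _)%E]patchE.
  case: ifPn => [/set_mem Ew|_]; last by apply: erestrict_ge0 => x _; exact: boltzmann_ge0.
  have -> : X w = y by apply/val_inj/funext => k /=; rewrite Xw Ew ym.
  by rewrite patchE mem_set// by_.
Qed.

End gibbs_weights.

(** * Large deviation upper bound *)

Section weighted_compactness.
Context {R : realType}.
Variables (w : nat -> R) (L : R).
Hypotheses (w1 : forall k, 1 <= w k) (w_homo : forall m n, (m <= n)%N -> w m <= w n).
Hypothesis w_unbounded : forall M, exists k, M <= w k.

Definition weighted_ball : set (l1 R) :=
  [set x | l1_nonneg x /\ forall n, \sum_(0 <= k < n) w k * x k <= L].

Let w0 k : 0 < w k. Proof. exact: lt_le_trans (w1 k). Qed.

Let T := prod_topology (fun _ : nat => R).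

Let B : set T := [set f | (forall k, 0 <= f k) /\ forall n, \sum_(0 <= k < n) w k * f k <= L].

Let tail_le (f : T) j n : B f -> (j <= n)%N -> w j * \sum_(j <= k < n) f k <= L.
Proof.
move=> [f0 fL] jn; apply: le_trans (fL n); rewrite (big_cat_nat (leq0n j) jn)/=.
rewrite -[leLHS]add0r lerD ?sumr_ge0// => [k _|]; first by rewrite mulr_ge0// ltW.
rewrite mulr_sumr; apply: ler_sum_nat => k /andP[jk _].
by rewrite ler_wpM2r// w_homo.
Qed.

Let B_l1 (f : T) : B f -> (f : nat -> R) \in l1pred.
Proof.
move=> Bf; rewrite inE /l1norm /=; apply: (@le_lt_trans _ _ L%:E); last exact: ltry.
apply: (tsum_le (u := fun k => `|f k|)) => // n; rewrite lee_fin.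
have [f0 fL] := Bf; apply: le_trans (fL n); apply: ler_sum_nat => k _.
by rewrite ger0_norm// ler_peMl.
Qed.

Let phi (f : T) : l1 R := insubd (0 : l1 R) (f : nat -> R).

Let phiE (f : T) : B f -> phi f = f :> (nat -> R).
Proof. by move=> Bf; rewrite /phi insubdK//; exact: B_l1. Qed.

Let coord_continuous k : continuous (fun f : T => f k).
Proof. exact: (@proj_continuous nat (fun=> R) k). Qed.

Let compactB : compact B.
Proof.
have -> : B = [set f : T | forall k, `[0, L]%classic (f k)] `&`
    \bigcap_n [set f : T | \sum_(0 <= k < n) w k * f k <= L].
  apply/seteqP; split => f.
    move=> [f0 fL]; split; last by move=> n _; exact: fL.
    move=> k; rewrite /= in_itv/= f0/=; apply: le_trans (fL k.+1).
    rewrite big_nat_recr//= -[leLHS]add0r lerD ?sumr_ge0// => [i _|].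
      by rewrite mulr_ge0// ltW.
    by rewrite ler_peMl.
  move=> [f0 fL]; split; last by move=> n; exact: fL.
  by move=> k; have := f0 k; rewrite /= in_itv/= => /andP[].
apply: compact_closedI.
  by apply: (@tychonoff nat (fun=> R) (fun=> `[0, L]%classic)) => k; exact: segment_compact.
apply: closed_bigI => n _.
have c : continuous (fun f : T => \sum_(0 <= k < n) w k * f k).
  move=> f; suff : (fun g : T => \sum_(0 <= k < n) w k * g k) @ nbhs f -->
      \sum_(0 <= k < n) w k * f k by [].
  elim: n => [|n IH].
    rewrite (_ : (fun g : T => _) = (fun=> 0)); last by apply/funext => g; rewrite big_geq.
    by rewrite big_geq//; exact: cvg_cst.
  rewrite (_ : (fun g : T => _) = (fun g : T => \sum_(0 <= k < n) w k * g k + w n * g n)).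
    rewrite big_nat_recr//=; apply: cvgD; first exact: IH.
    by apply: cvgM; [exact: cvg_cst|exact: coord_continuous].
  by apply/funext => g; rewrite big_nat_recr.
have /continuous_closedP := c.
by move=> hc; exact: (hc [set z | z <= L] (@closed_le R L)).
Qed.

Lemma weighted_ball_compact : compact weighted_ball.
Proof.
have -> : weighted_ball = phi @` B.
  apply/seteqP; split => [x [x0 xL]|_ [f Bf <-]].
    by exists (l1val x) => //; apply/val_inj; exact: phiE.
  by have [f0 fL] := Bf; split => [k|n]; rewrite phiE.
apply: continuous_compact compactB; apply/subspace_continuousP => f Bf.
apply/cvgrPdist_le => e e0.
have [j hj] := w_unbounded (4 * L / e).
have near_f J (e1 : R) : 0 < e1 ->
    \forall g \near f, forall k, (k < J)%N -> `|f k - g k| <= e1.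
  move=> e10; elim: J => [|J IH]; first by apply: (@nearW _ (nbhs f) _ (nbhs_filter f)) => g k; rewrite ltn0.
  have /(@cvgrPdist_le _ _ _ (nbhs f) (nbhs_filter f))/(_ _ e10) h := @coord_continuous J f.
  apply: (@filterS2 _ (nbhs f) (nbhs_filter f) _ _ _ _ IH h) => g h1 h2 k.
  by rewrite ltnS leq_eqVlt => /predU1P[->|/h1].
have e1 : 0 < e / (2 * j.+1%:R) by rewrite divr_gt0// mulr_gt0// ltr0n.
apply: (@filterS _ (nbhs f) (nbhs_filter f) _ _ _ (near_f j _ e1)) => g hg Bg.
apply: l1_norm_le => n'.
have nn := leq_addl j n'; set n := (j + n')%N in nn.
apply: le_trans (psum_le (u := fun k => `|(phi f - phi g) k|) (fun=> normr_ge0 _) nn) _.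
rewrite (eq_bigr (fun k => `|f k - g k|)); last first.
  move=> k _; rewrite [X in `|X|](_ : _ = phi f k - phi g k)//.
  by rewrite phiE// phiE.
have jn : (j <= n)%N by exact: leq_addr.
rewrite (big_cat_nat (leq0n j) jn)/= [leRHS]splitr; apply: lerD.
  apply: (@le_trans _ _ (\sum_(0 <= k < j) e / (2 * j.+1%:R))).
    by apply: ler_sum_nat => k /andP[_]; exact: hg.
  rewrite sumr_const_nat subn0 -[leLHS]mulr_natr.
  have -> : e / (2 * j.+1%:R) * j%:R = e / 2 * (j%:R / j.+1%:R) by rewrite invfM; ring.
  rewrite ler_piMr ?divr_ge0 ?(ltW e0)//.
  by rewrite ler_pdivrMr ?ltr0n// mul1r ler_nat.
have tf := tail_le Bf jn; have tg := tail_le Bg jn.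
apply: (@le_trans _ _ (\sum_(j <= k < n) f k + \sum_(j <= k < n) g k)).
  rewrite -big_split/=; apply: ler_sum_nat => k _; apply: le_trans (ler_normB _ _) _.
  by rewrite !ger0_norm//; [case: Bg|case: Bf].
rewrite -(ler_pM2l (w0 j)) mulrDr; apply: le_trans (lerD tf tg) _.
by rewrite ler_pdivrMr// in hj; lra.
Qed.

Lemma weighted_ball_closed : closed weighted_ball.
Proof.
by apply: compact_closed; [exact: norm_hausdorff|exact: weighted_ball_compact].
Qed.

End weighted_compactness.

Section ereal_split.
Context {R : realType}.
Local Open Scope ereal_scope.

Lemma lte_scaled_sum_split (beta c : R) (A B : \bar R) : (0 < beta)%R ->
  -oo < A -> -oo < B -> c%:E < beta%:E * A + B ->
  exists c1 c2 : R, [/\ c1%:E < A, c2%:E < B & (c < beta * c1 + c2)%R].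
Proof.
move=> b0; case: A => [A| |]//; case: B => [B| |]// _ _.
- rewrite -EFinM -EFinD lte_fin => h.
  pose e := ((beta * A + B - c) / (4 * (beta + 1)))%R.
  have b1 : (0 < beta + 1)%R by lra.
  have e0 : (0 < e)%R by rewrite divr_gt0 ?subr_gt0// mulr_gt0.
  have he : (e * (beta + 1) = (beta * A + B - c) / 4)%R by rewrite /e; field; lra.
  exists (A - e)%R, (B - e)%R; rewrite !lte_fin; split; lra.
- move=> _; exists (A - 1)%R, (c - beta * (A - 1) + 1)%R.
  by rewrite lte_fin ltry; split => //; lra.
- move=> _; exists ((c - B + 2) / beta)%R, (B - 1)%R; rewrite ltry lte_fin; split => //; first lra.
  have -> : (beta * ((c - B + 2) / beta) = c - B + 2)%R by field; rewrite gt_eqF.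
  lra.
- move=> _; exists ((c + 1) / beta)%R, 0%R; rewrite !ltry; split => //.
  have -> : (beta * ((c + 1) / beta) = c + 1)%R by field; rewrite gt_eqF.
  lra.
Qed.

Lemma lsc_regularization_gt (X : topologicalType) (f : X -> \bar R) (x : X) (c : \bar R) :
  c < lsc_regularization f x -> \forall y \near x, c <= f y.
Proof.
rewrite /lsc_regularization limf_einfE => /ereal_sup_gt[_ [V xV <-] cV].
apply: filterS xV => y Vy; apply: le_trans (ltW cV) _.
by apply: ereal_inf_lbound; exists y.
Qed.

End ereal_split.

Section exponential_moments.
Context {R : realType}.
Variables (d : nat) (beta a b alpha mu : R).
Variables (gDir : nat -> R -> 'rV[R]_d -> 'rV[R]_d -> R) (bc : boundary_condition).
Variable nu : nat -> probability (borel_l1 R) R.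
Hypotheses (d0 : (0 < d)%N) (beta0 : 0 < beta) (b0 : 0 <= b) (ab : b < a).
Hypothesis alpha0 : alpha <= 0.
Hypothesis nuP : forall N, (0 < N)%N -> reference_law beta gDir bc alpha N (nu N).
Local Notation V N := (vol d N : R).
Local Notation qN N k := (q_bc beta gDir bc alpha N k.+1).
Local Notation p k := (q_free d beta alpha k.+1).
Local Notation q k := (q_free d beta 0 k.+1).
Hypothesis qN0 : forall N k, (0 < N)%N -> 0 <= qN N k.
Hypothesis qN_le : forall e : R, 0 < e ->
  \forall N \near \oo, forall k, qN N k <= (1 + e) * p k.
Hypothesis qN_ge : forall (e : R) k, 0 < e -> \forall N \near \oo, p k - e <= qN N k.
Local Notation m := (mu + alpha).
Local Notation I := (rate0 d beta).
Local Notation Q N A := (gibbs d beta a b mu N (nu N) A).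

Let q0 k : 0 < q k. Proof. exact: q_free0_gt0. Qed.

Lemma q_free_tilt k : p k = expR (beta * alpha * k.+1%:R) * q k.
Proof. by rewrite /q_free mulr0 mul0r expR0 div1r. Qed.

Let p0 k : 0 < p k. Proof. by rewrite q_free_tilt mulr_gt0// expR_gt0. Qed.

Let p_le_q k : p k <= q k.
Proof.
rewrite q_free_tilt ler_piMl ?(ltW (q0 k))// expR_le1 mulr_le0_ge0//.
by rewrite mulr_ge0_le0// ltW.
Qed.

Lemma q_free_summable : (\sum_(0 <= k <oo) (p k)%:E < +oo)%E.
Proof.
apply: le_lt_trans (q_free0_summable d0 beta0).
apply: tsum_le => [k|n]; first exact/ltW.
apply: le_trans (psum_le_tsum n (fun k => ltW (q0 k))).
by rewrite lee_fin; apply: ler_sum_nat => k _; exact: p_le_q.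
Qed.

Definition ptot : R := fine (\sum_(0 <= k <oo) (p k)%:E)%E.

(* The constant by which the tilt from [alpha] to 0 changes exponential rates. *)
Definition kappa : R := ptot - @qtot R d beta.

Lemma vol_cvg : (fun N => V N) @ \oo --> +oo.
Proof.
apply/cvgryPge => M; near=> N.
have N0 : (0 < N)%N by near: N; exists 1%N.
have : M <= N%:R.
  near: N; exists (Num.truncn `|M|).+1 => // N /= hN.
  by apply: le_trans (ler_norm M) _; apply: le_trans (ltW (truncnS_gt _)) _; rewrite ler_nat.
move=> /le_trans; apply; rewrite ler_nat -(prednK d0) expnS.
apply: (@leq_trans (2 * N)); first by rewrite leq_pmull.
by rewrite leq_pmulr// expn_gt0 muln_gt0 N0.
Unshelve. all: by end_near. Qed.

Let V0 N : (0 < N)%N -> 0 < V N. Proof. exact: vol_gt0. Qed.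

Lemma exp_moment_le (l : nat -> R) K (e : R) : 0 < e -> (forall k, (K <= k)%N -> l k = 0) ->
  exists K', \forall N \near \oo, forall n, (K' <= n)%N ->
    \sum_(0 <= k < n) qN N k * (expR (l k - beta * alpha * k.+1%:R) - 1) <=
    \sum_(0 <= k < K) q k * (expR (l k) - 1) - kappa + e.
Proof.
move=> e0 lK.
have q0' k : 0 <= q k := ltW (q0 k).
pose A := \sum_(0 <= k < K) q k * (expR (l k) - 1) + @qtot R d beta.
have hA n : (K <= n)%N -> \sum_(0 <= k < n) q k * expR (l k) <= A.
  move=> Kn; have h := psum_le_fine n q0' (q_free0_summable d0 beta0).
  apply: (@le_trans _ _ (\sum_(0 <= k < K) q k * (expR (l k) - 1) + \sum_(0 <= k < n) q k)); last first.
    by rewrite lerD2l.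
  rewrite !(big_cat_nat (leq0n K) Kn)/= addrA -big_split/=.
  apply: lerD; first by apply: ler_sum_nat => k _; lra.
  by apply: ler_sum_nat => k /andP[Kk _]; rewrite lK// expR0 mulr1.
have A0 : 0 <= A.
  apply: le_trans (hA K (leqnn _)); apply: sumr_ge0 => k _.
  by rewrite mulr_ge0 ?expR_ge0.
pose e1 := e / (3 * (A + 1)).
have A1 : 0 < A + 1 by lra.
have e10 : 0 < e1 by rewrite divr_gt0// mulr_gt0.
have e3 : 0 < e / 3 by rewrite divr_gt0.
have p0' k : 0 <= p k := ltW (p0 k).
have [J hJ] : exists J, ptot - \sum_(0 <= k < J) p k <= e / 3.
  have /cvgrPdist_le/(_ _ e3)[J _ /(_ J)] := psum_cvg p0' q_free_summable.
  by move=> /(_ (leqnn _)) h; exists J; apply: le_trans (ler_norm _) h.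
pose e4 := e / (3 * J.+1%:R).
have e40 : 0 < e4 by rewrite divr_gt0// mulr_gt0// ltr0n.
have lower j : \forall N \near \oo, forall k, (k < j)%N -> p k - e4 <= qN N k.
  elim: j => [|j IH]; first by apply: nearW.
  apply: filterS2 IH (qN_ge j e40) => N h1 h2 k.
  by rewrite ltnS leq_eqVlt => /predU1P[->|/h1].
exists (maxn K J); near=> N; move=> n; rewrite geq_max => /andP[Kn Jn].
have N0 : (0 < N)%N by near: N; exists 1%N.
have h1 : \sum_(0 <= k < n) qN N k * expR (l k - beta * alpha * k.+1%:R) <= (1 + e1) * A.
  apply: (@le_trans _ _ ((1 + e1) * \sum_(0 <= k < n) q k * expR (l k))).
    rewrite mulr_sumr; apply: ler_sum_nat => k _.
    have hk : qN N k <= (1 + e1) * p k by move: k; near: N; exact: qN_le.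
    apply: le_trans (ler_wpM2r (expR_ge0 _) hk) _.
    have -> : (1 + e1) * p k * expR (l k - beta * alpha * k.+1%:R) =
        (1 + e1) * (q k * expR (l k)).
      rewrite q_free_tilt expRD expRN; field.
      by rewrite gt_eqF// expR_gt0.
    by [].
  by apply: ler_wpM2l; [rewrite addr_ge0// ltW|exact: hA].
have h2 : ptot - e / 3 - e / 3 <= \sum_(0 <= k < n) qN N k.
  apply: (@le_trans _ _ (\sum_(0 <= k < J) qN N k)); last first.
    by apply: psum_le => // k; exact: qN0.
  apply: (@le_trans _ _ (\sum_(0 <= k < J) (p k - e4))); last first.
    by apply: ler_sum_nat => k /andP[_]; move: k; near: N; exact: lower.
  rewrite sumrB sumr_const_nat subn0 -[e4 *+ J]mulr_natr.
  have : e4 * J%:R <= e / 3.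
    have -> : e / 3 = e4 * J.+1%:R by rewrite /e4; field; rewrite ?natr1 ?(addrC 1) ?natr1 pnatr_eq0.
    by rewrite ler_pM2l// ler_nat.
  lra.
have h3 : e1 * A <= e / 3.
  have -> : e / 3 = e1 * (A + 1) by rewrite /e1; field; lra.
  by rewrite ler_pM2l//; lra.
under eq_bigr do rewrite mulrBr mulr1; rewrite sumrB.
have -> : \sum_(0 <= k < K) q k * (expR (l k) - 1) = A - @qtot R d beta by rewrite /A addrK.
rewrite /kappa; rewrite mulrDl mul1r in h1; lra.
Unshelve. all: by end_near. Qed.

End exponential_moments.

Section upper_bound.
Context {R : realType}.
Variables (d : nat) (beta a b alpha mu : R).
Variables (gDir : nat -> R -> 'rV[R]_d -> 'rV[R]_d -> R) (bc : boundary_condition).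
Variable nu : nat -> probability (borel_l1 R) R.
Hypotheses (d0 : (0 < d)%N) (beta0 : 0 < beta) (b0 : 0 <= b) (ab : b < a).
Hypothesis alpha0 : alpha <= 0.
Hypothesis nuP : forall N, (0 < N)%N -> reference_law beta gDir bc alpha N (nu N).
Local Notation V N := (vol d N : R).
Local Notation qN N k := (q_bc beta gDir bc alpha N k.+1).
Local Notation p k := (q_free d beta alpha k.+1).
Local Notation q k := (q_free d beta 0 k.+1).
Hypothesis qN0 : forall N k, (0 < N)%N -> 0 <= qN N k.
Hypothesis qN_le : forall e : R, 0 < e ->
  \forall N \near \oo, forall k, qN N k <= (1 + e) * p k.
Hypothesis qN_ge : forall (e : R) k, 0 < e -> \forall N \near \oo, p k - e <= qN N k.
Local Notation m := (mu + alpha).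
Local Notation I := (rate0 d beta).
Local Notation Q N A := (gibbs d beta a b mu N (nu N) A).
Local Notation kappa := (kappa d beta alpha).

Let q0 k : 0 < q k. Proof. exact: q_free0_gt0. Qed.
Let V0 N : (0 < N)%N -> 0 < V N. Proof. exact: vol_gt0. Qed.

Lemma gibbs_local_upper (x : l1 R) (c1 c2 e : R) : (c1%:E < H_HYL_lsc a b m x)%E ->
  (c2%:E < I x)%E -> 0 < e ->
  exists U : set (l1 R), [/\ open U, U x & \forall N \near \oo,
    (Q N U <= (expR (- V N * (beta * c1 + c2 + kappa - e)))%:E)%E].
Proof.
move=> /lsc_regularization_gt hU /(rate0_dual d0 beta0)[l0 [K hl]] e0.
pose l k := if (k < K)%N then l0 k else 0.
pose S := \sum_(0 <= k < K) l k * x k - e / 2.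
have lK k : (K <= k)%N -> l k = 0 by rewrite /l ltnNge => ->.
have sumE (y : l1 R) n : (K <= n)%N ->
    \sum_(0 <= k < n) l k * y k = \sum_(0 <= k < K) l k * y k.
  move=> Kn; rewrite (big_cat_nat (leq0n K) Kn)/= [X in _ + X]big_nat_cond.
  by rewrite [X in _ + X]big1 ?addr0// => k /andP[/andP[/lK -> _] _]; rewrite mul0r.
have cS : continuous (fun y : l1 R => \sum_(0 <= k < K) l k * y k).
  move=> y; suff : (fun y : l1 R => \sum_(0 <= k < K) l k * y k) @ nbhs y -->
      \sum_(0 <= k < K) l k * y k by [].
  elim: (K) => [|j IH].
    under eq_fun do rewrite big_geq//; rewrite big_geq//; exact: cvg_cst.
  under eq_fun do rewrite big_nat_recr//=; rewrite big_nat_recr//=.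
  apply: cvgD => //; apply: cvgM; [exact: cvg_cst|exact: l1_coord_continuous].
pose U1 := [set y : l1 R | S < \sum_(0 <= k < K) l k * y k].
have oU1 : open U1.
  have /continuousP h := cS; have := h [set z | S < z]; apply; exact: open_gt.
exists ([set y : l1 R | (c1%:E <= H_HYL a b m y)%E]^° `&` U1).
have e2 : 0 < e / 2 by rewrite divr_gt0.
split.
- by apply: openI => //; exact: open_interior.
- by split => //; rewrite /U1 /= /S; lra.
have [K' hK'] := exp_moment_le d0 beta0 alpha0 qN0 qN_le qN_ge e2 lK.
near=> N; have N0 : (0 < N)%N by near: N; exists 1%N.
have hT : forall n, (K' <= n)%N ->
    \sum_(0 <= k < n) qN N k * (expR (l k - beta * alpha * k.+1%:R) - 1) <=
    \sum_(0 <= k < K) q k * (expR (l k) - 1) - kappa + e / 2.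
  by near: N; exact: hK'.
have := @gibbs_upper R d beta a b alpha mu gDir bc N (nu N) beta0 (nuP N0)
  (fun k => qN0 k N0) (V0 N0) ([set y : l1 R | (c1%:E <= H_HYL a b m y)%E]^° `&` U1)
  c1 S _ l K' _ _ _ hT.
move=> /(_ _ _ _)/le_trans; apply.
- apply: open_borel_l1; apply: openI => //; exact: open_interior.
- by move=> y [/interior_subset].
- move=> y [_ hy] _; exists K => n Kn; rewrite sumE//; exact: ltW.
rewrite lee_fin ler_expR mulNr -mulrN ler_pM2l ?V0//.
have dE : dual_pairing (d := d) (beta := beta) l0 K x =
    \sum_(0 <= k < K) l k * x k - \sum_(0 <= k < K) q k * (expR (l k) - 1).
  by rewrite -sumrB; apply: eq_big_nat => k /andP[_ kK]; rewrite /l kK.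
move: hl; rewrite dE /S; lra.
Unshelve. all: by end_near. Qed.

Lemma H_HYL_ge (x : l1 R) : ((- (m ^+ 2 / (2 * (a - b))))%:E <= H_HYL a b m x)%E.
Proof.
apply: le_trans (trunc_energy_le_H b0 ab m 0 x).
rewrite lee_fin /trunc_energy /relaxed /dens_trunc /sq_trunc !big_geq//.
set M := Num.max _ _.
have -> : - m * 0 + a / 2 * 0 ^+ 2 - b / 2 * 0 - M ^+ 2 / (2 * (a - b)) =
    - (M ^+ 2 / (2 * (a - b))) by ring.
rewrite lerN2 ler_pM2r ?invr_gt0 ?mulr_gt0 ?subr_gt0// /M mulr0 subr0.
have [h|h] := leP m 0; last by [].
by rewrite expr0n; exact: sqr_ge0.
Qed.

Lemma gibbs_tight (L' : R) : exists K : set (l1 R),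
  [/\ compact K, closed K & \forall N \near \oo, (Q N (~` K) <= (expR (- V N * L'))%:E)%E].
Proof.
have [B hB] := @q_free0_weighted_sum R d beta d0 beta0.
pose c1 := - (m ^+ 2 / (2 * (a - b))).
have B0 : 0 <= B by have := hB 0%N; rewrite big_geq.
pose L := 2 * B - beta * c1 + L'.
have w1 := @tight_weight_ge1 R; have wh := @tight_weight_homo R.
have wu := @tight_weight_unbounded R.
exists (weighted_ball (@tight_weight R) L); split.
- exact: weighted_ball_compact.
- exact: weighted_ball_closed.
near=> N; have N0 : (0 < N)%N by near: N; exists 1%N.
have hT : forall n, (0 <= n)%N -> \sum_(0 <= k < n) qN N k *
    (expR (tight_weight k - beta * alpha * k.+1%:R) - 1) <= 2 * B.
  move=> n _; apply: (@le_trans _ _ (2 * \sum_(0 <= k < n) q k * expR (tight_weight k))).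
    rewrite mulr_sumr; apply: ler_sum_nat => k _.
    have hk : qN N k <= (1 + 1) * p k by move: k; near: N; apply: qN_le.
    apply: (@le_trans _ _ (qN N k * expR (tight_weight k - beta * alpha * k.+1%:R))).
      by rewrite ler_wpM2l ?qN0// gerBl.
    apply: le_trans (ler_wpM2r (expR_ge0 _) hk) _.
    rewrite (q_free_tilt d beta alpha) expRD expRN.
    set E := expR (beta * _ * _); have E0 : 0 < E by exact: expR_gt0.
    have -> : (1 + 1) * (E * q k) * (expR (tight_weight k) * E^-1) =
        2 * (q k * expR (tight_weight k)) by field; rewrite gt_eqF.
    by [].
  by rewrite ler_pM2l.
have := @gibbs_upper R d beta a b alpha mu gDir bc N (nu N) beta0 (nuP N0)
  (fun k => qN0 k N0) (V0 N0) (~` weighted_ball (@tight_weight R) L)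
  c1 L _ (@tight_weight R) 0%N _ _ _ hT.
move=> /(_ _ _ _)/le_trans; apply.
- by apply: measurableC; apply: closed_borel_l1; exact: weighted_ball_closed.
- by move=> y _; exact: H_HYL_ge.
- move=> y ny y0; have [h|/existsNP[n /negP]] :=
    pselect (forall n, \sum_(0 <= k < n) tight_weight k * y k <= L).
    by exfalso; apply: ny.
  rewrite -ltNge => hn; exists n => n2 nn2; apply: (le_trans (ltW hn)).
  apply: (psum_le (u := fun k => tight_weight k * y k)) => // k.
  by rewrite mulr_ge0// (le_trans ler01).
rewrite lee_fin ler_expR mulNr -mulrN ler_pM2l ?V0// /L; lra.
Unshelve. all: by end_near. Qed.

Local Notation F x := (beta%:E * H_HYL_lsc a b m x + I x)%E.

Lemma H_lsc_ge (x : l1 R) : ((- (m ^+ 2 / (2 * (a - b))))%:E <= H_HYL_lsc a b m x)%E.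
Proof.
apply: lsc_regularization_ge; apply: (@nearW _ (nbhs x) _ (nbhs_filter x)) => y.
exact: H_HYL_ge.
Qed.

Lemma gibbs_measure_le (A B : set (l1 R)) N : (0 < N)%N ->
  measurable (A : set (borel_l1 R)) -> measurable (B : set (borel_l1 R)) ->
  A `<=` B -> (Q N A <= Q N B)%E.
Proof.
move=> N0 mA mB AB; apply: ge0_subset_integral => //.
- by apply: (measurable_funS measurableT) => //; exact: measurable_boltzmann.
- by move=> x _; exact: boltzmann_ge0.
Qed.

Lemma gibbs_setU_le (A B : set (l1 R)) N : (0 < N)%N ->
  measurable (A : set (borel_l1 R)) -> measurable (B : set (borel_l1 R)) ->
  (Q N (A `|` B) <= Q N A + Q N B)%E.
Proof.
move=> N0 mA mB; have mBA : measurable (B `\` A : set (borel_l1 R)) by exact: measurableD.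
have mb (D : set (borel_l1 R)) : measurable D ->
    measurable_fun D (boltzmann d beta a b mu N).
  by move=> mD; apply: (measurable_funS measurableT) => //; exact: measurable_boltzmann.
have -> : A `|` B = A `|` (B `\` A).
  apply/seteqP; split => x [Ax|]; [by left| |by left|by move=> [Bx _]; right].
  by move=> Bx; have [Ax|nAx] := pselect (A x); [left|right].
rewrite /gibbs ge0_integral_setU//.
- by rewrite leeD2l//; apply: gibbs_measure_le => //; exact: subDsetl.
- by apply: mb; exact: measurableU.
- by move=> x _; exact: boltzmann_ge0.
- by apply/disj_setPS => x [Ax [_ nAx]].
Qed.

Lemma gibbs_bigcup_le (U : l1 R -> set (l1 R)) (E : nat -> R) (s : seq (l1 R)) :
  (forall x, open (U x)) -> (forall x, \forall N \near \oo, (Q N (U x) <= (E N)%:E)%E) ->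
  \forall N \near \oo, (Q N (\bigcup_(x in [set` s]) U x) <= ((size s)%:R * E N)%:E)%E.
Proof.
move=> oU hU; elim: s => [|x s IH].
  apply: nearW => N; rewrite (_ : \bigcup_(x in _) _ = set0); last first.
    by apply/seteqP; split => // y [].
  by rewrite /gibbs integral_set0 mul0r.
near=> N; have N0 : (0 < N)%N by near: N; exists 1%N.
have oUs : open (\bigcup_(y in [set` s]) U y) by apply: bigcup_open => y _; exact: oU.
rewrite (_ : \bigcup_(y in _) _ = U x `|` \bigcup_(y in [set` s]) U y); last first.
  apply/seteqP; split => y.
    by move=> [z /=]; rewrite inE => /predU1P[->|zs] Uz; [left|right; exists z].
  by move=> [Ux|[z zs Uz]]; [exists x; rewrite //= mem_head|exists z; rewrite //= inE zs orbT].
apply: le_trans (gibbs_setU_le N0 (open_borel_l1 (oU x)) (open_borel_l1 oUs)) _.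
rewrite /= -natr1 mulrDl mul1r addrC EFinD; apply: leeD; near: N => //.
Unshelve. all: by end_near. Qed.

Lemma gibbs_closed_upper (C : set (l1 R)) (c e : R) : closed C -> 0 < e ->
  (c%:E < ereal_inf ((fun x => F x) @` C))%E ->
  \forall N \near \oo, (Q N C <= (expR (- V N * (c + kappa - e)))%:E)%E.
Proof.
move=> cC e0 hc; have e2 : 0 < e / 2 by rewrite divr_gt0.
have loc (x : l1 R) : exists U : set (l1 R), [/\ open U, (C x -> U x) & \forall N \near \oo,
    (Q N U <= (expR (- V N * (c + kappa - e / 2)))%:E)%E].
  have [Cx|nCx] := pselect (C x); last first.
    exists set0; split => //.
    apply: nearW => N; rewrite /gibbs integral_set0 lee_fin; exact: expR_ge0.
  have cF : (c%:E < F x)%E.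
    by apply: lt_le_trans hc _; apply: ereal_inf_lbound; exists x.
  have [||c1 [c2 [h1 h2 h3]]] := lte_scaled_sum_split beta0 _ _ cF.
  - by apply: lt_le_trans (H_lsc_ge x); exact: ltNyr.
  - by apply: lt_le_trans (rate0_ge0 d0 beta0 x); exact: ltNyr.
  have [U [oU Ux hU]] := gibbs_local_upper h1 h2 e2.
  exists U; split => //; near=> N; have N0 : (0 < N)%N by near: N; exists 1%N.
  apply: (@le_trans _ _ (expR (- V N * (beta * c1 + c2 + kappa - e / 2)))%:E); first by near: N.
  by rewrite lee_fin ler_expR !mulNr lerN2 ler_pM2l ?V0//; lra.
have [U hU] := choice loc.
have [K [cK clK hK]] := gibbs_tight (c + kappa - e / 2).
have cCK : compact (C `&` K) by rewrite setIC; exact: compact_closedI.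
have : cover_compact (C `&` K) by rewrite -compact_cover.
move=> /(_ (l1 R) setT U) [||D' _ hD].
- by move=> x _; case: (hU x).
- by move=> x [Cx _]; exists x => //; case: (hU x) => _ + _; exact.
have oU x : open (U x) by case: (hU x).
have hs := gibbs_bigcup_le (finmap.enum_fset D') oU (fun x => let: And3 _ _ h := hU x in h).
set s := finmap.enum_fset D' in hs.
have hV : \forall N \near \oo, (size s)%:R + 1 <= expR (V N * (e / 2)).
  have /cvgryPge/(_ ((size s)%:R / (e / 2))) := @vol_cvg R d d0; apply: filterS => N hN.
  by apply: le_trans (expR_ge1Dx _); rewrite addrC lerD2l -ler_pdivrMr.
near=> N; have N0 : (0 < N)%N by near: N; exists 1%N.
have mUs : measurable (\bigcup_(x in [set` s]) U x : set (borel_l1 R)).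
  by apply: open_borel_l1; apply: bigcup_open => y _; exact: oU.
have mK : measurable (~` K : set (borel_l1 R)).
  by apply: measurableC; exact: closed_borel_l1.
apply: (@le_trans _ _ (Q N (\bigcup_(x in [set` s]) U x `|` ~` K))).
  apply: gibbs_measure_le => //; [exact: closed_borel_l1|exact: measurableU|].
  move=> x Cx; have [Kx|nKx] := pselect (K x); last by right.
  by left; exact: hD.
apply: le_trans (gibbs_setU_le N0 mUs mK) _.
pose E := expR (- V N * (c + kappa - e / 2)).
apply: (@le_trans _ _ (((size s)%:R * E)%:E + E%:E)%E).
  by apply: leeD; rewrite /E; near: N.
rewrite -EFinD lee_fin.
have -> : (size s)%:R * E + E = ((size s)%:R + 1) * E by ring.
have -> : expR (- V N * (c + kappa - e)) = expR (V N * (e / 2)) * E.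
  by rewrite -expRD; congr expR; field.
by apply: ler_wpM2r; [exact: expR_ge0|near: N].
Unshelve. all: by end_near. Qed.

End upper_bound.

(** * Large deviation lower bound *)

Section poisson_product.
Context {R : realType}.
Variables (V : nat -> R) (r : nat -> nat -> R) (p y : nat -> R).
Hypotheses (Voo : V @ \oo --> +oo) (rp : forall k, r k @ \oo --> p k).
Hypotheses (p0 : forall k, 0 < p k) (y0 : forall k, 0 <= y k).

Lemma poisson_product_lower K (e : R) : 0 < e ->
  \forall N \near \oo, expR (- V N * (\sum_(0 <= k < K) entropy (p k) (y k) + e)) <=
    \prod_(0 <= k < K) poisson_weight (V N * r k N) (Num.truncn (V N * y k)).
Proof.
have V0 : \forall N \near \oo, 0 < V N by move/cvgryPgt : Voo; exact.
elim: K e => [|K IH] e e0.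
  apply: filterS V0 => N VN; rewrite !big_geq// add0r -expR0 ler_expR mulNr oppr_le0.
  by rewrite mulr_ge0// ltW.
have e2 : 0 < e / 2 by rewrite divr_gt0.
apply: filterS2 (IH _ e2) (poisson_weight_lower Voo (rp (k := K)) (p0 K) (y0 K) e2) => N h1 h2.
rewrite !big_nat_recr//=; apply: le_trans (ler_pM (expR_ge0 _) (expR_ge0 _) h1 h2).
by rewrite -expRD ler_expR; lra.
Qed.

End poisson_product.

Section discretization.
Context {R : realType}.
Implicit Types (V : R) (y : l1 R).

Definition discretize_count V (y : l1 R) K k : nat :=
  if (k < K)%N then Num.truncn (V * y k) else 0%N.

Lemma discretize_l1 V y K : (fun k => (discretize_count V y K k)%:R / V) \in l1pred.
Proof.
apply: (@finsupp_l1 _ _ K) => k Kk.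
by rewrite /discretize_count ltnNge Kk mul0r.
Qed.

Definition discretize V y K : l1 R := L1 (discretize_l1 V y K).

Lemma discretize_dist V y K : 0 < V -> l1_nonneg y -> (forall k, (K <= k)%N -> y k = 0) ->
  `|y - discretize V y K| <= K%:R / V.
Proof.
move=> V0 y0 yK; apply: l1_norm_le => n.
pose f k : R := if (k < K)%N then V^-1 else 0.
have f0 k : 0 <= f k by rewrite /f; case: ifP => // _; rewrite invr_ge0 ltW.
have -> : K%:R / V = \sum_(0 <= k < K) f k.
  rewrite (eq_big_nat _ _ (F2 := fun=> V^-1)) => [|k /andP[_ kK]]; last by rewrite /f kK.
  by rewrite sumr_const_nat subn0 mulr_natl.
apply: (@le_trans _ _ (\sum_(0 <= k < n) f k)).
  apply: ler_sum_nat => k _.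
  have -> : (y - discretize V y K) k = y k - (discretize_count V y K k)%:R / V by [].
  rewrite /discretize_count /f.
  case: ltnP => kK; last by rewrite yK// mul0r subrr normr0.
  have Vy : 0 <= V * y k by rewrite mulr_ge0// ltW.
  have h1 : (Num.truncn (V * y k))%:R / V <= y k by rewrite ler_pdivrMr// [X in _ <= X]mulrC truncn_le.
  have h2 : y k <= ((Num.truncn (V * y k))%:R + 1) / V.
    by rewrite ler_pdivlMr// natr1 [X in X <= _]mulrC ltW// truncnS_gt.
  rewrite ger0_norm ?subr_ge0// lerBlDr addrC; rewrite mulrDl mul1r in h2; exact: h2.
apply: (@le_trans _ _ (\sum_(0 <= k < maxn n K) f k)).
  by apply: psum_le => //; exact: leq_maxl.
rewrite (big_cat_nat (leq0n K) (leq_maxr n K))/= [X in _ + X]big_nat_cond.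
rewrite [X in _ + X]big1 ?addr0// => k /andP[/andP[Kk _] _].
by rewrite /f ltnNge Kk.
Qed.

Lemma discretize_cvg (V : nat -> R) y K : V @ \oo --> +oo ->
  l1_nonneg y -> (forall k, (K <= k)%N -> y k = 0) ->
  (fun N => discretize (V N) y K) @ \oo --> y.
Proof.
move=> Voo y0 yK; have V0 : \forall N \near \oo, 0 < V N by move/cvgryPgt : Voo; exact.
apply/cvgrPdist_lt => e e0.
have /cvgryPgt/(_ (K%:R / e)) := Voo; apply: filterS2 V0 => N VN hN.
apply: le_lt_trans (discretize_dist VN y0 yK) _.
by rewrite ltr_pdivrMr// mulrC -ltr_pdivrMr.
Qed.

End discretization.

Section lower_bound.
Context {R : realType}.
Variables (d : nat) (beta a b alpha mu : R).
Variables (gDir : nat -> R -> 'rV[R]_d -> 'rV[R]_d -> R) (bc : boundary_condition).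
Variable nu : nat -> probability (borel_l1 R) R.
Hypotheses (d0 : (0 < d)%N) (beta0 : 0 < beta) (b0 : 0 <= b) (ab : b < a).
Hypothesis alpha0 : alpha <= 0.
Hypothesis nuP : forall N, (0 < N)%N -> reference_law beta gDir bc alpha N (nu N).
Local Notation V N := (vol d N : R).
Local Notation qN N k := (q_bc beta gDir bc alpha N k.+1).
Local Notation p k := (q_free d beta alpha k.+1).
Local Notation q k := (q_free d beta 0 k.+1).
Hypothesis qN0 : forall N k, (0 < N)%N -> 0 <= qN N k.
Hypothesis qN_le : forall e : R, 0 < e ->
  \forall N \near \oo, forall k, qN N k <= (1 + e) * p k.
Hypothesis qN_ge : forall (e : R) k, 0 < e -> \forall N \near \oo, p k - e <= qN N k.
Local Notation m := (mu + alpha).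
Local Notation I := (rate0 d beta).
Local Notation Q N A := (gibbs d beta a b mu N (nu N) A).
Local Notation kappa := (kappa d beta alpha).
Local Notation ptot := (ptot d beta alpha).

Let q0 k : 0 < q k. Proof. exact: q_free0_gt0. Qed.
Let p0 k : 0 < p k. Proof. by rewrite q_free_tilt mulr_gt0// expR_gt0. Qed.
Let V0 N : (0 < N)%N -> 0 < V N. Proof. exact: vol_gt0. Qed.

Lemma q_bc_cvg k : (fun N => qN N k) @ \oo --> p k.
Proof.
apply/cvgrPdist_le => e e0.
have e1 : 0 < e / p k by rewrite divr_gt0.
apply: filterS2 (qN_ge k e0) (qN_le e1) => N h1 /(_ k).
have -> : (1 + e / p k) * p k = p k + e by field; rewrite gt_eqF.
by move=> h2; rewrite ler_norml; apply/andP; split; lra.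
Qed.

Lemma gibbs_lower_at (O : set (l1 R)) (y : l1 R) K (e : R) : open O -> O y ->
  l1_nonneg y -> (forall k, (K <= k)%N -> y k = 0) -> 0 < e ->
  \forall N \near \oo, ((expR (- V N * (\sum_(0 <= k < K) entropy (p k) (y k) +
      (ptot - \sum_(0 <= k < K) p k) +
      beta * energy a b mu (dens_trunc K y) (sq_trunc K y) + e)))%:E <= Q N O)%E.
Proof.
move=> oO Oy y0 yK e0; have e3 : 0 < e / 3 by rewrite divr_gt0.
have p0' k : 0 <= p k := ltW (p0 k).
have pS := q_free_summable d0 beta0 alpha0.
set t := ptot - \sum_(0 <= k < K) p k.
have ptail n : \sum_(K <= k < n) p k <= t.
  rewrite lerBrDl; have [Kn|nK] := leqP K n; last first.
    by rewrite (@big_geq _ _ _ K n) ?(ltnW nK)// addr0; exact: psum_le_fine.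
  by rewrite -(big_cat_nat (leq0n K) Kn)/=; exact: psum_le_fine.
have t0 : 0 <= t by have := ptail 0%N; rewrite big_geq.
pose e1 := e / (3 * (t + 1)).
have e10 : 0 < e1 by rewrite divr_gt0// mulr_gt0//; lra.
have e1t : e1 * t <= e / 3.
  have -> : e / 3 = e1 * (t + 1) by rewrite /e1; field; lra.
  by rewrite ler_pM2l//; lra.
have Voo := @vol_cvg R d d0.
have xy := discretize_cvg Voo y0 yK.
have Ecvg : (fun N => beta * energy a b mu (dens_trunc K (discretize (V N) y K))
    (sq_trunc K (discretize (V N) y K))) @ \oo -->
    beta * energy a b mu (dens_trunc K y) (sq_trunc K y).
  apply: cvgM; [exact: cvg_cst|apply: energy_cvg].
    have h := @weighted_psum_cvg R (fun k => k.+1%:R) 1 K y.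
    have := cvg_comp _ _ xy h; under eq_fun do under eq_bigr do rewrite expr1.
    by under eq_bigr do rewrite expr1.
  exact: (cvg_comp _ _ xy (@weighted_psum_cvg R (fun k => k.+1%:R ^+ 2) 2 K y)).
near=> N; have N0 : (0 < N)%N by near: N; exists 1%N.
have VN : 0 < V N := V0 N0.
have hx : O (discretize (V N) y K).
  by near: N; apply: (xy O); exact: open_nbhs_nbhs.
have hq n : \sum_(K <= k < n) V N * qN N k <= V N * ((1 + e1) * t).
  rewrite -mulr_sumr ler_pM2l//.
  apply: (@le_trans _ _ (\sum_(K <= k < n) (1 + e1) * p k)).
    by apply: ler_sum_nat => k _; move: k; near: N; exact: qN_le.
  by rewrite -mulr_sumr ler_wpM2l// addr_ge0// ltW.
have hK k : (K <= k)%N -> discretize_count (V N) y K k = 0%N.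
  by move=> Kk; rewrite /discretize_count ltnNge Kk.
have := @gibbs_lower R d beta a b alpha mu gDir bc N (nu N) (nuP N0)
  (fun k => qN0 k N0) O (discretize (V N) y K) (discretize_count (V N) y K) K _
  (open_borel_l1 oO) hx (fun k => erefl) hK hq.
apply: le_trans; rewrite lee_fin.
have hP : expR (- V N * (\sum_(0 <= k < K) entropy (p k) (y k) + e / 3)) <=
    \prod_(0 <= k < K) poisson_weight (V N * qN N k) (discretize_count (V N) y K k).
  rewrite [leRHS](eq_big_nat _ _ (F2 := fun k =>
      poisson_weight (V N * qN N k) (Num.truncn (V N * y k)))) => [|k /andP[_ kK]].
    by near: N; apply: poisson_product_lower => //; exact: q_bc_cvg.
  by rewrite /discretize_count kK.
have hE : beta * energy a b mu (dens_trunc K (discretize (V N) y K))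
    (sq_trunc K (discretize (V N) y K)) <=
    beta * energy a b mu (dens_trunc K y) (sq_trunc K y) + e / 3.
  by near: N; apply: (cvgr_le _ Ecvg); rewrite ltrDl.
rewrite -mulrA -expRD.
apply: le_trans (ler_wpM2r (expR_ge0 _) hP).
rewrite -expRD ler_expR mulNr.
have hVE := ler_wpM2l (ltW VN) hE; have hVt := ler_wpM2l (ltW VN) e1t.
rewrite mulrDr in hVE.
set En := energy a b mu (dens_trunc K (discretize _ _ _)) _ in hVE *.
set E := energy _ _ _ _ _ in hVE *.
set S := \sum_(_ <= _ < _) _.
have -> : beta * V N * En = V N * (beta * En) by ring.
rewrite !mulrDl !mulrDr mul1r in hVE hVt *; lra.
Unshelve. all: by end_near. Qed.

Lemma rate0_finsupp_ge (y : l1 R) K : l1_nonneg y -> (forall k, (K <= k)%N -> y k = 0) ->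
  ((\sum_(0 <= k < K) entropy (q k) (y k) + (@qtot R d beta - \sum_(0 <= k < K) q k))%:E
    <= I y)%E.
Proof.
move=> y0 yK; have q0' k : 0 <= q k := ltW (q0 k).
have ent0 k : 0 <= entropy (q k) (y k) by exact: entropy_ge0.
have := rate0_ge0 d0 beta0 y; rewrite rate0_nonneg//.
case E : (\sum_(0 <= k <oo) _)%E => [i| |]//; last by move=> _; exact: leey.
move=> _; rewrite lee_fin addrCA -lerBrDr -lee_fin /qtot.
rewrite tsum_fin//; last exact: q_free0_summable.
apply: tsum_le => // n; rewrite lee_fin lerBrDr.
apply: (@le_trans _ _ (\sum_(0 <= k < maxn n K) entropy (q k) (y k))); last first.
  by rewrite -lee_fin -E; exact: psum_le_tsum.
have h := psum_le (u := fun k => q k) q0' (leq_maxl n K).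
have Km := leq_maxr n K.
rewrite (big_cat_nat (leq0n K) Km)/= in h.
rewrite (big_cat_nat (leq0n K) Km)/=.
rewrite [X in _ <= _ + X](eq_big_nat _ _ (F2 := fun k => q k)) => [|k /andP[Kk _]]; last first.
  by rewrite yK// /entropy mul0r add0r.
lra.
Qed.

Lemma entropy_tilt k t : 0 <= t ->
  entropy (p k) t = entropy (q k) t - beta * alpha * (k.+1%:R * t) + p k - q k.
Proof.
rewrite /entropy le_eqVlt => /predU1P[<-|t0]; first by rewrite !mul0r !mulr0; ring.
have -> : t / p k = expR (- (beta * alpha * k.+1%:R)) * (t / q k).
  by rewrite q_free_tilt expRN; field; rewrite !gt_eqF ?expR_gt0.
rewrite (@lnM R (expR _) (t / q k)) ?posrE ?expR_gt0 ?(divr_gt0 t0 (q0 k))// expRK; ring.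
Qed.

Local Notation F x := (beta%:E * H_HYL_lsc a b m x + I x)%E.

Lemma gibbs_open_lower (O : set (l1 R)) (c e : R) : open O -> 0 < e ->
  (ereal_inf ((fun x => F x) @` O) < c%:E)%E ->
  \forall N \near \oo, ((expR (- V N * (c + kappa + e)))%:E <= Q N O)%E.
Proof.
move=> oO e0 /ereal_inf_lt[_ [x Ox <-] Fx].
have I0 := rate0_ge0 d0 beta0 x.
have fx : finite_density x.
  apply: contrapT => /(H_lsc_infty b0 ab m) hx; move: Fx; rewrite hx gt0_muley//.
  by rewrite addye ?ltNge ?leey//; case: (I x) I0.
have Hx := H_lscE b0 ab m fx.
move: Fx; rewrite Hx -EFinM; set h := energy_lsc a b m x.
case Ix : (I x) I0 => [i| |]// _; rewrite -EFinD lte_fin => hc.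
pose e' := c - (beta * h + i); have e'0 : 0 < e' by rewrite subr_gt0.
have e2 : 0 < e' / 2 by rewrite divr_gt0.
have hH : \forall K \near \oo, fine (H_HYL a b m (recovery a b m x K)) <= h + e' / 2 / beta.
  have /fine_cvg hcv := recovery_energy ab (m := m) fx.
  by apply: (cvgr_le _ hcv); rewrite ltrDl divr_gt0.
have hO : \forall K \near \oo, O (recovery a b m x K).
  by have := @recovery_cvg _ _ b ab m x O; apply; exact: open_nbhs_nbhs.
have x0 : l1_nonneg x by case: fx.
have hI := @rate0_recovery_le R d beta d0 beta0 a b m _ x ab x0 e2.
have [K [[hHK hOK] hIK]] := filter_ex (filterI (filterI hH hO) hI).
set y := recovery a b m x K in hHK hOK hIK.
have y0 : l1_nonneg y by exact: recovery_nonneg.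
have fy : finite_density y by exact: recovery_finite_density.
have yK k : (K.+1 <= k)%N -> y k = 0 by exact: recovery_ge.
apply: filterS (gibbs_lower_at oO hOK y0 yK e0) => N; apply: le_trans.
rewrite lee_fin ler_expR.
rewrite !mulNr lerN2 ler_wpM2l ?ler0n// lerD2r.
set D := dens_trunc K.+1 y; set S := sq_trunc K.+1 y.
have eH : fine (H_HYL a b m y) = energy a b mu D S - alpha * D.
  have dE : density y = D%:E by apply: tsum_finsupp => k /yK ->; rewrite mulr0.
  have sE : sq_density y = S%:E by apply: tsum_finsupp => k /yK ->; rewrite expr0n mulr0.
  by rewrite /H_HYL asboolT// dE sE /= /energy; ring.
have h1 : beta * energy a b mu D S - beta * alpha * D <= beta * h + e' / 2.
  have -> : beta * energy a b mu D S - beta * alpha * D = beta * (energy a b mu D S - alpha * D) by ring.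
  rewrite -eH; have -> : beta * h + e' / 2 = beta * (h + e' / 2 / beta) by field; rewrite gt_eqF.
  by rewrite ler_pM2l.
have h2 := le_trans (rate0_finsupp_ge y0 yK) hIK.
rewrite Ix -EFinD lee_fin in h2.
rewrite (eq_bigr (fun k => entropy (q k) (y k) - beta * alpha * (k.+1%:R * y k) + p k - q k));
  last by move=> k _; exact: entropy_tilt.
rewrite sumrB big_split sumrB/= -mulr_sumr -/(dens_trunc K.+1 y) -/D /kappa.
move: h1 h2; rewrite /e'; move: (energy _ _ _ _ _) (\sum_(_ <= _ < _) _) => E S1.
move: (\sum_(_ <= _ < _) q _) (\sum_(_ <= _ < _) p _) (beta * alpha * D) => S2 S3 z; lra.
Qed.
End lower_bound.

Section ereal_limits.
Context {R : realType}.
Local Open Scope ereal_scope.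

Lemma lee_real_below (x y : \bar R) : (forall c : R, c%:E < y -> c%:E <= x) -> y <= x.
Proof.
move=> h; rewrite leNgt; apply/negP => xy; move: h xy.
case: x => [r| |]; case: y => [s| |]// h.
- by rewrite lte_fin => rs; have := h ((r + s) / 2)%R; rewrite lte_fin lee_fin; lra.
- by move=> _; have := h (r + 1)%R; rewrite ltry lee_fin => /(_ isT); lra.
- by move=> _; have := h (s - 1)%R; rewrite lte_fin ltrBlDr ltrDl ltr01 => /(_ isT).
- by move=> _; have := h 0%R; rewrite ltry => /(_ isT).
Qed.

Lemma limn_esup_le (u : (\bar R)^nat) (c : \bar R) :
  (\forall N \near \oo, u N <= c) -> limn_esup u <= c.
Proof.
move=> h; rewrite /limn_esup limf_esupE; apply: ge_ereal_inf.
exists (ereal_sup (u @` [set N | u N <= c])); first by exists [set N | u N <= c].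
by apply: ge_ereal_sup => _ [N hN <-].
Qed.

Lemma limn_einf_ge (u : (\bar R)^nat) (c : \bar R) :
  (\forall N \near \oo, c <= u N) -> c <= limn_einf u.
Proof.
move=> h; rewrite /limn_einf leeNr; apply: limn_esup_le.
by apply: filterS h => N; rewrite leeN2.
Qed.

Lemma scaled_lne_le (V c : R) (x : \bar R) : (0 < V)%R -> 0 <= x ->
  x <= (expR (- V * c))%:E -> (V^-1)%:E * lne x <= (- c)%:E.
Proof.
move=> V0 x0 hx; apply: (@le_trans _ _ ((V^-1)%:E * (- V * c)%:E)).
  rewrite lee_pmul2l ?lte_fin ?invr_gt0// -[X in _ <= X%:E]expRK.
  by rewrite -lne_EFin ?expR_gt0// lee_lne// in_itv/= ?x0 ?leey ?lee_fin ?expR_ge0.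
by rewrite -EFinM lee_fin mulNr mulrN mulrA mulVf ?gt_eqF// mul1r.
Qed.

Lemma scaled_lne_ge (V c : R) (x : \bar R) : (0 < V)%R ->
  (expR (- V * c))%:E <= x -> (- c)%:E <= (V^-1)%:E * lne x.
Proof.
move=> V0 hx; have x0 : 0 <= x by apply: le_trans hx; rewrite lee_fin expR_ge0.
apply: (@le_trans _ _ ((V^-1)%:E * (- V * c)%:E)).
  by rewrite -EFinM lee_fin mulNr mulrN mulrA mulVf ?gt_eqF// mul1r.
rewrite lee_pmul2l ?lte_fin ?invr_gt0// -[X in X%:E <= _]expRK.
by rewrite -lne_EFin ?expR_gt0// lee_lne// in_itv/= ?x0 ?leey ?lee_fin ?expR_ge0.
Qed.

Lemma lsc_regularization_lsc (X : topologicalType) (f : X -> \bar R) :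
  lower_semicontinuous (lsc_regularization f).
Proof.
move=> x c cx.
have [c' cc' c'x] : exists2 c' : R, (c < c')%R & c'%:E < lsc_regularization f x.
  move: cx; case: (lsc_regularization f x) => [r| |]//.
    by rewrite lte_fin => cr; exists ((c + r) / 2)%R; rewrite ?lte_fin; lra.
  by move=> _; exists (c + 1)%R; [rewrite ltrDl|exact: ltry].
exists ([set y | c'%:E <= f y]^°).
  by apply: nbhs_interior; exact: lsc_regularization_gt.
move=> y hy; apply: (@lt_le_trans _ _ c'%:E); first by rewrite lte_fin.
exact: lsc_regularization_ge.
Qed.

End ereal_limits.

Section hyl_ldp.
Context {R : realType}.
Variables (d : nat) (beta a b alpha mu : R).
Variables (gDir : nat -> R -> 'rV[R]_d -> 'rV[R]_d -> R) (bc : boundary_condition).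
Variable nu : nat -> probability (borel_l1 R) R.
Hypotheses (d0 : (0 < d)%N) (beta0 : 0 < beta) (b0 : 0 <= b) (ab : b < a).
Hypothesis alpha0 : alpha <= 0.
Hypothesis nuP : forall N, (0 < N)%N -> reference_law beta gDir bc alpha N (nu N).
Local Notation V N := (vol d N : R).
Local Notation qN N k := (q_bc beta gDir bc alpha N k.+1).
Local Notation p k := (q_free d beta alpha k.+1).
Local Notation q k := (q_free d beta 0 k.+1).
Hypothesis qN0 : forall N k, (0 < N)%N -> 0 <= qN N k.
Hypothesis qN_le : forall e : R, 0 < e ->
  \forall N \near \oo, forall k, qN N k <= (1 + e) * p k.
Hypothesis qN_ge : forall (e : R) k, 0 < e -> \forall N \near \oo, p k - e <= qN N k.
Local Notation m := (mu + alpha).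
Local Notation I := (rate0 d beta).
Local Notation Q N A := (gibbs d beta a b mu N (nu N) A).
Local Notation kappa := (kappa d beta alpha).
Local Notation F x := (beta%:E * H_HYL_lsc a b m x + I x)%E.
Local Notation J := (rate_HYL d beta a b mu alpha).
Local Notation law N := (HYL_law d beta a b mu N (nu N)).

Let V0 N : (0 < N)%N -> 0 < V N. Proof. exact: vol_gt0. Qed.
Let upper C c e := @gibbs_closed_upper R d beta a b alpha mu gDir bc nu d0 beta0 b0 ab
  alpha0 nuP qN0 qN_le qN_ge C c e.
Let lower O c e := @gibbs_open_lower R d beta a b alpha mu gDir bc nu d0 beta0 b0 ab
  alpha0 nuP qN0 qN_le qN_ge O c e.
Local Notation inff := (ereal_inf (range (fun y => F y))).
Let f0 := fine inff.

Let F_ge x : ((- (beta * (m ^+ 2 / (2 * (a - b)))))%:E <= F x)%E.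
Proof.
rewrite -[leLHS]adde0; apply: leeD; last exact: rate0_ge0.
rewrite -mulrN EFinM lee_pmul2l ?lte_fin//; exact: H_lsc_ge.
Qed.

Let F_zero : (F (0%R : l1 R) < +oo)%E.
Proof.
have z0 : l1_nonneg (0 : l1 R) by move=> k; exact: lexx.
have fz : finite_density (0 : l1 R).
  split => //; rewrite /density eseries0 ?ltry// => k _ _.
  by rewrite mulr0.
rewrite H_lscE// -EFinM lte_add_pinfty ?ltry// rate0_nonneg//.
apply: le_lt_trans (q_free0_summable d0 beta0).
rewrite le_eqVlt; apply/orP; left; apply/eqP; apply: eq_eseriesr => k _.
by rewrite /entropy mul0r add0r.
Qed.

Let f0E : inff = f0%:E.
Proof.
rewrite /f0 fineK// fin_numElt; apply/andP; split.
  apply: lt_le_trans (ltNyr _) _; apply: le_ereal_inf_tmp => _ [x _ <-]; exact: F_ge.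
by apply: le_lt_trans F_zero; apply: ereal_inf_lbound; exists 0.
Qed.

Let JE x : J x = (F x - f0%:E)%E. Proof. by rewrite -f0E. Qed.

Let f0_le x : (f0%:E <= F x)%E.
Proof. by rewrite -f0E; apply: ereal_inf_lbound; exists x. Qed.

Let partition_bounds (e : R) : 0 < e -> \forall N \near \oo,
  expR (- V N * (f0 + kappa + e)) <= fine (Q N setT) <= expR (- V N * (f0 + kappa - e)).
Proof.
move=> e0; have e2 : 0 < e / 2 by rewrite divr_gt0.
have hl := @lower setT (f0 + e / 2) (e / 2) openT e2.
have hu := @upper setT (f0 - e / 2) (e / 2) closedT e2.
rewrite !f0E !lte_fin in hl hu.
have {}hl := hl ltac:(lra); have {}hu := hu ltac:(lra).
apply: filterS2 hl hu => N hl hu.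
have fin : Q N setT \is a fin_num.
  by rewrite ge0_fin_numE ?gibbs_ge0//; apply: le_lt_trans hu _; exact: ltry.
rewrite -!lee_fin fineK//; apply/andP; split.
  by apply: le_trans hl; rewrite lee_fin ler_expR le_eqVlt; apply/orP; left; apply/eqP; field.
apply: le_trans hu _.
by rewrite lee_fin ler_expR le_eqVlt; apply/orP; left; apply/eqP; field.
Qed.

Let lawE N A : law N A = ((fine (Q N setT))^-1%:E * Q N A)%E. Proof. by []. Qed.

Let law_upper (A : set (l1 R)) (g e : R) : 0 < e ->
  (\forall N \near \oo, (Q N A <= (expR (- V N * (g + f0 + kappa)))%:E)%E) ->
  \forall N \near \oo, (((V N)^-1)%:E * lne (law N A) <= (- (g - e))%:E)%E.
Proof.
move=> e0 hA; apply: filterS3 hA (partition_bounds e0) (nbhs_infty_gt 0) => N hQ /andP[hZ _] N0.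
have Z0 : 0 < fine (Q N setT) by apply: lt_le_trans hZ; exact: expR_gt0.
apply: scaled_lne_le; first exact: V0.
  by rewrite lawE mule_ge0 ?gibbs_ge0// lee_fin invr_ge0 ltW.
rewrite lawE; apply: (@le_trans _ _ ((fine (Q N setT))^-1%:E *
    (expR (- V N * (g + f0 + kappa)))%:E)%E).
  by rewrite lee_pmul2l// lte_fin invr_gt0.
rewrite -EFinM lee_fin mulrC ler_pdivrMr//.
apply: le_trans (ler_wpM2l (expR_ge0 _) hZ).
by rewrite -expRD ler_expR le_eqVlt; apply/orP; left; apply/eqP; ring.
Qed.

Let law_lower (A : set (l1 R)) (g e : R) : 0 < e ->
  (\forall N \near \oo, ((expR (- V N * (g + f0 + kappa)))%:E <= Q N A)%E) ->
  \forall N \near \oo, ((- (g + e))%:E <= ((V N)^-1)%:E * lne (law N A))%E.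
Proof.
move=> e0 hA; apply: filterS3 hA (partition_bounds e0) (nbhs_infty_gt 0) => N hQ /andP[hZ hZ'] N0.
have Z0 : 0 < fine (Q N setT) by apply: lt_le_trans hZ; exact: expR_gt0.
apply: scaled_lne_ge; first exact: V0.
rewrite lawE; apply: (@le_trans _ _ ((fine (Q N setT))^-1%:E *
    (expR (- V N * (g + f0 + kappa)))%:E)%E); last first.
  by rewrite lee_pmul2l// lte_fin invr_gt0.
rewrite -EFinM lee_fin [leRHS]mulrC ler_pdivlMr//.
apply: le_trans (ler_wpM2l (expR_ge0 _) hZ') _.
by rewrite -expRD ler_expR le_eqVlt; apply/orP; left; apply/eqP; ring.
Qed.

Let rate_function_HYL : rate_function J.
Proof.
split=> [x|x c]; rewrite JE; first by rewrite sube_ge0.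
rewrite lteBrDr// -EFinD => /(lte_scaled_sum_split beta0)[||c1 [c2 [h1 h2 h3]]].
- by apply: lt_le_trans (H_lsc_ge _ _ b0 ab _); exact: ltNyr.
- by apply: lt_le_trans (rate0_ge0 d0 beta0 x); exact: ltNyr.
have [U1 xU1 hU1] := lsc_regularization_lsc h1.
have [U2 xU2 hU2] := rate0_lsc d0 beta0 h2.
exists (U1 `&` U2); first exact: filterI.
move=> y [/hU1 y1 /hU2 y2]; rewrite JE lteBrDr// -EFinD.
apply: (@lt_trans _ _ (beta * c1 + c2)%:E); first by rewrite lte_fin.
rewrite EFinD EFinM; apply: lteD => //.
by rewrite lte_pmul2l ?lte_fin.
Qed.

Lemma HYL_large_deviations : large_deviation_principle (fun N => law N) (vol d) J.
Proof.
split; first exact: rate_function_HYL.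
- move=> C cC; rewrite leeNr; apply: lee_real_below => c hc.
  apply/lee_subgt0Pr => e e0; rewrite leeNr -EFinB; apply: limn_esup_le.
  have e2 : 0 < e / 2 by rewrite divr_gt0.
  have e4 : 0 < e / 4 by rewrite divr_gt0.
  have {}hc : ((c + f0 - e / 4)%:E < ereal_inf ((fun x => F x) @` C))%E.
    apply: (@lt_le_trans _ _ (c + f0)%:E); first by rewrite lte_fin gtrBl.
    apply: le_ereal_inf_tmp => _ [x Cx <-].
    rewrite EFinD -leeBrDr// -JE; apply: le_trans (ltW hc) _.
    by apply: ereal_inf_lbound; exists x.
  have h : \forall N \near \oo, (Q N C <= (expR (- V N * ((c - e / 2) + f0 + kappa)))%:E)%E.
    apply: filterS (upper cC e4 hc) => N; have -> : c + f0 - e / 4 + kappa - e / 4 =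
      c - e / 2 + f0 + kappa by field.
    by [].
  apply: filterS (law_upper e2 h) => N.
  by have -> : c - e / 2 - e / 2 = c - e by field.
- move=> O oO; rewrite leeNl; apply: le_ereal_inf_tmp => _ [x Ox <-].
  have := rate_function_HYL.1 x; case Jx : (J x) => [r| |]// _; last exact: leey.
  apply/lee_addgt0Pr => e e0; rewrite leeNl -EFinD; apply: limn_einf_ge.
  have e2 : 0 < e / 2 by rewrite divr_gt0.
  have e4 : 0 < e / 4 by rewrite divr_gt0.
  have Fx : F x = (r + f0)%:E by rewrite EFinD -Jx JE subeK.
  have hr : (ereal_inf ((fun x => F x) @` O) < (r + f0 + e / 4)%:E)%E.
    apply: (@le_lt_trans _ _ (r + f0)%:E); last by rewrite lte_fin ltrDl.
    by rewrite -Fx; apply: ereal_inf_lbound; exists x.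
  have h : \forall N \near \oo, ((expR (- V N * ((r + e / 2) + f0 + kappa)))%:E <= Q N O)%E.
    apply: filterS (lower oO e4 hr) => N; have -> : r + f0 + e / 4 + kappa + e / 4 =
      r + e / 2 + f0 + kappa by field.
    by [].
  apply: filterS (law_lower e2 h) => N.
  by have -> : r + e / 2 + e / 2 = r + e by field.
Qed.

End hyl_ldp.

Theorem theorem1p6 (R : realType) (d : nat) (beta a b alpha mu : R)
    (bc : boundary_condition)
    (gDir : nat -> R -> 'rV[R]_d -> 'rV[R]_d -> R)
    (nu : nat -> probability (borel_l1 R) R)
    (d_gt0 : (0 < d)%N) (beta_gt0 : 0 < beta) (b_ge0 : 0 <= b) (ltba : b < a)
    (alpha_le0 : alpha <= 0)
    (gDirP : bc = Dirichlet ->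
       forall N, (0 < N)%N -> killed_transition_density N (gDir N))
    (nuP : forall N, (0 < N)%N -> reference_law beta gDir bc alpha N (nu N)) :
  (forall m x,
     (finite_density x ->
        let D := fine (density x) in
        H_HYL_lsc a b m x =
          (H_HYL a b m x - ((Num.max (m - a * D) 0) ^+ 2 / (2 * (a - b)))%:E)%E
        /\
        H_HYL_lsc a b m x =
          (- (b / 2) * fine (sq_density x) +
           if m / a <= D then - m * D + a / 2 * D ^+ 2
           else - (b / (a - b)) * (- m * D + a / 2 * D ^+ 2)
                - m ^+ 2 / (2 * (a - b)))%:E) /\
     (~ finite_density x -> H_HYL_lsc a b m x = +oo%E)) /\
  large_deviation_principle
    (fun N => HYL_law d beta a b mu N (nu N)) (vol d)
    (rate_HYL d beta a b mu alpha).
Proof.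
split=> [m x|].
  by split; [exact: H_lsc_formulas|exact: H_lsc_infty].
apply: HYL_large_deviations nuP _ _ _ => //.
- by move=> N k; exact: q_bc_ge0.
- by move=> e; exact: q_bc_le.
- by move=> e k; exact: q_bc_ge.
Qed.
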